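(* Let $\Omega\subset\mathbb R^n$ be a bounded smooth domain, $2\le p<n$, $p'=\frac{p}{p-1}$, $p^*=\frac{np}{n-p}$ and $(p^* )'=\frac{np}{np-n+p}$. Let $V:\Omega\times\mathbb R\to\mathbb R$ be a Carathéodory function such that (i) for every $\sigma\in\mathbb R$ the map $x\mapsto V(x;\sigma)$ is in $L^\infty(\Omega)$; (ii) for almost every $x\in\Omega$ the map $\sigma\mapsto V(x;\sigma)$ is continuous and non-decreasing, and $V(x;0)=0$. For $f\in L^1(\Omega)$ let $u$ be the unique entropic-renormalized solution of $$-\operatorname{div}(|\nabla u|^{p-2}\nabla u)+V(x;u)=f \ \text{ in }\Omega,\qquad u=0\ \text{ on }\partial\Omega,$$ and put $\mathcal T f=\nabla u$. Then $\mathcal T$ is $\frac1{p-1}$-Hölderian from $L^{(p^* )'}(\Omega)$ into $[L^p(\Omega)]^n$, i.e. there exists a constant $c_p>0$ such that $$\|\mathcal T f_1-\mathcal T f_2\|_{L^p(\Omega)}\le c_p\,\|f_1-f_2\|_{L^{(p^* )'}(\Omega)}^{\frac1{p-1}}\qquad\text{for all } f_1,f_2\in L^{(p^* )'}(\Omega).$$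
   Context: For $k>0$ let $T_k(\sigma)=\frac12\{|k+\sigma|-|k-\sigma|\}$ be the truncation. $\mathbb S^{1,p}_0$ is the set of measurable $v:\Omega\to\mathbb R$ such that $\tan^{-1}(v)\in W^{1,1}_0(\Omega)$, $T_k(v)\in W^{1,p}_0(\Omega)$ for all $k>0$, and $\sup_{k>0}k^{-1/p}\|\nabla T_k(v)\|_{L^p(\Omega)}<\infty$. Entropic-renormalized solution: $u$ is an entropic-renormalized solution of $-\operatorname{div}(|\nabla u|^{p-2}\nabla u)+V(x;u)=f\in L^1(\Omega)$, $u=0$ on $\partial\Omega$, if $u\in\mathbb S^{1,p}_0$, $V(\cdot,u)\in L^1(\Omega)$, and for all $\eta\in W^{1,r}(\Omega)$ with $r>n$, all $\varphi\in W^{1,p}_0(\Omega)\cap L^\infty(\Omega)$ and all $B\in W^{1,\infty}(\mathbb R)$ with $B(0)=0$ and $B'(\sigma)=0$ for all $|\sigma|\ge\sigma_0$ (for some $\sigma_0>0$), $$\int_\Omega|\nabla u|^{p-2}\nabla u\cdot\nabla\big(\eta B(u-\varphi)\big)dx+\int_\Omega V(x;u)\,\eta B(u-\varphi)\,dx=\int_\Omega f\,\eta B(u-\varphi)\,dx.$$ It is known that under the stated assumptions on $V$ such a solution exists and is unique for each $f\in L^1(\Omega)$, and that for $p>2-\frac1n$ it belongs to $W^{1,1}_0(\Omega)$. For a vector field $F$ and a function space $X$, $F\in X^n$ is normed by $\||F|\|_X$. *)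

(* Defs.v *)
From HB Require Import structures.
From mathcomp Require Import all_boot all_order all_algebra.
From mathcomp Require Import all_classical all_reals all_analysis.

Set Implicit Arguments.
Unset Strict Implicit.
Unset Printing Implicit Defensive.
Import Order.TTheory GRing.Theory Num.Theory.
Import numFieldNormedType.Exports.

Local Open Scope classical_set_scope.
Local Open Scope ring_scope.

(* 'rV[R]_n carries the product sigma-algebra, as n.-tuple R does in the
   library; it coincides with the Borel sigma-algebra of R^n. *)
Definition rV_display : measure_display.
Proof. exact: (measure_tuple_display default_measure_display). Qed.

Section measurable_rV.
Context {R : realType} {n : nat}.

Let coors : 'I_n -> 'rV[R]_n -> measurableTypeR R := fun i x => x 0 i.

Let rV_set0 : g_sigma_preimage coors set0.
Proof. exact: sigma_algebra0. Qed.

Let rV_setC A : g_sigma_preimage coors A -> g_sigma_preimage coors (~` A).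
Proof. exact: sigma_algebraC. Qed.

Let rV_bigcup (F : _^nat) : (forall i, g_sigma_preimage coors (F i)) ->
  g_sigma_preimage coors (\bigcup_i (F i)).
Proof. exact: sigma_algebra_bigcup. Qed.

HB.instance Definition _ := @isMeasurable.Build rV_display
  'rV[R]_n (g_sigma_preimage coors) rV_set0 rV_setC rV_bigcup.

Lemma measurable_coord (i : 'I_n) :
  measurable_fun [set: 'rV[R]_n] (fun x => x 0 i : measurableTypeR R).
Proof.
move=> _ Y mY; rewrite setTI; apply: sub_sigma_algebra => /=.
rewrite -bigcup_seq/=; exists i => /=; first by rewrite mem_index_enum.
by exists Y => //; rewrite setTI.
Qed.

Lemma measurable_fun_rVP d (T : measurableType d) (f : T -> 'rV[R]_n) :
  (forall i, measurable_fun [set: T] (fun x => f x 0 i : measurableTypeR R)) ->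
  measurable_fun [set: T] f.
Proof.
move=> mf.
have sub : g_sigma_preimage (fun i => coors i \o f) `<=` measurable.
  apply: smallest_sub; first exact: sigma_algebra_measurable.
  rewrite -bigcup_seq => A [i _ [B mB <-]].
  exact: mf.
by move=> _ A mA; apply: sub; rewrite g_sigma_preimage_comp; exists A.
Qed.

End measurable_rV.

Section lebesgue_step.
Context {R : realType} {n : nat}.
Variable mu : {sigma_finite_measure set 'rV[R]_n -> \bar R}.

Definition cons_rV (xy : measurableTypeR R * 'rV[R]_n) : 'rV[R]_n.+1 :=
  row_mx (xy.1)%:M xy.2 : 'rV[R]_(1 + n).

Definition uncons_rV (x : 'rV[R]_n.+1) : measurableTypeR R * 'rV[R]_n :=
  (x 0 ord0, \row_i x 0 (lift ord0 i)).

Lemma cons_rVK : cancel cons_rV uncons_rV.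
Proof.
move=> [x y]; rewrite /uncons_rV /cons_rV /=; congr pair.
  rewrite (_ : ord0 = @lshift 1 n 0); last exact: val_inj.
  by rewrite (@row_mxEl R 1 1 n) mxE eqxx.
apply/rowP => i; rewrite mxE.
rewrite (_ : lift ord0 i = @rshift 1 n i); last exact: val_inj.
by rewrite (@row_mxEr R 1 1 n).
Qed.

Lemma measurable_cons_rV : measurable_fun [set: _] cons_rV.
Proof.
apply: measurable_fun_rVP => i.
have [->|[j ->]] : i = ord0 \/ exists j, i = lift ord0 j.
  by case: (unliftP ord0 i) => [j ->|->]; [right; exists j|left].
- rewrite (_ : (fun _ => _) = fst); first exact: measurable_fst.
  by apply/funext => z; rewrite -[in RHS](cons_rVK z).
- rewrite (_ : (fun _ => _) =
      (fun y : 'rV[R]_n => y 0 j : measurableTypeR R) \o snd).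
    apply: measurableT_comp; last exact: measurable_snd.
    exact: measurable_coord.
  apply/funext => z /=; rewrite -[in RHS](cons_rVK z) /= mxE.
  by [].
Qed.

Lemma measurable_uncons_rV : measurable_fun [set: _] uncons_rV.
Proof.
apply: measurable_fun_pair; first exact: measurable_coord.
apply: measurable_fun_rVP => i.
under eq_fun do rewrite mxE.
exact: measurable_coord.
Qed.

Definition lebesgue_step : set 'rV[R]_n.+1 -> \bar R :=
  pushforward (@lebesgue_measure R \x mu)%E cons_rV.

Let step0 : lebesgue_step set0 = 0%E.
Proof. by rewrite /lebesgue_step /pushforward preimage_set0 measure0. Qed.

Let step_ge0 A : (0 <= lebesgue_step A)%E.
Proof. exact: (measure_ge0 (@lebesgue_measure R \x mu)%E). Qed.

Let step_sigma_additive : semi_sigma_additive lebesgue_step.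
Proof.
move=> F mF tF mUF; rewrite /lebesgue_step /pushforward preimage_bigcup.
apply: measure_semi_sigma_additive.
- by move=> k; rewrite -[X in measurable X]setTI; exact: measurable_cons_rV.
- apply/trivIsetP => /= i j _ _ ij; rewrite -preimage_setI.
  by move/trivIsetP : tF => /(_ _ _ _ _ ij) ->//; rewrite preimage_set0.
- by rewrite -preimage_bigcup -[X in measurable X]setTI;
    exact: measurable_cons_rV.
Qed.

HB.instance Definition _ := isMeasure.Build _ _ _ lebesgue_step
  step0 step_ge0 step_sigma_additive.

Let step_sigma_finite : sigma_finite setT lebesgue_step.
Proof.
have /sigma_finiteP[F [TF ndF Foo]] := sigma_finiteT (@lebesgue_measure R).
have /sigma_finiteP[G [TG ndG Goo]] := sigma_finiteT mu.
exists (fun k => uncons_rV @^-1` (F k `*` G k)).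
  rewrite -preimage_bigcup; apply/esym/seteqP; split => // z _ /=.
  have [k _ Fk] : (\bigcup_i F i) (uncons_rV z).1 by rewrite -TF.
  have [l _ Gl] : (\bigcup_i G i) (uncons_rV z).2 by rewrite -TG.
  exists (maxn k l) => //; split.
  - by move: Fk; exact/subsetPset/ndF/leq_maxl.
  - by move: Gl; exact/subsetPset/ndG/leq_maxr.
move=> k; have [mF Fk] := Foo k; have [mG Gk] := Goo k.
have mFG : measurable (F k `*` G k) by exact: measurableX.
split; first by rewrite -[X in measurable X]setTI; exact: measurable_uncons_rV.
rewrite /lebesgue_step /pushforward -comp_preimage.
rewrite (_ : uncons_rV \o cons_rV = id); last first.
  by apply/funext => z; exact: cons_rVK.
rewrite preimage_id product_measure1E// lte_mul_pinfty// ge0_fin_numE//.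
Qed.

HB.instance Definition _ := Measure_isSigmaFinite.Build _ _ _ lebesgue_step
  step_sigma_finite.

End lebesgue_step.

(* n-dimensional Lebesgue measure, as an iterated product measure *)
Fixpoint lebesgue (R : realType) (n : nat) :
    {sigma_finite_measure set 'rV[R]_n -> \bar R} :=
  match n return {sigma_finite_measure set 'rV[R]_n -> \bar R} with
  | 0 => \d_(0 : 'rV[R]_0)
  | m.+1 => lebesgue_step (lebesgue R m)
  end.

Section euclidean.
Context {R : realType} {n : nat}.
Implicit Types x y : 'rV[R]_n.

(* The library norm `|x| on 'rV[R]_n is the sup norm. *)
Definition dotr x y : R := \sum_(i < n) x 0 i * y 0 i.
Definition enorm x : R := Num.sqrt (dotr x x).

Definition partial (i : 'I_n) (f : 'rV[R]_n -> R) : 'rV[R]_n -> R :=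
  fun x => 'D_(delta_mx 0 i) f x.

Fixpoint Ck (k : nat) (f : 'rV[R]_n -> R) : Prop :=
  match k with
  | 0 => continuous f
  | k'.+1 => forall i, (forall x, derivable f x (delta_mx 0 i)) /\
                       Ck k' (partial i f)
  end.

Definition Cinfty (f : 'rV[R]_n -> R) := forall k, Ck k f.

Definition grad (f : 'rV[R]_n -> R) : 'rV[R]_n -> 'rV[R]_n :=
  fun x => \row_i partial i f x.

(* C_c^infty(Om) *)
Definition test_function (Om : set 'rV[R]_n) (f : 'rV[R]_n -> R) :=
  Cinfty f /\
  exists K, [/\ compact K, K `<=` Om & forall x, ~ K x -> f x = 0].

End euclidean.

(* The boundary is locally the graph of a smooth function of n - 1 of the
   coordinates, with Om lying on one side of it. *)
Definition smooth_boundary (R : realType) (n : nat) (Om : set 'rV[R]_n) :=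
  forall x0, (closure Om `\` interior Om) x0 ->
  exists (i : 'I_n) (s : bool) (gam : 'rV[R]_n.-1 -> R), Cinfty gam /\
    \forall x \near x0, Om x <-> gam (col' i x) < (-1) ^+ s * x 0 i.

Definition bounded_smooth_domain (R : realType) (n : nat)
    (Om : set 'rV[R]_n) :=
  [/\ Om !=set0, open Om, connected Om, bounded_set Om & smooth_boundary Om].

Section Lp.
Context d {T : measurableType d} {R : realType}.
Variable mu : {measure set T -> \bar R}.
Implicit Types (D : set T) (f : T -> R) (q : \bar R).

(* Measurability with respect to the completion of mu, on D: the measurable
   sets of T are the Borel sets when T is R or 'rV[R]_n. *)
Definition ae_measurable D f :=
  exists2 g : T -> R, measurable_fun D g &
    {ae mu, forall x, D x -> f x = g x}.

Definition normLp D q f : \bar R := 'N[mu]_q[EFin \o (f \_ D)]%E.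

Definition inLp D q f := ae_measurable D f /\ (normLp D q f < +oo)%E.

End Lp.

Section sobolev.
Context {R : realType} {n : nat}.
Variable Om : set 'rV[R]_n.
Notation rV := 'rV[R]_n.
Notation mu := (lebesgue R n).
Implicit Types (v : rV -> R) (F G : rV -> rV) (q : \bar R).

Definition normLp_vec q F : \bar R := normLp mu Om q (enorm \o F).

Definition inLp_vec q F :=
  (forall i, ae_measurable mu Om (fun x => F x 0 i)) /\
  (normLp_vec q F < +oo)%E.

Definition inL1loc v := forall K, compact K -> K `<=` Om -> inLp mu K 1%E v.

Definition is_weak_grad v G :=
  [/\ inL1loc v, (forall i, inL1loc (fun x => G x 0 i)) &
      forall (i : 'I_n) (f : rV -> R), test_function Om f ->
        \int[mu]_(x in Om) (v x * partial i f x) =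
        - \int[mu]_(x in Om) (G x 0 i * f x)].

(* The weak gradient (a.e. unique), and 0 if there is none *)
Definition wgrad v : rV -> rV := xget (cst 0) [set G | is_weak_grad v G].

Definition inW1 q v :=
  [/\ inLp mu Om q v, exists G, is_weak_grad v G & inLp_vec q (wgrad v)].

(* W^{1,q}_0(Om), q finite: the closure of C_c^infty(Om) in W^{1,q}(Om) *)
Definition inW10 (q : R) v :=
  inW1 q%:E v /\
  forall e : R, 0 < e -> exists2 f, test_function Om f &
    (normLp mu Om q%:E (fun x => v x - f x)%R
       + normLp_vec q%:E (fun x => wgrad v x - grad f x)%R < e%:E)%E.

Definition trunc (k s : R) : R := 2^-1 * (`|k + s| - `|k - s|).

Definition inS10 (p : R) v :=
  [/\ ae_measurable mu Om v,
      inW10 1 (fun x => atan (v x)),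
      (forall k : R, 0 < k -> inW10 p (fun x => trunc k (v x))) &
      (ereal_sup [set (k `^ (- p^-1))%:E
          * normLp_vec p%:E (wgrad (fun x => trunc k (v x))%R)
        | k in [set k : R | (0 < k)%R]] < +oo)%E].

(* Functions of inS10 need not be locally integrable in general; their
   gradient is the field F with grad (trunc k v) = F 1_{|v| < k} for every
   k > 0. It is the weak gradient as soon as v is in W^{1,1}(Om). *)
Definition is_gengrad v F :=
  (forall i, ae_measurable mu Om (fun x => F x 0 i)) /\
  forall k : R, 0 < k -> is_weak_grad (fun x => trunc k (v x))
                       (fun x => if `|v x| < k then F x else 0).

Definition gengrad v : rV -> rV := xget (cst 0) [set F | is_gengrad v F].

End sobolev.

(* B is in W^{1,oo}(R) (with its continuous representative) and B' = 0 a.e.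
   on |s| >= s0 for some s0 > 0 *)
Definition admissible_B (R : realType) (B : R -> R) :=
  let lam := @lebesgue_measure R in
  [/\ continuous B, B 0 = 0, inLp lam setT +oo%E B &
   exists b : R -> R, [/\ inLp lam setT +oo%E b,
     (forall f : R -> R,
        (forall k x, derivable (f^`(k))%classic (x : R) 1) ->
        (exists2 K, compact K & forall x, ~ K x -> f x = 0) ->
        \int[lam]_x (B x * (f^`())%classic x) = - \int[lam]_x (b x * f x)) &
     exists2 s0 : R, 0 < s0 & {ae lam, forall s, s0 <= `|s| -> b s = 0}]].

Section problem.
Context {R : realType} {n : nat}.
Variables (Om : set 'rV[R]_n) (p : R) (V : 'rV[R]_n -> R -> R).
Notation mu := (lebesgue R n).

Definition potential_hyp :=
  (forall s, inLp mu Om +oo%E (V ^~ s)) /\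
  {ae mu, forall x, Om x ->
     [/\ continuous (V x), {homo V x : s t / s <= t} & V x 0 = 0]}.

Definition entropic_renormalized (f u : 'rV[R]_n -> R) :=
  [/\ inLp mu Om 1%E f, inS10 Om p u,
      inLp mu Om 1%E (fun x => V x (u x)) &
   forall (r : \bar R) (eta phi : 'rV[R]_n -> R) (B : R -> R),
     (n%:R%:E < r)%E -> inW1 Om r eta ->
     inW10 Om p phi -> inLp mu Om +oo%E phi ->
     admissible_B B ->
     let w x := eta x * B (u x - phi x) in
     \int[mu]_(x in Om) (enorm (gengrad Om u x) `^ (p - 2)
                         * dotr (gengrad Om u x) (wgrad Om w x))
     + \int[mu]_(x in Om) (V x (u x) * w x)
     = \int[mu]_(x in Om) (f x * w x)].

End problem.

(* Main.v *)
(* With T_k the truncation, T_k (u - phi) is an admissible test function for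
   every bounded phi in W^{1,p}_0, its gradient being that of u - phi cut off
   to |u - phi| < k. With phi = 0, the monotone term V can be dropped, and
   Hoelder and Sobolev (q being conjugate to p^* ) give
     || grad T_k u ||_p^p <= || f ||_q || T_k u ||_{p^*}
                          <= gam || f ||_q || grad T_k u ||_p,
   a bound uniform in k; hence grad u is in L^p. For two solutions, take
   phi = T_h u_2 in the first identity and phi = T_h u_1 in the second, add, and
   let h tend to infinity: dropping the monotone term again, the inequality
     (|x|^(p-2) x - |y|^(p-2) y) . (x - y) >= 2^(1-p) |x - y|^p
   and Hoelder and Sobolev as before yield, as k tends to infinity,
     2^(1-p) || grad u_1 - grad u_2 ||_p^p
       <= gam || f_1 - f_2 ||_q || grad u_1 - grad u_2 ||_p.
   The Sobolev inequality itself comes from a Loomis-Whitney inequality. *)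

Require Import Defs.
From mathcomp Require Import all_boot all_order all_algebra.
From mathcomp Require Import all_classical all_reals all_analysis.
From mathcomp Require Import measurable_realfun ess_sup_inf ring lra.
Set Implicit Arguments.
Unset Strict Implicit.
Unset Printing Implicit Defensive.
Import Order.TTheory GRing.Theory Num.Theory.
Import numFieldNormedType.Exports.
Local Open Scope classical_set_scope.
Local Open Scope ring_scope.

(** * Lebesgue measure on R^n *)

(** Two obstacles shape the proof. First, a solution need not lie in a Sobolev space, only its
    truncations do, while [wgrad] and [gengrad] are unspecified choices and functions are only
    almost everywhere measurable. So each solution is replaced by a Borel representative vanishing
    off [Om], with a field [F'] whose cutoffs are the gradients of the truncations; all integrals
    then run over the whole space. In a test function trunc k (u - phi) with |phi| <= h, the set |u
    - phi| < k lies in |u| < h + k, so [u] may be replaced there by a truncation. Second, a gradient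
    norm can be absorbed into the left-hand side only if it is known to be finite. For truncations
    this is part of the definition; for the difference of two solutions it is the first estimate,
    which also supplies the integrable majorant as h tends to infinity. Absorbing turns y^p <= C D y
    into y <= (C D)^(1/(p-1)), whence the Hoelder exponent. Here C = 2^(p-1) gam, and gam = p (n -
    1) / (n - p) is both the power of |f| used in the Sobolev inequality and its constant. *)

Section rV_measure.
Context {R : realType}.
Implicit Types n : nat.

Definition box n (a b : 'rV[R]_n) : set 'rV[R]_n :=
  [set x | forall i, a 0 i < x 0 i < b 0 i].

Definition cbox n (a b : 'rV[R]_n) : set 'rV[R]_n :=
  [set x | forall i, a 0 i <= x 0 i <= b 0 i].

Lemma measurable_rV_itv n (I : 'I_n -> interval R) :
  measurable [set x : 'rV[R]_n | forall i, x 0 i \in I i].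
Proof.
have -> : [set x : 'rV[R]_n | forall i, x 0 i \in I i] =
    \bigcap_(i in [set: 'I_n]) [set x : 'rV[R]_n | x 0 i \in I i].
  by apply/seteqP; split => [x h i _|x h i]; [exact: h|exact: h i Logic.I].
apply: fin_bigcap_measurable => // i _.
by have := @measurable_coord R n i measurableT _ (measurable_itv (I i)); rewrite setTI.
Qed.

Lemma measurable_box n (a b : 'rV[R]_n) : measurable (box a b).
Proof.
by have := measurable_rV_itv (fun i => `]a 0 i, b 0 i[); congr measurable.
Qed.

Lemma measurable_cbox n (a b : 'rV[R]_n) : measurable (cbox a b).
Proof.
by have := measurable_rV_itv (fun i => `[a 0 i, b 0 i]); congr measurable.
Qed.

(** [unpickle] makes the boxes with rational corners a countable family. The fallback [(0, 0)] is
    harmless, since the union in [open_qbox] only takes boxes that lie in [U]. *)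
Definition qbox n (k : nat) : 'rV[R]_n * 'rV[R]_n :=
  if unpickle k is Some (a, b) then
    (map_mx (@ratr R) (a : 'rV[rat]_n), map_mx (@ratr R) (b : 'rV[rat]_n))
  else (0, 0).

(** The index set asks for the closed box to lie in [U]: a bump function on the open box is
    supported in the closed one, which has to be a compact subset of the domain. *)
Lemma open_qbox n (U : set 'rV[R]_n) : open U ->
  U = \bigcup_(k in [set k | cbox (qbox n k).1 (qbox n k).2 `<=` U])
        box (qbox n k).1 (qbox n k).2.
Proof.
move=> oU; apply/seteqP; split; last first.
  move=> x [k /= kU xk]; apply: kU => i.
  by have /andP[/ltW -> /ltW ->] := xk i.
move=> x Ux.
have /nbhs_ballP[e/= e0 eU] : nbhs x U by exact: open_nbhs_nbhs.
have /choice[a Ha] : forall i, exists q : rat, x 0 i - e < ratr q < x 0 i.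
  move=> i.
  have /rat_in_itvoo[q] : x 0 i - e < x 0 i by rewrite ltrBlDr ltrDl.
  by rewrite in_itv/=; exists q.
have /choice[b Hb] : forall i, exists q : rat, x 0 i < ratr q < x 0 i + e.
  move=> i.
  have /rat_in_itvoo[q] : x 0 i < x 0 i + e by rewrite ltrDl.
  by rewrite in_itv/=; exists q.
exists (pickle (\row_i a i, \row_i b i)).
  rewrite /= /qbox pickleK /= => y Hy; apply: eU; split => // i j.
  rewrite ord1; move: (Hy j) (Ha j) (Hb j); rewrite !mxE => /andP[h1 h2] /andP[h3 h4] /andP[h5 h6].
  by rewrite /ball/= ltr_norml; apply/andP; split; lra.
rewrite /= /qbox pickleK /= => i; rewrite !mxE.
by have /andP[_ ->] := Ha i; have /andP[-> _] := Hb i.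
Qed.

Lemma open_measurable_rV n (U : set 'rV[R]_n) : open U -> measurable U.
Proof.
by move=> /open_qbox ->; apply: bigcup_measurable => k _; exact: measurable_box.
Qed.

Lemma closed_measurable_rV n (U : set 'rV[R]_n) : closed U -> measurable U.
Proof.
by move=> cU; rewrite -(setCK U); apply: measurableC; apply: open_measurable_rV; exact: closed_openC.
Qed.

Lemma continuous_measurable_rV n (f : 'rV[R]_n -> R) :
  continuous f -> measurable_fun setT f.
Proof.
move=> cf; apply: (measurability _ (@RGenOInfty.measurableE R)) => _ [_ [r ->] <-].
rewrite setTI; apply: open_measurable_rV; apply: open_comp => // x _; exact: cf.
Qed.

Lemma setI_box n (a b a' b' : 'rV[R]_n) :
  box a b `&` box a' b' = box (\row_i Num.max (a 0 i) (a' 0 i)) (\row_i Num.min (b 0 i) (b' 0 i)).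
Proof.
apply/seteqP; split => [x [h h'] i|x h]; last split => i.
- by rewrite !mxE gt_max lt_min; have /andP[-> ->] := h i; have /andP[-> ->] := h' i.
- by have := h i; rewrite !mxE gt_max lt_min => /andP[/andP[-> _] /andP[-> _]].
- by have := h i; rewrite !mxE gt_max lt_min => /andP[/andP[_ ->] /andP[_ ->]].
Qed.

Lemma coord_le_norm n (x : 'rV[R]_n) j : `|x 0 j| <= `|x|.
Proof.
rewrite [leRHS]/Num.norm/= mx_normrE.
exact: (@le_bigmax _ _ _ _ (fun ij => `|x ij.1 ij.2|) (0, j)).
Qed.

(** Open boxes are stable under intersection, so a generating family of boxes is what a Dynkin
    argument requires. *)
Lemma measurable_rV_boxE n :
  @measurable _ 'rV[R]_n = <<s [set A | exists a b, A = box a b] >>.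
Proof.
apply/seteqP; split; last first.
  apply: smallest_sub; first exact: sigma_algebra_measurable.
  by move=> _ [a [b ->]]; exact: measurable_box.
apply: smallest_sub; first exact: smallest_sigma_algebra.
rewrite -bigcup_seq => A [i _ [B mB <-]]; rewrite setTI.
set S := <<s _ >>.
have sS : sigma_algebra setT S by exact: smallest_sigma_algebra.
have [S0 SC SU] := sS.
suff: B \in [set B | S ([set x : 'rV[R]_n | B (x 0 i)])] by rewrite inE.
rewrite inE.
move: B mB; rewrite RGenOInfty.measurableE.
apply: smallest_sub.
  split => /=.
  - rewrite (_ : mkset _ = set0)//.
  - by move=> B SB; have := SC _ SB; congr S.
  - by move=> F SF; have := SU _ SF; congr S; apply/seteqP; split => x [k _ ?]; exists k.
move=> _ [r ->] /=.
(* A half-space is exhausted by boxes whose other sides grow with [k]. *)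
rewrite (_ : mkset _ = \bigcup_k box (\row_j if j == i then r else - k%:R) (const_mx k%:R)).
  by apply: SU => k; apply: sub_sigma_algebra; eexists; eexists.
apply/seteqP; split => x /=; last first.
  by move=> [k _ /(_ i)]; rewrite !mxE eqxx in_itv/= => /andP[->].
rewrite in_itv/= andbT => rx.
exists (Num.truncn `|x|).+1 => // j; rewrite !mxE.
have xj : `|x 0 j| < (Num.truncn `|x|).+1%:R.
  exact: le_lt_trans (coord_le_norm x j) (Num.Theory.truncnS_gt _).
move: xj; rewrite ltr_norml => /andP[h1 h2]; rewrite h2 andbT.
by case: eqP => [->|].
Qed.

Lemma cons_rV0 n (z : measurableTypeR R * 'rV[R]_n) : cons_rV z 0 0 = z.1.
Proof. by have := cons_rVK z => /(congr1 fst). Qed.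

Lemma cons_rVS n (z : measurableTypeR R * 'rV[R]_n) i : cons_rV z 0 (lift ord0 i) = z.2 0 i.
Proof.
by have := cons_rVK z => /(congr1 (fun z : _ * 'rV[R]_n => z.2 0 i)); rewrite /= mxE.
Qed.

Lemma uncons_rVK n : cancel (@uncons_rV R n) (@cons_rV R n).
Proof.
move=> x; apply/rowP => i.
case: (unliftP 0 i) => [j ->|->]; first by rewrite cons_rVS/= mxE.
by rewrite cons_rV0.
Qed.

(** Supports are kept in such cubes: they are compact, of finite measure, and split as products
    along [cons_rV], which suits induction on the dimension. *)
Definition cube n (M : R) : set 'rV[R]_n :=
  [set x | forall i, - M <= x 0 i <= M].

Lemma measurable_cube n M : measurable (cube M : set 'rV[R]_n).
Proof.
rewrite (_ : cube M = cbox (const_mx (- M)) (const_mx M)).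
  exact: measurable_cbox.
by apply/seteqP; split => x h i; have := h i; rewrite !mxE.
Qed.

Lemma cube_norm n M (x : 'rV[R]_n) : `|x| <= M -> cube M x.
Proof.
by move=> xM i; rewrite -ler_norml; exact: le_trans (coord_le_norm _ _) xM.
Qed.

Lemma cons_rV_cube n M (t : R) (y : 'rV[R]_n) :
  cube M (cons_rV (t, y)) <-> - M <= t <= M /\ cube M y.
Proof.
split=> [h|[h1 h2] i].
  split; first by have := h 0; rewrite cons_rV0.
  by move=> i; have := h (lift ord0 i); rewrite cons_rVS.
case: (unliftP 0 i) => [j ->|->]; last by rewrite cons_rV0.
by rewrite cons_rVS; exact: h2.
Qed.

Lemma lebesgue_cube_lty n (M : R) : (lebesgue R n (@cube n M) < +oo)%E.
Proof.
elim: n => [|n IH] /=; first by rewrite diracE ltry.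
rewrite /lebesgue_step /pushforward.
rewrite (_ : _ @^-1` _ = `[- M, M] `*` @cube n M).
  rewrite product_measure1E//; last exact: measurable_cube.
  rewrite lte_mul_pinfty//.
  rewrite ge0_fin_numE//.
  rewrite [ltLHS](@lebesgue_measure_itv R); case: ifP => // _.
  by rewrite -EFinB ltry.
by apply/seteqP; split => [[t y]|[t y]] /=; rewrite cons_rV_cube in_itv//=.
Qed.

Lemma ge0_integral_rVS n (f : 'rV[R]_n.+1 -> \bar R) :
  measurable_fun setT f -> (forall x, 0 <= f x)%E ->
  (\int[lebesgue R n.+1]_x f x =
   \int[lebesgue_measure]_t \int[lebesgue R n]_y f (cons_rV (t, y)))%E.
Proof.
move=> mf f0 /=; rewrite /lebesgue_step/=.
rewrite (@ge0_integral_pushforward _ _ _ _ _ (@cons_rV R n) (@measurable_cons_rV R n)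
   (@lebesgue_measure R \x lebesgue R n)%E)//.
rewrite preimage_setT fubini_tonelli1//=.
exact: measurableT_comp mf (@measurable_cons_rV R n).
Qed.

Lemma ge0_integral_rVS_swap n (f : 'rV[R]_n.+1 -> \bar R) :
  measurable_fun setT f -> (forall x, 0 <= f x)%E ->
  (\int[lebesgue R n.+1]_x f x =
   \int[lebesgue R n]_y \int[lebesgue_measure]_t f (cons_rV (t, y)))%E.
Proof.
move=> mf f0; rewrite ge0_integral_rVS//.
rewrite (@fubini_tonelli _ _ _ _ _ (@lebesgue_measure R) (lebesgue R n) (f \o @cons_rV R n))//.
  exact: measurableT_comp mf (@measurable_cons_rV R n).
by move=> x; exact: f0.
Qed.

(** Both orders serve: differentiation in the first coordinate calls for the inner integral in [t],
    in any other coordinate for the inner integral in [y]. *)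
Lemma integral_rVS n (f : 'rV[R]_n.+1 -> \bar R) :
  (lebesgue R n.+1).-integrable setT f ->
  (\int[lebesgue R n.+1]_x f x =
   \int[lebesgue_measure]_t \int[lebesgue R n]_y f (cons_rV (t, y)))%E /\
  (\int[lebesgue R n.+1]_x f x =
   \int[lebesgue R n]_y \int[lebesgue_measure]_t f (cons_rV (t, y)))%E.
Proof.
move=> intf; have mf := measurable_int _ intf.
have i2 : (@lebesgue_measure R \x lebesgue R n)%E.-integrable setT (f \o @cons_rV R n).
  apply/integrableP; split.
    exact: measurableT_comp mf (@measurable_cons_rV R n).
  move/integrableP : (intf) => [_] /=; rewrite /lebesgue_step.
  rewrite (@ge0_integral_pushforward _ _ _ _ _ (@cons_rV R n) (@measurable_cons_rV R n)
     (@lebesgue_measure R \x lebesgue R n)%E)//.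
  exact: measurableT_comp.
have -> : (\int[lebesgue R n.+1]_x f x =
   \int[(@lebesgue_measure R \x lebesgue R n)%E]_z (f (cons_rV z)))%E.
  rewrite /= /lebesgue_step (@integral_pushforward _ _ _ _ _ (@cons_rV R n) (@measurable_cons_rV R n)
     (@lebesgue_measure R \x lebesgue R n)%E)//.
split; first by rewrite -(integral12_prod_meas1 i2).
by rewrite -(integral21_prod_meas1 i2).
Qed.

End rV_measure.

(** * Integrals of almost everywhere measurable functions *)

Section ae_integral.
Context d (T : measurableType d) (R : realType).
Variable mu : {measure set T -> \bar R}.
Local Open Scope ereal_scope.
Import HBNNSimple.

(* Neither function is assumed measurable: the integral of a nonnegative
   function is a supremum over the simple functions below it, and these may
   be cut off on a null set. *)
Lemma ge0_ae_eq_integralT (f g : T -> \bar R) :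
  (forall x, 0 <= f x) -> (forall x, 0 <= g x) ->
  {ae mu, forall x, f x = g x} -> \int[mu]_x f x = \int[mu]_x g x.
Proof.
suff main (f' g' : T -> \bar R) : (forall x, 0 <= f' x) -> (forall x, 0 <= g' x) ->
    {ae mu, forall x, f' x = g' x} -> \int[mu]_x f' x <= \int[mu]_x g' x.
  move=> f0 g0 fg; apply/eqP; rewrite eq_le main//= main//.
  by apply: filterS fg.
move=> f0 g0 [N [mN N0 Nfg]].
rewrite !ge0_integralTE//; apply: ub_ereal_sup => _ [h hf <-].
have mCN : measurable (~` N) by exact: measurableC.
apply: (@le_trans _ _ (sintegral mu (proj_nnsfun h mCN))); last first.
  apply: ereal_sup_ubound.
  exists (proj_nnsfun h mCN) => // x /=; rewrite mindicE.
  case: (boolP (x \in ~` N)) => [|_]; last by rewrite mulr0.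
  rewrite inE => Nx; rewrite mulr1; suff <- : f' x = g' x by exact: hf.
  by apply: contrapT => fg; apply: Nx; exact: Nfg.
rewrite -!integralT_nnsfun le_eqVlt; apply/orP; left; apply/eqP.
apply: ae_eq_integral => //.
- exact/measurable_EFinP.
- exact/measurable_EFinP.
exists N; split => // x; apply: contra_notP => Nx _ /=.
by rewrite mindicE mem_set// mulr1.
Qed.

Lemma ae_eq_integralT (f g : T -> \bar R) :
  {ae mu, forall x, f x = g x} -> \int[mu]_x f x = \int[mu]_x g x.
Proof.
move=> fg; rewrite [LHS]integralE [RHS]integralE; congr (_ - _);
  apply: ge0_ae_eq_integralT => //; apply: filterS fg => x fgx.
  by rewrite !funeposE fgx.
by rewrite !funenegE fgx.
Qed.

(** The passage from an integral over [D] of functions that are merely almost everywhere measurable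
    to one over the whole space of a representative. *)
Lemma ae_eq_integral_on (D : set T) (f g : T -> \bar R) :
  {ae mu, forall x, D x -> f x = g x} -> (forall x, ~ D x -> g x = 0) ->
  \int[mu]_(x in D) f x = \int[mu]_x g x.
Proof.
move=> fg g0; rewrite integral_mkcond; apply: ae_eq_integralT.
apply: filterS fg => x fgx; rewrite patchE; case: ifPn; first by rewrite inE.
by rewrite notin_setE => /g0 ->.
Qed.

Lemma ae_eq_Rintegral_on (D : set T) (f g : T -> R) :
  {ae mu, forall x, D x -> f x = g x} -> (forall x, ~ D x -> g x = 0%R) ->
  (\int[mu]_(x in D) f x = \int[mu]_x g x)%R.
Proof.
move=> fg g0; rewrite /Rintegral; congr fine; apply: ae_eq_integral_on.
  by apply: filterS fg => x fgx Dx; rewrite fgx.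
by move=> x Dx; rewrite g0.
Qed.

Lemma Lnorm_EFinE (p : R) (f : T -> R) :
  'N[mu]_p%:E[EFin \o f] = (\int[mu]_x ((`|f x| `^ p)%:E)) `^ p^-1.
Proof. by rewrite unlock. Qed.

Lemma normLpE (D : set T) (p : R) (f g : T -> R) :
  {ae mu, forall x, D x -> f x = g x} -> (forall x, ~ D x -> g x = 0%R) ->
  normLp mu D p%:E f = 'N[mu]_p%:E[EFin \o g].
Proof.
move=> fg g0; rewrite /normLp !Lnorm_EFinE.
rewrite (@ae_eq_integralT _ (fun x => (`|g x| `^ p)%:E))//; apply: filterS fg => x fgx /=.
rewrite patchE; case: ifPn; first by rewrite inE => /fgx ->.
by rewrite notin_setE => /g0 ->.
Qed.

Lemma Lnorm_lty (p : R) (f : T -> R) : (0 < p)%R ->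
  ('N[mu]_p%:E[EFin \o f] < +oo) = (\int[mu]_x ((`|f x| `^ p)%:E) < +oo).
Proof.
move=> p0; have i0 : 0 <= \int[mu]_x ((`|f x| `^ p)%:E).
  by apply: integral_ge0 => x _; rewrite lee_fin powR_ge0.
apply/idP/idP => [|h]; last by rewrite Lnorm_EFinE poweR_lty.
rewrite Lnorm_EFinE => /(poweR_lty p).
by rewrite -poweRrM mulVf ?gt_eqF// poweRe1.
Qed.

Lemma normLp_oo_lty (D : set T) (f : T -> R) (M : R) :
  (forall x, D x -> (`|f x| <= M)%R) -> normLp mu D +oo f < +oo.
Proof.
move=> fM; rewrite /normLp unlock; case: ifPn => // _.
(* Off [D] the restricted function is 0, so the essential bound must be at least 0 whatever the sign
   of [M]. *)
apply: (@le_lt_trans _ _ (Num.max 0 M)%:E); last exact: ltry.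
apply/ess_supP; apply: aeW => x /=; rewrite lee_fin patchE.
case: ifPn => [|_]; last by rewrite normr0 le_max lexx.
by rewrite inE => /fM fx; rewrite le_max fx orbT.
Qed.

(** A series with finite integral is finite almost everywhere, hence its terms tend to 0. With a
    summable rate of approximation, no subsequence has to be extracted. *)
Lemma ae_cvg0_nneseries (g : (T -> R)^nat) :
  (forall k, measurable_fun setT (g k)) -> (forall k x, 0 <= g k x)%R ->
  \sum_(0 <= k <oo) \int[mu]_x (g k x)%:E < +oo ->
  {ae mu, forall x, g k x @[k --> \oo] --> (0:R)%R}.
Proof.
move=> mg g0 sg.
have mgk k : measurable_fun setT (fun x => (g k x)%:E) by exact/measurable_EFinP.
have gk0 k x : 0 <= (g k x)%:E by rewrite lee_fin.
have : mu.-integrable setT (fun x => \sum_(0 <= k <oo) (g k x)%:E).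
  apply/integrableP; split.
    exact: ge0_emeasurable_sum.
  under eq_integral.
    move=> x _; rewrite gee0_abs; last by apply: nneseries_ge0.
    over.
  by rewrite integral_nneseries.
move=> /(integrable_ae measurableT); apply: filterS => x /(_ I) sx.
apply/cvg_series_cvg_0.
apply: nondecreasing_is_cvgn.
  by apply: nondecreasing_series => n _ _; exact: g0.
exists (fine (\sum_(0 <= k <oo) (g k x)%:E)) => _ [n _ <-].
rewrite -lee_fin fineK//.
rewrite /series/= -sumEFin.
by apply: (@nneseries_lim_ge _ (fun k => (g k x)%:E) xpredT).
Qed.

End ae_integral.

Section representatives.
Context d (T : measurableType d) (R : realType).
Variable mu : {measure set T -> \bar R}.
Implicit Types (D : set T) (f g : T -> R).

(** Borel measurability is what Fubini and dominated convergence ask for, and vanishing off [D]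
    makes integrals over [D] and over the whole space agree. *)
Definition represents D f g := [/\ measurable_fun setT g,
  forall x, ~ D x -> g x = 0 & {ae mu, forall x, D x -> f x = g x}].

Lemma ae_measurable_represents D f : measurable D -> ae_measurable mu D f ->
  exists g, represents D f g.
Proof.
move=> mD [g mg fg]; exists (g \_ D); split.
- exact/(measurable_restrictT _ mD).
- by move=> x Dx; rewrite patchE memNset.
- by apply: filterS fg => x fgx Dx; rewrite patchE mem_set// fgx.
Qed.

Lemma represents_ae_measurable D f g : represents D f g -> ae_measurable mu D f.
Proof. by move=> [mg _ fg]; exists g => //; exact: measurable_funTS. Qed.

End representatives.

Section dominated_convergence_EFin.
Context d (T : measurableType d) (R : realType).
Variable mu : {measure set T -> \bar R}.
Variables (D : set T) (mD : measurable D).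
Variables (f_ : nat -> T -> R) (f g : T -> R).
Hypothesis mf_ : forall k, measurable_fun D (f_ k).
Hypothesis mf : measurable_fun D f.
Hypothesis ig : mu.-integrable D (EFin \o g).
Hypothesis f_f : {ae mu, forall x, D x -> f_ k x @[k --> \oo] --> f x}.
Hypothesis f_g : forall k x, D x -> `|f_ k x| <= g x.

Let dct : mu.-integrable D (EFin \o f) /\
  (\int[mu]_(x in D) (f_ k x)%:E)%E @[k --> \oo] --> (\int[mu]_(x in D) (f x)%:E)%E.
Proof.
have mf_' k : measurable_fun D (EFin \o f_ k) by exact/measurable_EFinP.
have mf' : measurable_fun D (EFin \o f) by exact/measurable_EFinP.
have f_f' : {ae mu, forall x, D x -> (EFin \o f_ k) x @[k --> \oo] --> (EFin \o f) x}.
  apply: filterS f_f => x fx Dx; apply: cvg_EFin; first exact: nearW.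
  exact: fx.
have f_g' : {ae mu, forall x k, D x -> (`|(EFin \o f_ k) x| <= (EFin \o g) x)%E}.
  by apply: aeW => x k Dx; rewrite lee_fin f_g.
by have [] := dominated_convergence mD mf_' mf' f_f' ig f_g'.
Qed.

Lemma dominated_integrable : mu.-integrable D (EFin \o f).
Proof. exact: dct.1. Qed.

Lemma dominated_cvg :
  (\int[mu]_(x in D) (f_ k x)%:E)%E @[k --> \oo] --> (\int[mu]_(x in D) (f x)%:E)%E.
Proof. exact: dct.2. Qed.

Lemma dominated_cvg_Rintegral :
  \int[mu]_(x in D) f_ k x @[k --> \oo] --> \int[mu]_(x in D) f x.
Proof.
apply: fine_cvg; rewrite fineK; first exact: dominated_cvg.
by apply: integrable_fin_num => //; exact: dominated_integrable.
Qed.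

End dominated_convergence_EFin.

Section integrable_EFin.
Context d (T : measurableType d) (R : realType).
Variables (mu : {measure set T -> \bar R}) (D : set T).
Implicit Types f g h : T -> R.

Lemma integrable_measurable f : mu.-integrable D (EFin \o f) -> measurable_fun D f.
Proof. by move=> /measurable_int/measurable_EFinP. Qed.

Lemma integrableD_EFin f g : measurable D -> mu.-integrable D (EFin \o f) ->
  mu.-integrable D (EFin \o g) -> mu.-integrable D (EFin \o (fun x => f x + g x)).
Proof. by move=> mD if_ ig; have := integrableD mD if_ ig. Qed.

Lemma integrableB_EFin f g : measurable D -> mu.-integrable D (EFin \o f) ->
  mu.-integrable D (EFin \o g) -> mu.-integrable D (EFin \o (fun x => f x - g x)).
Proof. by move=> mD if_ ig; have := integrableB mD if_ ig. Qed.

Lemma integrableZ_EFin k f : measurable D -> mu.-integrable D (EFin \o f) ->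
  mu.-integrable D (EFin \o (fun x => k * f x)).
Proof. by move=> mD if_; have := integrableZl mD k if_. Qed.

Lemma integrable_bddM h g (M : R) : measurable D ->
  mu.-integrable D (EFin \o g) -> measurable_fun D h ->
  (forall x, D x -> `|h x| <= M) -> mu.-integrable D (EFin \o (fun x => h x * g x)).
Proof.
move=> mD ig mh hM; have mg := integrable_measurable ig.
apply: (le_integrable mD _ _ (integrableZl mD M ig)).
  by apply/measurable_EFinP; exact: measurable_funM.
move=> x Dx; rewrite /= lee_fin !normrM ler_wpM2r//.
by rewrite (le_trans (hM x Dx))// ler_norm.
Qed.

Lemma le_integrable_EFin f g : measurable D -> measurable_fun D f ->
  (forall x, D x -> `|f x| <= g x) -> mu.-integrable D (EFin \o g) ->
  mu.-integrable D (EFin \o f).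
Proof.
move=> mD mf fg; apply: le_integrable => //; first exact/measurable_EFinP.
by move=> x Dx; rewrite /= lee_fin (le_trans (fg x Dx))// ler_norm.
Qed.

End integrable_EFin.

(** * Smooth bump functions and uniqueness of weak gradients *)

Section derive_facts.
Context {R : realType}.

(** Meant for points where a function is glued from two formulas: quadratic contact with the line of
    slope [a] bounds the slope function around [a] by C |z - x|, and Caratheodory's criterion
    applies. *)
Lemma is_derive_quadratic (f : R -> R) (x a C : R) :
  (forall h, `|f (x + h) - f x - a * h| <= C * h ^+ 2) -> is_derive x 1 f a.
Proof.
move=> fC; apply/is_derive1_caratheodory.
pose g z := if z == x then a else (f z - f x) / (z - x).
have gx : g x = a by rewrite /g eqxx.
exists g; split => //.
  move=> z; rewrite /g; case: eqP => [->|/eqP zx]; first by rewrite !subrr mulr0.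
  by rewrite divfK// subr_eq0.
have gC z : `|g z - a| <= C * `|z - x|.
  have C0 : 0 <= C.
    by have := le_trans (normr_ge0 _) (fC 1); rewrite expr1n mulr1.
  rewrite /g; case: eqP => [->|/eqP zx]; first by rewrite !subrr normr0 mulr0.
  have zx0 : z - x != 0 by rewrite subr_eq0.
  have := fC (z - x); rewrite subrKC.
  have -> : f z - f x - a * (z - x) = ((f z - f x) / (z - x) - a) * (z - x).
    by rewrite mulrBl divfK.
  rewrite normrM -real_normK ?num_real// expr2 mulrA ler_pM2r ?normr_gt0//.
apply/cvgrPdist_lep => /=; near=> e.
have C1 : 0 < `|C| + 1 by rewrite ltr_wpDl.
near=> z; rewrite gx distrC (le_trans (gC z))//.
rewrite (@le_trans _ _ ((`|C| + 1) * `|z - x|))//.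
  by rewrite ler_wpM2r// (le_trans (ler_norm _))// lerDl.
rewrite -ler_pdivlMl// mulrC distrC.
near: z; apply: cvgr_dist_le => //.
by rewrite divr_gt0.
Unshelve. all: by end_near. Qed.

Lemma is_derive_continuous (f df : R -> R) :
  (forall x, is_derive x (1 : R) f (df x)) -> continuous f.
Proof.
move=> fdf x; apply/differentiable_continuous/derivable1_diffP.
by have [] := fdf x.
Qed.

(** [Ck] only speaks of partial derivatives, so there is no total differential to compose with.
    Restricting to a line makes the one-variable rules available. *)
Lemma is_derive_line (U : normedModType R) (f : U -> R) x v a :
  is_derive (0 : R) 1 (fun t => f (x + t *: v)) a <-> is_derive x v f a.
Proof.
have E : (fun h : R => h^-1 *: (((fun t => f (x + t *: v)) \o shift 0) (h *: (1 : R)) - f (x + 0 *: v)))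
   = (fun h : R => h^-1 *: ((f \o shift x) (h *: v) - f x)).
  apply/funext => h /=; rewrite addr0 scale0r addr0.
  by rewrite [h%:A]mulr1 (addrC x).
split=> -[df dv]; apply: DeriveDef.
- by move: df; rewrite /derivable E.
- by move: dv; rewrite /derive E.
- by rewrite /derivable E.
- by rewrite /derive E.
Qed.

Lemma is_derive_comp_rV n (S : R -> R) (f : 'rV[R]_n -> R) x v s df :
  is_derive (f x) 1 S s -> is_derive x v f df ->
  is_derive x v (S \o f) (s * df).
Proof.
move=> dS /is_derive_line df'; apply/is_derive_line.
apply: (@is_derive1_comp _ S (fun t => f (x + t *: v)) 0) => //.
by rewrite scale0r addr0.
Qed.

End derive_facts.

Section bump.
Context {R : realType}.
Implicit Types P : {poly R}.

(* The functions P(1/x) e^(-1/x), extended by 0 to x <= 0, are closed under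
   derivation. *)
Definition flat P (x : R) : R := if 0 < x then P.[x^-1] * expR (- x^-1) else 0.

(** In the variable y = 1/x one has d/dx = - y^2 d/dy, applied here to P(y) e^(-y). *)
Definition dflat P : {poly R} := 'X^2 * (P - P^`()).

(** Since e^y >= y^(i+2) / (i+2)!, each y^i e^(-y) is at most (i+2)! / y^2; with y = 1/h this is a
    multiple of h^2. It yields the derivative 0 at the origin. *)
Lemma flat_quadratic P : exists C, forall h, `|flat P h| <= C * h ^+ 2.
Proof.
exists (\sum_(i < size P) `|P`_i| * (i.+2)`!%:R) => h; rewrite /flat.
case: ifPn => [h0|_]; last first.
  by rewrite normr0 mulr_ge0 ?sqr_ge0// sumr_ge0.
rewrite normrM (ger0_norm (expR_ge0 _)) horner_coef.
rewrite (@le_trans _ _ (\sum_(i < size P) `|P`_i| * (h ^- i * expR (- h^-1))))//.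
  rewrite (le_trans (ler_wpM2r (expR_ge0 _) (ler_norm_sum _ _ _)))//.
  rewrite mulr_suml ler_sum// => i _.
  by rewrite normrM -mulrA exprVn (ger0_norm (_ : 0 <= h ^- i))// invr_ge0 exprn_ge0// ltW.
rewrite mulr_suml ler_sum// => i _; rewrite -mulrA ler_wpM2l//.
have := @expR_ge1Dxn _ (h^-1) i.+1; rewrite invr_ge0 ltW// => /(_ isT) H.
have {}H : h^-1 ^+ i.+2 / (i.+2)`!%:R <= expR h^-1.
  by apply: le_trans H; rewrite lerDr.
rewrite expRN ler_pdivrMr ?expR_gt0//.
have F0 : 0 < (i.+2)`!%:R :> R by rewrite ltr0n fact_gt0.
move: H; rewrite ler_pdivrMr// => H.
have h20 : 0 < h ^+ 2 by rewrite exprn_gt0.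
have := ler_wpM2r (ltW h20) H.
have -> : h^-1 ^+ i.+2 * h ^+ 2 = h ^- i.
  rewrite -addn2 exprD exprVn -mulrA -exprMn mulVf ?gt_eqF// expr1n mulr1//.
by rewrite -mulrA mulrC.
Qed.

Lemma flat_derive P (x : R) : is_derive x (1 : R) (flat P) (flat (dflat P) x).
Proof.
have [x0|x0|->] := ltgtP x 0.
- apply: (@near_eq_is_derive _ _ _ (cst 0)).
    near=> y; rewrite /flat ifF//; apply/negbTE; rewrite -leNgt ltW//.
    by near: y; exact: lt_nbhsl.
  by rewrite /flat ltNge (ltW x0)/=; exact: is_derive_cst.
- apply: (@near_eq_is_derive _ _ _ ((horner P \o (fun y => y^-1)) * (expR \o (-%R \o (fun y => y^-1))))).
    near=> y; rewrite /flat ifT//.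
    by near: y; exact: lt_nbhsr.
  have xN0 : x != 0 by rewrite gt_eqF.
  have dV : is_derive x (1 : R) (fun y : R => y^-1) (- x ^- 2).
    apply: is_derive_eq; first by apply: (@is_deriveV _ id x 1 1).
    by rewrite [_ *: _]mulr1.
  have d1 := @is_derive1_comp _ (horner P) _ x _ _ (is_derive_poly P _) dV.
  have d2 := @is_derive1_comp _ expR _ x _ _ (is_derive_expR _) (@is_derive1_comp _ -%R _ x _ _ (is_deriveNid _ _) dV).
  have d12 := is_deriveM d1 d2; apply: (is_derive_eq d12).
  rewrite /flat x0 /dflat !hornerE /=.
  rewrite /GRing.scale/= exprVn; ring.
- have [C HC] := flat_quadratic P.
  apply: (is_derive_quadratic (C := C)) => h.
  by rewrite add0r /flat ltxx mul0r !subr0; exact: HC.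
Unshelve. all: by end_near. Qed.

Definition rho (x : R) : R := flat 1 x.

Lemma rhoE x : rho x = if 0 < x then expR (- x^-1) else 0.
Proof. by rewrite /rho /flat !hornerE; case: ifP => //; rewrite mul1r. Qed.

End bump.

Section Cinfty_closure.
Context {R : realType} {n : nat}.
Implicit Types f g : 'rV[R]_n -> R.

Lemma partialP f i x : derivable f x (delta_mx 0 i) ->
  is_derive x (delta_mx 0 i) f (partial i f x).
Proof. by move=> df; apply: DeriveDef. Qed.

Lemma Ck_cst k (c : R) : Ck k (cst c : 'rV[R]_n -> R).
Proof.
elim: k c => [|k IH] c /=; first exact: cst_continuous.
move=> i; split; first by move=> x; exact: derivable_cst.
rewrite (_ : partial i _ = cst 0)//; apply/funext => x.
by rewrite /partial derive_cst.
Qed.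

Lemma CkD k f g : Ck k f -> Ck k g -> Ck k (f \+ g).
Proof.
elim: k f g => [|k IH] f g /=; first by move=> cf cg x; exact: cvgD (cf x) (cg x).
move=> cf cg i; split; first by move=> x; apply: derivableD; [apply: (cf i).1|apply: (cg i).1].
rewrite (_ : partial i _ = partial i f \+ partial i g).
  by apply: IH; [exact: (cf i).2|exact: (cg i).2].
apply/funext => x; rewrite /partial deriveD//; [exact: (cf i).1|exact: (cg i).1].
Qed.

Lemma Cinfty_partial f i : Cinfty f -> Cinfty (partial i f).
Proof. by move=> cf k; have /= := cf k.+1 => /(_ i) []. Qed.

Lemma CinftyM f g : Cinfty f -> Cinfty g -> Cinfty (f \* g).
Proof.
move=> cf cg k; elim: k f g cf cg => [|k IH] f g cf cg /=.
  by move=> x; exact: cvgM (cf 0%N x) (cg 0%N x).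
move=> i; split.
  by move=> x; apply: derivableM; [exact: (cf 1%N i).1|exact: (cg 1%N i).1].
rewrite (_ : partial i _ = (f \* partial i g) \+ (g \* partial i f)).
  by apply: CkD; apply: IH => //; exact: Cinfty_partial.
apply/funext => x; rewrite /partial deriveM//; [exact: (cf 1%N i).1|exact: (cg 1%N i).1].
Qed.

Lemma Cinfty_prod (I : Type) (r : seq I) (F : I -> 'rV[R]_n -> R) :
  (forall i, Cinfty (F i)) -> Cinfty (fun x => \prod_(i <- r) F i x).
Proof.
move=> cF; elim: r => [|i r IH].
  by under eq_fun do rewrite big_nil; move=> k; exact: Ck_cst.
by under eq_fun do rewrite big_cons; exact: CinftyM.
Qed.

Lemma Cinfty_flat (P : {poly R}) (c d : R) (i : 'I_n) :
  Cinfty (fun x : 'rV[R]_n => flat P (c * x 0 i + d)).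
Proof.
have dx (Q : {poly R}) x j : is_derive x (delta_mx 0 j : 'rV[R]_n) (fun x : 'rV[R]_n => flat Q (c * x 0 i + d))
    (flat (((i == j)%:R * c) *: dflat Q) (c * x 0 i + d)).
  have d1 : is_derive x (delta_mx 0 j : 'rV[R]_n) (fun x : 'rV[R]_n => c * x 0 i + d) ((i == j)%:R * c).
    apply/is_derive_line.
    have : is_derive (0 : R) (1 : R) (horner ((c * (i == j)%:R)%:P * 'X + (c * x 0 i + d)%:P))
       ((i == j)%:R * c).
      by apply: (is_derive_eq (is_derive_poly _ _)); rewrite derivD derivM !derivC derivX mul0r add0r mulr1 addr0 hornerC mulrC.
    congr is_derive; apply/funext => t; rewrite !mxE !hornerE /= eq_sym; ring.
  have d2 := is_derive_comp_rV (flat_derive Q (c * x 0 i + d)) d1.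
  apply: (is_derive_eq d2); rewrite /flat; case: ifP => _; last by rewrite mul0r.
  by rewrite hornerZ; ring.
move=> k; elim: k P => [|k IH] P /=.
  move=> x; apply: (@continuous_comp _ _ _ (fun x : 'rV[R]_n => c * x 0 i + d) (flat P)).
    apply: (@continuousD _ _ _ (fun x : 'rV[R]_n => c * x 0 i) (cst d)); last exact: cst_continuous.
    apply: (@continuousM _ _ (cst c) (fun x : 'rV[R]_n => x 0 i)); first exact: cst_continuous.
    exact: coord_continuous.
  exact: (is_derive_continuous (flat_derive P)).
move=> j; split; first by move=> x; have [] := dx P x j.
rewrite (_ : partial j _ = (fun x : 'rV[R]_n => flat (((i == j)%:R * c) *: dflat P) (c * x 0 i + d))).
  exact: IH.
by apply/funext => x; have [_] := dx P x j.
Qed.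

End Cinfty_closure.

Section bump_functions.
Context {R : realType} {n : nat}.
Notation mu := (lebesgue R n).
Implicit Types (a b : 'rV[R]_n) (Om : set 'rV[R]_n).

(** The dilation by [m.+1] pushes [rho] to the indicator function of the positive reals, so that
    bumps tend pointwise to the indicator of the open box without leaving it. *)
Definition bump (m : nat) a b (x : 'rV[R]_n) : R :=
  \prod_(i < n) (rho (m.+1%:R * (x 0 i - a 0 i)) * rho (m.+1%:R * (b 0 i - x 0 i))).

Lemma rho_ge0 (x : R) : 0 <= rho x.
Proof. by rewrite rhoE; case: ifP => // _; exact: expR_ge0. Qed.

Lemma rho_le1 (x : R) : rho x <= 1.
Proof.
rewrite rhoE; case: ifP => // x0.
by rewrite -[leRHS]expR0 ler_expR oppr_le0 invr_ge0 ltW.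
Qed.

Lemma bump_ge0 m a b x : 0 <= bump m a b x.
Proof. by apply: prodr_ge0 => i _; rewrite mulr_ge0// rho_ge0. Qed.

Lemma bump_le1 m a b x : bump m a b x <= 1.
Proof.
suff /andP[] : 0 <= bump m a b x <= 1 by [].
rewrite /bump; elim/big_ind : _ => [|y z /andP[y0 y1] /andP[z0 z1]|i _].
- by rewrite ler01 lexx.
- by rewrite mulr_ge0// mulr_ile1.
- by rewrite mulr_ge0 ?mulr_ile1 ?rho_ge0 ?rho_le1.
Qed.

Lemma bump_out m a b x : ~ box a b x -> bump m a b x = 0.
Proof.
move=> /existsNP[i /negP]; rewrite negb_and => H.
rewrite /bump (bigD1 i)//=; apply/eqP; rewrite mulf_eq0; apply/orP; left.
case/orP: H => H; rewrite mulf_eq0 !rhoE !pmulr_rgt0// ?subr_gt0.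
  by rewrite (negbTE H) eqxx.
by rewrite (negbTE H) eqxx orbT.
Qed.

Lemma cvg_rho (y : R) : rho (m.+1%:R * y) @[m --> \oo] --> ((0 < y)%R%:R : R).
Proof.
have [y0|y0] := ltP 0 y; last first.
  rewrite (_ : (fun _ => _) = cst 0); first exact: cvg_cst.
  by apply/funext => m; rewrite rhoE pmulr_rgt0// ltNge y0.
rewrite (_ : (fun _ => _) = (fun m : nat => expR (- y^-1 * m.+1%:R^-1))); last first.
  by apply/funext => m; rewrite rhoE pmulr_rgt0// y0 invfM mulrC mulNr.
rewrite -[X in _ --> X](@expR0 R).
apply: continuous_cvg; first exact: continuous_expR.
rewrite -[X in _ --> X](mulr0 (- y^-1)).
by apply: cvgM; [exact: cvg_cst|exact: cvg_harmonic].
Qed.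

Lemma cvg_bump a b x : bump m a b x @[m --> \oo] --> (\1_(box a b) x : R).
Proof.
rewrite (_ : \1_(box a b) x = \prod_(i < n) ((0 < x 0 i - a 0 i)%R%:R * (0 < b 0 i - x 0 i)%R%:R)); last first.
  rewrite indicE; case: (boolP (x \in _)) => [|].
    rewrite inE => xab; rewrite big1// => i _.
    by rewrite !subr_gt0; have /andP[-> ->] := xab i; rewrite mulr1.
  rewrite notin_setE => /existsNP[i /negP]; rewrite negb_and => H.
  rewrite (bigD1 i)//= !subr_gt0.
  by case/orP: H => /negbTE ->; rewrite ?mul0r// mulr0 mul0r.
rewrite /bump; elim: (index_enum _) => [|i r IH].
  by rewrite big_nil; under eq_fun do rewrite big_nil; exact: cvg_cst.
rewrite big_cons; under eq_fun do rewrite big_cons.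
by apply: cvgM IH; apply: cvgM; exact: cvg_rho.
Qed.

Lemma Cinfty_bump m a b : Cinfty (bump m a b).
Proof.
apply: Cinfty_prod => i; apply: CinftyM.
  rewrite (_ : (fun x => _) = (fun x : 'rV[R]_n => flat 1 (m.+1%:R * x 0 i + (- m.+1%:R * a 0 i)))).
    exact: Cinfty_flat.
  by apply/funext => x; rewrite /rho mulrBr mulNr.
rewrite (_ : (fun x => _) = (fun x : 'rV[R]_n => flat 1 (- m.+1%:R * x 0 i + (m.+1%:R * b 0 i)))).
  exact: Cinfty_flat.
by apply/funext => x; rewrite /rho mulrBr mulNr addrC.
Qed.

Lemma compact_cbox a b : compact (cbox a b).
Proof.
rewrite (_ : cbox a b = [set x | forall i, `[a 0 i, b 0 i]%classic (x 0 i)]).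
  by apply: (@rV_compact _ n (fun i => `[a 0 i, b 0 i]%classic)) => i; exact: segment_compact.
by apply/seteqP; split => x /= h i; have := h i; rewrite in_itv.
Qed.

Lemma box_sub_cbox a b : box a b `<=` cbox a b.
Proof. by move=> x h i; have /andP[/ltW -> /ltW ->] := h i. Qed.

Lemma test_function_bump Om m a b : cbox a b `<=` Om -> test_function Om (bump m a b).
Proof.
move=> abO; split; first exact: Cinfty_bump.
exists (cbox a b); split => //; first exact: compact_cbox.
by move=> x xab; rewrite bump_out// => /box_sub_cbox.
Qed.

Lemma Cinfty_measurable (f : 'rV[R]_n -> R) : Cinfty f -> measurable_fun setT f.
Proof. by move=> cf; apply: continuous_measurable_rV; exact: cf 0%N. Qed.

Section vanishing.
Variables (Om : set 'rV[R]_n) (g : 'rV[R]_n -> R).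
Hypothesis mg : measurable_fun setT g.
Hypothesis ig : forall K, compact K -> K `<=` Om -> mu.-integrable K (EFin \o g).
Hypothesis g0 : forall f, test_function Om f ->
  (\int[mu]_(x in Om) (g x * f x)%:E = 0)%E.

(** Bumps are admissible in [g0] and bounded by 1, so dominated convergence passes from them to the
    indicator of the box. *)
Lemma integral_box_eq0 a b : cbox a b `<=` Om ->
  (\int[mu]_(x in box a b) (g x)%:E = 0)%E.
Proof.
move=> abO.
have mab := measurable_cbox a b.
have igab : mu.-integrable (cbox a b) (EFin \o (fun x => `|g x|)).
  apply: eq_integrable (integrable_abse (ig (compact_cbox (a:=a) (b:=b)) abO)) => //.
have cvgI : ((\int[mu]_(x in cbox a b) (g x * bump m a b x)%:E)%E @[m --> \oo]
    --> (\int[mu]_(x in cbox a b) (g x * \1_(box a b) x)%:E)%E).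
  apply: (dominated_cvg mab _ _ igab).
  - move=> m; apply: measurable_funTS; apply: measurable_funM => //.
    by apply: Cinfty_measurable; exact: Cinfty_bump.
  - apply: measurable_funTS; apply: measurable_funM => //.
    by apply: measurable_indic; exact: measurable_box.
  - by apply: aeW => x _; apply: cvgM; [exact: cvg_cst|exact: cvg_bump].
  - move=> m x _; rewrite normrM ler_piMr//.
    by rewrite ger0_norm ?bump_ge0// bump_le1.
have E m : (\int[mu]_(x in cbox a b) (g x * bump m a b x)%:E = 0)%E.
  rewrite -[RHS](g0 (test_function_bump m abO)).
  rewrite integral_mkcond [RHS]integral_mkcond; apply: eq_integral => x _.
  rewrite !patchE; case: ifPn => [|].
    by rewrite inE => /abO xO; rewrite mem_set.
  rewrite notin_setE => xab; case: ifPn => // _.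
  by rewrite bump_out ?mulr0// => /box_sub_cbox.
have H := cvg_lim (@ereal_hausdorff R) cvgI.
move: H; under eq_fun do rewrite E; rewrite lim_cst// => H.
rewrite [RHS]H.
rewrite integral_mkcond [RHS]integral_mkcond; apply: eq_integral => x _.
rewrite !patchE indicE; case: (boolP (x \in box a b)) => [|].
  by rewrite inE => /box_sub_cbox xab; rewrite mem_set// mulr1.
by rewrite mulr0; case: ifP.
Qed.

(** The sets [E] over which [g] has zero integral within [box a b] form a Dynkin system containing
    all boxes, hence all measurable sets. *)
Lemma ae_eq0_cbox a b : cbox a b `<=` Om -> {ae mu, forall x, box a b x -> g x = 0}.
Proof.
move=> abO.
have iab : mu.-integrable (box a b) (EFin \o g).
  apply: (@integrableS _ _ _ _ (cbox a b)).
  - exact: measurable_cbox.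
  - exact: measurable_box.
  - exact: box_sub_cbox.
  - by apply: ig => //; exact: compact_cbox.
have : ae_eq mu (box a b) (EFin \o g) (cst 0)%E.
  apply: integral_ae_eq => //; first exact: measurable_box.
  move=> E EO mE; rewrite integral0.
  suff H : (\int[mu]_(x in E `&` box a b) (EFin \o g) x = 0)%E.
    by rewrite -H; congr (integral _ _ _); apply/esym/setIidPl.
  move: mE {EO}; rewrite {1}measurable_rV_boxE.
  apply: (@dynkin_induction _ _ [set A | exists a b, A = box a b]
    [set E | (\int[mu]_(x in E `&` box a b) (EFin \o g) x = 0)%E]) => /=.
  - exact: measurable_rV_boxE.
  - by move=> _ _ [a1 [b1 ->]] [a2 [b2 ->]]; rewrite setI_box; do 2 eexists.
  - by rewrite setTI; exact: integral_box_eq0.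
  - move=> _ [a1 [b1 ->]] /=; rewrite setIC setI_box; apply: integral_box_eq0.
    apply: subset_trans abO => x h i; have := h i; rewrite !mxE.
    by rewrite ge_max le_min => /andP[/andP[-> _] /andP[-> _]].
  - move=> S mS S0.
    have := @integral_setU _ _ _ mu (S `&` box a b) (~` S `&` box a b) (EFin \o g).
    rewrite -setIUl setUv setTI S0 add0e integral_box_eq0// => H.
    apply/esym; apply: H.
    + by apply: measurableI => //; exact: measurable_box.
    + by apply: measurableI; [exact: measurableC|exact: measurable_box].
    + exact: (measurable_int _ iab).
    + by apply/disj_setPS => x [[Sx _] []].
  - move=> F mF tF F0; rewrite setI_bigcupl integral_bigcup.
    + by rewrite eseries0.
    + exact: trivIset_setIr.
    + by move=> k; apply: measurableI => //; exact: measurable_box.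
    + rewrite -setI_bigcupl; apply: integrableS iab => //.
      * exact: measurable_box.
      * by apply: measurableI; [exact: bigcup_measurable|exact: measurable_box].
by apply: filterS => x h xab; have [] := h xab.
Qed.

End vanishing.
End bump_functions.

(** * Integration by parts and the chain rule for truncations *)

Section C1_compact_support.
Context {R : realType}.

Lemma continuous_funD (T : topologicalType) (f g : T -> R) :
  continuous f -> continuous g -> continuous (fun x => f x + g x).
Proof. by move=> cf cg x; exact: cvgD (cf x) (cg x). Qed.

Lemma continuous_funM (T : topologicalType) (f g : T -> R) :
  continuous f -> continuous g -> continuous (fun x => f x * g x).
Proof. by move=> cf cg x; exact: cvgM (cf x) (cg x). Qed.

(** A cube instead of an arbitrary compact set, because slices with one coordinate frozen then
    inherit the bound on the support. *)
Definition bsupp n (g : 'rV[R]_n -> R) := exists M : R, forall x, ~ cube M x -> g x = 0.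

(** [Ck 1] says that the partial derivatives exist and are continuous; continuity of [g] itself is
    therefore carried separately. *)
Definition C1c n (g : 'rV[R]_n -> R) := [/\ continuous g, Ck 1 g & bsupp g].

Lemma cubeS n (M N : R) : M <= N -> cube M `<=` (cube N : set 'rV[R]_n).
Proof.
move=> MN x xM i; have /andP[h1 h2] := xM i.
by rewrite (le_trans _ h1) ?lerN2//= (le_trans h2).
Qed.

Lemma compact_cube n (M : R) : compact (cube M : set 'rV[R]_n).
Proof.
rewrite (_ : cube M = cbox (const_mx (- M)) (const_mx M)); first exact: compact_cbox.
by apply/seteqP; split => x h i; have := h i; rewrite !mxE.
Qed.

Lemma rV_norm_le n (x : 'rV[R]_n) e : 0 <= e -> (forall i, `|x 0 i| <= e) -> `|x| <= e.
Proof.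
move=> e0 xe; rewrite [leLHS]/Num.norm/= mx_normrE.
by apply: bigmax_le => // -[i j] _; rewrite ord1.
Qed.

Lemma cons_rVB n (t t' : R) (y y' : 'rV[R]_n) :
  (cons_rV (t, y) : 'rV[R]_n.+1) - cons_rV (t', y') = cons_rV (t - t', y - y').
Proof.
apply/rowP => i; rewrite mxE [in X in _ + X]mxE.
case: (unliftP 0 i) => [j ->|->]; first by rewrite !cons_rVS !mxE.
by rewrite !cons_rV0.
Qed.

Lemma norm_cons_rV n (t : R) (y : 'rV[R]_n) e : `|t| <= e -> `|y| <= e ->
  `|cons_rV (t, y) : 'rV[R]_n.+1| <= e.
Proof.
move=> te ye; apply: rV_norm_le; first exact: le_trans (normr_ge0 _) te.
move=> i; case: (unliftP 0 i) => [j ->|->]; last by rewrite cons_rV0.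
by rewrite cons_rVS (le_trans (coord_le_norm _ _)).
Qed.

Lemma continuous_cons_rVl n (y : 'rV[R]_n) :
  continuous (fun t : R => cons_rV (t, y) : 'rV[R]_n.+1).
Proof.
move=> t; apply/cvgrPdist_le => /= e e0; near=> s.
rewrite cons_rVB subrr; apply: norm_cons_rV; last by rewrite normr0 ltW.
by near: s; exact: cvgr_dist_le.
Unshelve. all: by end_near. Qed.

Lemma continuous_cons_rVr n (t : R) :
  continuous (fun y : 'rV[R]_n => cons_rV (t, y) : 'rV[R]_n.+1).
Proof.
move=> y; apply/(@cvgrPdist_le _ _ _ _ (nbhs_filter y)) => e e0.
have : nbhs y (ball y e) by exact: nbhsx_ballx.
apply: (@filterS _ _ (nbhs_filter y)) => z; rewrite mx_norm_ball /ball_/= => yz.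
by rewrite cons_rVB subrr; apply: norm_cons_rV; [rewrite normr0 ltW|exact: ltW].
Qed.

Lemma cons_rV_line0 n (t s : R) (y : 'rV[R]_n) :
  (cons_rV (t, y) : 'rV[R]_n.+1) + s *: delta_mx 0 0 = cons_rV (t + s, y).
Proof.
apply/rowP => i; rewrite mxE [in X in _ + X]mxE [in X in _ * X]mxE.
case: (unliftP 0 i) => [j ->|->]; first by rewrite !cons_rVS mulr0 addr0.
by rewrite !cons_rV0 eqxx mulr1.
Qed.

Lemma cons_rV_lineS n (t s : R) (y : 'rV[R]_n) (j : 'I_n) :
  (cons_rV (t, y) : 'rV[R]_n.+1) + s *: delta_mx 0 (lift ord0 j) =
  cons_rV (t, y + s *: delta_mx 0 j).
Proof.
apply/rowP => i; rewrite mxE [in X in _ + X]mxE [in X in _ * X]mxE.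
case: (unliftP 0 i) => [k ->|->]; last by rewrite !cons_rV0 mulr0 addr0.
by rewrite !cons_rVS !mxE/= (inj_eq lift_inj).
Qed.

Lemma is_derive_slice0 n (g : 'rV[R]_n.+1 -> R) (y : 'rV[R]_n) t a :
  is_derive (cons_rV (t, y) : 'rV[R]_n.+1) (delta_mx 0 0) g a ->
  is_derive t (1 : R) (fun t => g (cons_rV (t, y))) a.
Proof.
move/is_derive_line => H; apply/is_derive_line; move: H; congr is_derive.
by apply/funext => s; rewrite cons_rV_line0 [_ *: 1]mulr1.
Qed.

Lemma is_derive_sliceS n (g : 'rV[R]_n.+1 -> R) (y : 'rV[R]_n) t j a :
  is_derive (cons_rV (t, y) : 'rV[R]_n.+1) (delta_mx 0 (lift ord0 j)) g a ->
  is_derive y (delta_mx 0 j) (fun y => g (cons_rV (t, y))) a.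
Proof.
move/is_derive_line => H; apply/is_derive_line; move: H; congr is_derive.
by apply/funext => s; rewrite cons_rV_lineS.
Qed.

Lemma partial_sliceS n (g : 'rV[R]_n.+1 -> R) t j : C1c g ->
  partial j (fun y => g (cons_rV (t, y))) = (fun y => partial (lift ord0 j) g (cons_rV (t, y))).
Proof.
move=> [_ dg _]; apply/funext => y.
by have [_] := is_derive_sliceS (partialP ((dg (lift ord0 j)).1 (cons_rV (t, y)))).
Qed.

Lemma C1c_slice n (g : 'rV[R]_n.+1 -> R) t : C1c g -> C1c (fun y => g (cons_rV (t, y))).
Proof.
move=> Cg; have [cg dg [M gM]] := Cg; split.
- move=> y; apply: (@continuous_comp _ _ _ (fun y : 'rV[R]_n => cons_rV (t, y) : 'rV[R]_n.+1) g).
    exact: continuous_cons_rVr.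
  exact: cg.
- move=> j; split.
    by move=> y; have [] := is_derive_sliceS (partialP ((dg (lift ord0 j)).1 (cons_rV (t, y)))).
  rewrite partial_sliceS// => y.
  apply: (@continuous_comp _ _ _ (fun y : 'rV[R]_n => cons_rV (t, y) : 'rV[R]_n.+1)).
    exact: continuous_cons_rVr.
  exact: (dg (lift ord0 j)).2.
- exists M => y My; apply: gM; apply: contra_not My.
  by rewrite cons_rV_cube => -[].
Qed.

Lemma partial_eq0_out n (g : 'rV[R]_n -> R) (K : set 'rV[R]_n) i x : compact K ->
  (forall x, ~ K x -> g x = 0) -> ~ K x -> partial i g x = 0.
Proof.
move=> cK gK Kx; have : is_derive x (delta_mx 0 i) g 0.
  apply: (@near_eq_is_derive _ _ _ (cst 0)).
  have /closed_openC oC : closed K by apply: compact_closed => //; exact: norm_hausdorff.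
  have : nbhs x (~` K) by exact: open_nbhs_nbhs.
  by apply: filterS => z /gK ->.
by case.
Qed.

Lemma bsupp_partial n (g : 'rV[R]_n -> R) i : bsupp g -> bsupp (partial i g).
Proof.
by move=> [M gM]; exists M => x; exact: partial_eq0_out (@compact_cube _ _) gM.
Qed.

Lemma bsupp_bounded n (g : 'rV[R]_n -> R) : continuous g -> bsupp g ->
  exists2 C : R, 0 <= C & forall x, `|g x| <= C.
Proof.
move=> cg [M gM].
have : compact (g @` cube M).
  apply: continuous_compact; last exact: compact_cube.
  exact: continuous_subspaceT.
move=> /compact_bounded [C [_ HC]].
exists (Num.max 0 (C + 1)); first by rewrite le_max lexx.
move=> x; have [xM|/gM ->] := pselect (cube M x); last by rewrite normr0 le_max lexx.
rewrite le_max; apply/orP; right; apply: HC; first by rewrite ltrDl.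
by exists x.
Qed.

Lemma bounded_supp_integrable n (C M : R) (g : 'rV[R]_n -> R) : measurable_fun setT g ->
  (forall x, `|g x| <= C) -> (forall x, ~ cube M x -> g x = 0) ->
  (lebesgue R n).-integrable setT (EFin \o g).
Proof.
move=> mg gC gM; rewrite (_ : EFin \o g = (EFin \o g) \_ (cube M)).
  apply/(integrable_mkcond _ (@measurable_cube R n M)).
  apply: measurable_bounded_integrable.
  - exact: measurable_cube.
  - exact: lebesgue_cube_lty.
  - exact: measurable_funTS.
  - by exists C; split; [exact: num_real|move=> D CD x _; apply: le_trans (gC x) _; exact: ltW].
apply/funext => x; rewrite patchE; case: ifPn => //.
by rewrite notin_setE => /gM /= ->.
Qed.

Lemma bsupp_integrable n (g : 'rV[R]_n -> R) : continuous g -> bsupp g ->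
  (lebesgue R n).-integrable setT (EFin \o g).
Proof.
move=> cg bg; have [C _ gC] := bsupp_bounded cg bg; have [M gM] := bg.
exact: bounded_supp_integrable (continuous_measurable_rV cg) gC gM.
Qed.

Lemma C1c_partial_integrable n (g : 'rV[R]_n -> R) i : C1c g ->
  (lebesgue R n).-integrable setT (EFin \o partial i g).
Proof.
move=> [cg dg bg]; apply: bsupp_integrable; first exact: (dg i).2.
exact: bsupp_partial.
Qed.

Lemma FTC (h dh : R -> R) (a b : R) : a < b -> (forall x, is_derive x (1 : R) h (dh x)) ->
  continuous dh ->
  (\int[lebesgue_measure]_(x in `[a, b]) (dh x)%:E = (h b)%:E - (h a)%:E)%E.
Proof.
move=> ab hdh cdh.
have ch := is_derive_continuous hdh.
apply: continuous_FTC2 => //.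
- exact: continuous_subspaceT.
- split.
  + by move=> x _; have [] := hdh x.
  + by apply: cvg_at_right_filter; exact: ch.
  + by apply: cvg_at_left_filter; exact: ch.
- by move=> x _; have [_] := hdh x; rewrite derive1E.
Qed.

Lemma derive_eq0_out (h dh : R -> R) (M : R) : (forall x, is_derive x (1 : R) h (dh x)) ->
  (forall x, M < `|x| -> h x = 0) -> forall x, M < `|x| -> dh x = 0.
Proof.
move=> hdh hM x Mx.
have : is_derive x (1 : R) h 0.
  apply: (@near_eq_is_derive _ _ _ (cst 0)).
  have : \forall y \near x, M < `|y|.
    near=> y; have : `|x - y| < `|x| - M.
      by near: y; apply: cvgr_dist_lt => //; rewrite subr_gt0.
    by move=> xy; have := ler_normD (x - y) y; rewrite subrK; lra.
  by apply: filterS => y /hM ->.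
by have [_ <-] := hdh x; case.
Unshelve. all: by end_near. Qed.

Lemma integral_derive_eq0 (h dh : R -> R) (M : R) : (forall x, is_derive x (1 : R) h (dh x)) ->
  continuous dh -> (forall x, M < `|x| -> h x = 0) ->
  (\int[lebesgue_measure]_x (dh x)%:E = 0)%E.
Proof.
move=> hdh cdh hM; have dhM := derive_eq0_out hdh hM.
(* Beyond [M], so that [h] vanishes at both ends, and positive, so that the interval from -N to N is
   proper. *)
pose N : R := `|M| + 1.
have MN : M < N by rewrite (le_lt_trans (ler_norm M))// ltrDl.
have N0 : 0 < N by rewrite ltr_wpDl.
transitivity (\int[lebesgue_measure]_(x in `[(- N)%R, N]) (dh x)%:E)%E.
  rewrite [RHS]integral_mkcond; apply: eq_integral => x _; rewrite patchE.
  case: ifPn => //; rewrite notin_setE/= in_itv/= => /negP.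
  by rewrite -ler_norml -ltNge => Nx; rewrite dhM// (lt_trans MN).
rewrite FTC//; last by rewrite gtrN.
by rewrite !hM ?normrN ?gtr0_norm// subee.
Qed.

(** In the first coordinate this is the fundamental theorem of calculus on the inner integral; any
    other coordinate is a coordinate of the slice, to which the induction hypothesis applies. *)
Lemma integral_partial_eq0 n (g : 'rV[R]_n -> R) i : C1c g ->
  (\int[lebesgue R n]_x (partial i g x)%:E = 0)%E.
Proof.
elim: n g i => [|n IH] g i Cg; first by case: i.
have [cg dg [M gM]] := Cg.
have [I1 I2] := integral_rVS (C1c_partial_integrable i Cg).
case: (unliftP 0 i) I1 I2 => [j ->|->] /= I1 I2.
  rewrite I1 integral0_eq// => t _.
  by have := IH _ j (C1c_slice t Cg); rewrite partial_sliceS.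
rewrite I2 integral0_eq// => y _.
apply: (@integral_derive_eq0 (fun t => g (cons_rV (t, y))) _ M).
- by move=> t; apply: is_derive_slice0; exact: partialP ((dg 0).1 _).
- move=> t; apply: (@continuous_comp _ _ _ (fun t : R => cons_rV (t, y) : 'rV[R]_n.+1)).
    exact: continuous_cons_rVl.
  exact: (dg 0).2.
- move=> t Mt; apply: gM; rewrite cons_rV_cube => -[].
  by rewrite -ler_norml leNgt Mt.
Qed.

End C1_compact_support.

(** * C^1 approximation of the truncations *)

Section smooth_truncation.
Context {R : realType}.
Implicit Types (e k s : R).

Let pos2 s : R := Num.max s 0 ^+ 2.

Let is_derive_pos2 s : is_derive s (1 : R) pos2 (2 * Num.max s 0).
Proof.
apply: (is_derive_quadratic (C := 1)) => h; rewrite /pos2 mul1r ler_norml.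
by case: (leP s 0) => s0; case: (leP (s + h) 0) => sh0; apply/andP; split; nra.
Qed.

(** The mean of max(., 0) over the interval from s - e to s: a C^1 function whose derivative climbs
    from 0 to 1 between 0 and e. *)
Let ramp e s : R := (pos2 s - pos2 (s - e)) / (2 * e).
Let dramp e s : R := (Num.max s 0 - Num.max (s - e) 0) / e.

Let is_derive_ramp e s : is_derive s (1 : R) (ramp e) (dramp e s).
Proof.
have dB : is_derive s (1 : R) (fun s => s - e) 1 by exact: is_derive_shift.
have d1 := @is_derive1_comp _ pos2 (fun s => s - e) s _ _ (is_derive_pos2 _) dB.
have d2 := is_deriveZ (2 * e)^-1 (is_deriveB (is_derive_pos2 s) d1).
rewrite (_ : ramp e = (2 * e)^-1 \*: (pos2 - (pos2 \o (fun s => s - e)))).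
  apply: (is_derive_eq d2); rewrite /dramp /GRing.scale/= mulr1 -mulrBr invfM.
  by rewrite (mulrC 2^-1) -mulrA mulKf// mulrC.
by apply/funext => x; rewrite /ramp mulrC.
Qed.

Let dramp_continuous e : continuous (dramp e).
Proof.
have cmax : continuous (fun s : R => Num.max s 0).
  by move=> s; apply: continuous_max; [exact: cvg_id|exact: cst_continuous].
move=> s; apply: cvgMl; apply: cvgB; first exact: cmax.
apply: (@continuous_comp _ _ _ (fun s => s - e) (fun s : R => Num.max s 0)); last exact: cmax.
by apply: cvgB; [exact: cvg_id|exact: cvg_cst].
Qed.

Let dramp_itv e s : 0 < e -> 0 <= dramp e s <= 1.
Proof.
move=> e0; rewrite /dramp divr_ge0 ?(ltW e0)//=.
  rewrite ler_pdivrMr// mul1r.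
  by case: (leP s 0) => s0; case: (leP (s - e) 0) => s1; lra.
by case: (leP s 0) => s0; case: (leP (s - e) 0) => s1; lra.
Qed.

Let dramp_eq1 e s : 0 < e -> e <= s -> dramp e s = 1.
Proof.
move=> e0 es; rewrite /dramp !max_l ?subr_ge0//; last by rewrite (le_trans (ltW e0)).
by rewrite opprB addrC subrK mulfV// gt_eqF.
Qed.

Let dramp_eq0 e s : 0 < e -> s <= 0 -> dramp e s = 0.
Proof.
move=> e0 s0; rewrite /dramp !max_r//; first by rewrite subrr mul0r.
by rewrite subr_le0 (le_trans s0)// ltW.
Qed.

Let ramp_dist e s : 0 < e -> `|ramp e s - Num.max s 0| <= e.
Proof.
move=> e0; have e20 : 0 < 2 * e by rewrite mulr_gt0.
rewrite /ramp /pos2.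
have -> : forall a b c : R, (a - b) / (2 * e) - c = (a - b - 2 * e * c) / (2 * e).
  by move=> a b c; rewrite [in RHS]mulrBl (mulrC (2 * e)) mulfK// gt_eqF.
rewrite normrM (gtr0_norm (_ : 0 < (2 * e)^-1)) ?invr_gt0// ler_pdivrMr// ler_norml.
by case: (leP s 0) => s0; case: (leP (s - e) 0) => s1; apply/andP; split; nra.
Qed.

(* C^1 approximations of trunc k whose derivatives converge at every point,
   including |s| = k, to the indicator function of |s| < k. *)
Definition strunc k (m : nat) s : R :=
  ramp m.+1%:R^-1 (s + k) - ramp m.+1%:R^-1 (s - k + m.+1%:R^-1) - k.

(** With e = 1/(m+1), it rises on [-k, -k + e] and falls on [k - e, k]. The shift by e in the second
    term keeps the descent inside |s| <= k, so that for e <= 2k it vanishes whenever |s| >= k. *)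
Definition dstrunc k (m : nat) s : R :=
  dramp m.+1%:R^-1 (s + k) - dramp m.+1%:R^-1 (s - k + m.+1%:R^-1).

Lemma is_derive_strunc k m s : is_derive s (1 : R) (strunc k m) (dstrunc k m s).
Proof.
set e : R := m.+1%:R^-1.
have dB a : is_derive s (1 : R) (fun s => s + a) 1 by exact: is_derive_shift.
have d1 := @is_derive1_comp _ (ramp e) (fun s => s + k) s _ _ (is_derive_ramp _ _) (dB k).
have d2 := @is_derive1_comp _ (ramp e) (fun s => s + (- k + e)) s _ _ (is_derive_ramp _ _) (dB _).
have d3 := is_deriveB (is_deriveB d1 d2) (is_derive_cst k s (1 : R)).
rewrite (_ : strunc k m = ((ramp e \o (fun s => s + k)) - (ramp e \o (fun s => s + (- k + e))) - cst k)).
  by apply: (is_derive_eq d3); rewrite subr0 !mulr1 addrA.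
by apply/funext => x; rewrite !fctE /= addrA.
Qed.

Lemma strunc_continuous k m : continuous (strunc k m).
Proof. exact: is_derive_continuous (is_derive_strunc k m). Qed.

Lemma dstrunc_continuous k m : continuous (dstrunc k m).
Proof.
move=> s; apply: cvgB.
  apply: (@continuous_comp _ _ _ (fun s => s + k) (dramp _)).
    by apply: cvgD; [exact: cvg_id|exact: cvg_cst].
  exact: dramp_continuous.
apply: (@continuous_comp _ _ _ (fun s => s - k + _) (dramp _)).
  apply: cvgD; last exact: cvg_cst.
  by apply: cvgB; [exact: cvg_id|exact: cvg_cst].
exact: dramp_continuous.
Qed.

Let inv_gt0 (m : nat) : 0 < m.+1%:R^-1 :> R. Proof. by []. Qed.

Lemma dstrunc_le1 k m s : `|dstrunc k m s| <= 1.
Proof.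
rewrite /dstrunc; have /andP[a0 a1] := dramp_itv (s + k) (inv_gt0 m).
have /andP[b0 b1] := dramp_itv (s - k + m.+1%:R^-1) (inv_gt0 m).
by rewrite ler_norml; apply/andP; split; lra.
Qed.

Lemma truncE k s : 0 < k -> trunc k s = Num.max (s + k) 0 - Num.max (s - k) 0 - k.
Proof.
move=> k0; rewrite /trunc (addrC k).
by case: (leP (s + k) 0) => s0; case: (leP (s - k) 0) => s1;
 [rewrite ler0_norm// ger0_norm|rewrite ler0_norm// ltr0_norm|
  rewrite gtr0_norm// ger0_norm|rewrite gtr0_norm// ltr0_norm]; lra.
Qed.

(** One error of 1/(m+1) for each of the two ramps, and one for the shift. *)
Lemma strunc_dist k m s : 0 < k -> `|strunc k m s - trunc k s| <= 3 * m.+1%:R^-1.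
Proof.
move=> k0; rewrite truncE// /strunc.
have := ramp_dist (s + k) (inv_gt0 m).
have := ramp_dist (s - k + m.+1%:R^-1) (inv_gt0 m).
have H : `|Num.max (s - k + m.+1%:R^-1) 0 - Num.max (s - k) 0| <= m.+1%:R^-1.
  have := inv_gt0 m; set e := _^-1 => e0; rewrite ler_norml.
  by case: (leP (s - k + e) 0) => s0; case: (leP (s - k) 0) => s1; apply/andP; split; lra.
move: H; move: (m.+1%:R^-1 : R) => e; rewrite !ler_norml => /andP[h1 h2] /andP[h3 h4] /andP[h5 h6].
by apply/andP; split; lra.
Qed.

Lemma cvg_strunc k s : 0 < k -> strunc k m s @[m --> \oo] --> trunc k s.
Proof.
move=> k0; apply/cvgrPdist_le => e e0.
have : \forall m \near \oo, `|0 - 3 * (m.+1%:R^-1 : R)| <= e.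
  apply: cvgr_dist_le => //; rewrite -[X in _ --> X](mulr0 3).
  by apply: cvgM; [exact: cvg_cst|exact: cvg_harmonic].
apply: filterS => m; rewrite sub0r normrN ger0_norm ?mulr_ge0// => me.
by rewrite distrC (le_trans (strunc_dist _ _ _)).
Qed.

Lemma cvg_dstrunc k s : 0 < k ->
  dstrunc k m s @[m --> \oo] --> ((`|s| < k)%R%:R : R).
Proof.
move=> k0; apply: cvg_near_cst.
have near_le e : 0 < e -> \forall m \near \oo, (m.+1%:R^-1 : R) <= e.
  move=> e0.
  have : \forall m \near \oo, `|0 - (m.+1%:R^-1 : R)| <= e.
    by apply: cvgr_dist_le => //; exact: cvg_harmonic.
  by apply: filterS => m; rewrite sub0r normrN ger0_norm.
have [sk|sk] := ltP `|s| k; last first.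
  apply: filterS (near_le (2 * k) _) => [m|]; last by rewrite mulr_gt0.
  have /orP[ks|sk'] : (k <= s) || (s <= - k) by move: sk; rewrite ler_normr lerNr.
    have := inv_gt0 m; rewrite /dstrunc; move: (m.+1%:R^-1 : R) => e e0 ek.
    by rewrite !dramp_eq1 ?subrr//; lra.
  have := inv_gt0 m; rewrite /dstrunc; move: (m.+1%:R^-1 : R) => e e0 ek.
  by rewrite !dramp_eq0 ?subrr//; lra.
move: sk; rewrite ltr_norml => /andP[h1 h2].
have m0 : 0 < Num.min (s + k) (k - s) by rewrite lt_min; apply/andP; split; lra.
apply: filterS (near_le _ m0) => m; rewrite le_min.
have := inv_gt0 m; rewrite /dstrunc; move: (m.+1%:R^-1 : R) => e e0 /andP[mk1 mk2].
by rewrite dramp_eq1// dramp_eq0 ?subr0//; lra.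
Qed.

Lemma trunc_le k s : 0 < k -> `|trunc k s| <= k.
Proof.
move=> k0; rewrite truncE// ler_norml.
by case: (leP (s + k) 0) => s0; case: (leP (s - k) 0) => s1; apply/andP; split; lra.
Qed.

Lemma strunc_le k m s : 0 < k -> `|strunc k m s| <= k + 3.
Proof.
move=> k0; rewrite -(subrK (trunc k s) (strunc k m s)) addrC.
rewrite (le_trans (ler_normD _ _))// lerD ?trunc_le// (le_trans (strunc_dist _ _ k0))//.
by rewrite ler_piMr// invf_le1 ?ltr0n// ler1n.
Qed.

Lemma trunc_le_norm k s : 0 < k -> `|trunc k s| <= `|s|.
Proof.
move=> k0; rewrite truncE// ler_norml.
have h1 : s <= `|s| by rewrite ler_norm.
have h2 : - s <= `|s| by rewrite -normrN ler_norm.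
by case: (leP (s + k) 0) => s0; case: (leP (s - k) 0) => s1; apply/andP; split; lra.
Qed.

Lemma strunc_lipschitz k m s t : `|strunc k m s - strunc k m t| <= `|s - t|.
Proof.
wlog : s t / t < s => [H|ts].
  have [st|ts|->] := ltgtP s t; last by rewrite !subrr.
    by rewrite distrC (distrC s); exact: H.
  exact: H.
have [] := @MVT _ (strunc k m) (dstrunc k m) _ _ ts.
- by move=> x _; exact: is_derive_strunc.
- exact/continuous_subspaceT/strunc_continuous.
- by move=> c _ ->; rewrite normrM ler_piMl// dstrunc_le1.
Qed.

End smooth_truncation.

Section chain_rule.
Context {R : realType} {n : nat}.
Variable Om : set 'rV[R]_n.
Notation mu := (lebesgue R n).
Implicit Types (v phi : 'rV[R]_n -> R) (G : 'rV[R]_n -> 'rV[R]_n).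

Lemma test_C1c phi : test_function Om phi -> C1c phi.
Proof.
move=> [cphi [K [cK _ phiK]]]; split; [exact: cphi 0%N|exact: cphi 1%N|].
have [M [_ HM]] := compact_bounded cK.
exists (M + 1) => x Mx; apply: phiK; apply: contra_not Mx => Kx.
by apply: cube_norm; apply: HM Kx; rewrite ltrDl.
Qed.

Lemma test_out phi x : test_function Om phi -> ~ Om x -> phi x = 0.
Proof. by move=> [_ [K [_ KO phiK]]] Ox; apply: phiK => /KO. Qed.

Lemma test_partial_out phi i x : test_function Om phi -> ~ Om x -> partial i phi x = 0.
Proof.
by move=> [_ [K [cK KO phiK]]] Ox; apply: (partial_eq0_out i cK phiK) => /KO.
Qed.

Lemma test_measurable phi : test_function Om phi -> measurable_fun setT phi.
Proof. by move=> [/Cinfty_measurable]. Qed.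

Lemma test_partial_measurable phi i : test_function Om phi -> measurable_fun setT (partial i phi).
Proof. by move=> [/(@Cinfty_partial _ _ _ i)/Cinfty_measurable]. Qed.

Lemma test_functionB phi psi : test_function Om phi -> test_function Om psi ->
  test_function Om (fun x => phi x - psi x).
Proof.
move=> [cphi [K [cK KO phiK]]] [cpsi [L [cL LO psiL]]]; split.
  rewrite (_ : (fun x => _) = phi \+ (cst (-1) \* psi)).
    move=> k; apply: CkD; first exact: cphi.
    by apply: CinftyM => // j; exact: Ck_cst.
  by apply/funext => x /=; rewrite mulN1r.
exists (K `|` L); split; first exact: compactU.
  by move=> x [/KO|/LO].
by move=> x /not_orP[/phiK -> /psiL ->]; rewrite subrr.
Qed.

Lemma test_partialB phi psi i x : test_function Om phi -> test_function Om psi ->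
  partial i (fun x => phi x - psi x) x = partial i phi x - partial i psi x.
Proof.
move=> [/(_ 1%N)/(_ i)[dphi _] _] [/(_ 1%N)/(_ i)[dpsi _] _].
by rewrite /partial (deriveB (dphi x) (dpsi x)).
Qed.

Lemma C1c_compM (S s : R -> R) (f phi : 'rV[R]_n -> R) :
  (forall y, is_derive y (1 : R) S (s y)) -> continuous s -> C1c f -> C1c phi ->
  C1c (fun x => S (f x) * phi x) /\
  forall i x, partial i (fun x => S (f x) * phi x) x =
    S (f x) * partial i phi x + s (f x) * (partial i f x * phi x).
Proof.
move=> dS cs [cf df bf] [cphi dphi bphi].
have cS := is_derive_continuous dS.
have D i x : is_derive x (delta_mx 0 i) (fun x => S (f x) * phi x)
    (S (f x) * partial i phi x + s (f x) * (partial i f x * phi x)).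
  have d1 := is_derive_comp_rV (dS (f x)) (partialP ((df i).1 x)).
  have d2 := is_deriveM d1 (partialP ((dphi i).1 x)).
  by apply: (is_derive_eq d2); rewrite /GRing.scale/=; ring.
have E i x : partial i (fun x => S (f x) * phi x) x =
    S (f x) * partial i phi x + s (f x) * (partial i f x * phi x).
  by have [_] := D i x.
split => //; split.
- apply: continuous_funM => //.
  by move=> x; apply: (@continuous_comp _ _ _ f S); [exact: cf|exact: cS].
- move=> i; split; first by move=> x; have [] := D i x.
  rewrite (_ : partial i _ = fun x => S (f x) * partial i phi x + s (f x) * (partial i f x * phi x)); last exact/funext/E.
  apply: continuous_funD; apply: continuous_funM.
  + by move=> x; apply: (@continuous_comp _ _ _ f S); [exact: cf|exact: cS].
  + exact: (dphi i).2.
  + by move=> x; apply: (@continuous_comp _ _ _ f s); [exact: cf|exact: cs].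
  + by apply: continuous_funM => //; exact: (df i).2.
- by have [M phiM] := bphi; exists M => x /phiM ->; rewrite mulr0.
Qed.

(* What the chain rule needs of a function of W^{1,1}_0 and its gradient. *)
Definition approx v G := [/\ measurable_fun setT v,
  forall i, measurable_fun setT (fun x => G x 0 i),
  mu.-integrable setT (EFin \o v),
  forall i, mu.-integrable setT (EFin \o (fun x => G x 0 i)) &
  exists f : nat -> 'rV[R]_n -> R,
    [/\ forall j, test_function Om (f j),
        {ae mu, forall x, f j x @[j --> \oo] --> v x},
        (\int[mu]_x `|v x - f j x|%:E)%E @[j --> \oo] --> 0%E &
        forall i, (\int[mu]_x `|G x 0 i - partial i (f j) x|%:E)%E @[j --> \oo] --> 0%E]].

Lemma integrable_normB (g h : 'rV[R]_n -> R) :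
  mu.-integrable setT (EFin \o g) -> mu.-integrable setT (EFin \o h) ->
  mu.-integrable setT (EFin \o (fun x => `|g x - h x|)).
Proof.
move=> ig ih; have := integrable_abse (integrableB measurableT ig ih).
exact: eq_integrable.
Qed.

Lemma cvg0_Rintegral (g : nat -> 'rV[R]_n -> R) :
  (\int[mu]_x (g j x)%:E)%E @[j --> \oo] --> 0%E ->
  \int[mu]_x g j x @[j --> \oo] --> (0 : R).
Proof. exact: fine_cvg. Qed.

(** For a test function [f j] the identity says that a partial derivative of S(f_j) phi has integral
    0. In the limit, L^1 convergence handles everything but the factor s(f_j), for which almost
    everywhere convergence is used. *)
Lemma chain_rule_C1 (S s : R -> R) v G phi i :
  (forall y, is_derive y (1 : R) S (s y)) -> continuous s -> (forall y, `|s y| <= 1) ->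
  (forall y z, `|S y - S z| <= `|y - z|) ->
  approx v G -> test_function Om phi ->
  \int[mu]_x (S (v x) * partial i phi x) = - \int[mu]_x (s (v x) * (G x 0 i * phi x)).
Proof.
move=> dS cs s1 S1 [mv mG iv iG [f [tf fv fv1 fG1]]] tphi.
have Cphi := test_C1c tphi; have [cphi dphi bphi] := Cphi.
have cS := is_derive_continuous dS.
have mS (g : 'rV[R]_n -> R) : measurable_fun setT g -> measurable_fun setT (fun x => S (g x)).
  by move=> mg; apply: (measurableT_comp _ mg); exact: continuous_measurable_fun.
have ms (g : 'rV[R]_n -> R) : measurable_fun setT g -> measurable_fun setT (fun x => s (g x)).
  by move=> mg; apply: (measurableT_comp _ mg); exact: continuous_measurable_fun.
have mphi := test_measurable tphi; have mdphi := test_partial_measurable i tphi.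
have idphi := C1c_partial_integrable i Cphi.
have iphi : mu.-integrable setT (EFin \o phi) by exact: bsupp_integrable.
have [M M0 phiM] := bsupp_bounded cphi bphi.
have [N N0 dphiN] := bsupp_bounded (dphi i).2 (bsupp_partial i bphi).
have mf j := test_measurable (tf j); have mdf j := test_partial_measurable i (tf j).
have iGphi : mu.-integrable setT (EFin \o (fun x => G x 0 i * phi x)).
  by under eq_fun do rewrite mulrC; exact: integrable_bddM (fun x _ => phiM x).
have isG (g : 'rV[R]_n -> R) : measurable_fun setT g ->
    mu.-integrable setT (EFin \o (fun x => s (g x) * (G x 0 i * phi x))).
  by move=> mg; apply: (integrable_bddM (M := 1)) => //; exact: ms.
have iS (g : 'rV[R]_n -> R) : mu.-integrable setT (EFin \o g) ->
    mu.-integrable setT (EFin \o (fun x => S (g x) * partial i phi x)).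
  move=> ig; have mg := integrable_measurable ig.
  (* [S] may be nonzero at 0, so S(g) need not be integrable; the constant S(0) is split off and
     paired with the integrable derivative of [phi]. *)
  rewrite (_ : (fun x => _) = (fun x => S 0 * partial i phi x + partial i phi x * (S (g x) - S 0))); last first.
    by apply/funext => x; ring.
  have := integrableD measurableT (integrableZl measurableT (S 0) idphi)
    (@integrable_bddM _ _ _ _ _ (partial i phi) (fun x => S (g x) - S 0) N measurableT _ mdphi (fun x _ => dphiN x)).
  apply; apply: (le_integrable measurableT _ _ ig).
    by apply/measurable_EFinP; apply: measurable_funB => //; exact: mS.
  by move=> x _; rewrite /= lee_fin (le_trans (S1 _ _))// subr0.
have if_ j : mu.-integrable setT (EFin \o f j).
  by have [cf _ bf] := test_C1c (tf j); exact: bsupp_integrable.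
have idf j : mu.-integrable setT (EFin \o partial i (f j)).
  exact: C1c_partial_integrable (test_C1c (tf j)).
set A := \int[mu]_x (S (v x) * partial i phi x).
(* Only the factor s is taken at [f j], the gradient stays that of [v]. Replacing it by the gradient
   of [f j] costs an L^1 error, since |s| <= 1. *)
pose B j := \int[mu]_x (s (f j x) * (G x 0 i * phi x)).
have BB : B j @[j --> \oo] --> \int[mu]_x (s (v x) * (G x 0 i * phi x)).
  apply: (dominated_cvg_Rintegral measurableT _ _ (integrable_norm iGphi)).
  - by move=> j; exact: integrable_measurable (isG _ (mf j)).
  - exact: integrable_measurable (isG _ mv).
  - apply: filterS fv => x fvx _; apply: cvgM; last exact: cvg_cst.
    exact: (cvg_comp _ _ fvx (cs (v x))).
  - by move=> j x _; rewrite normrM ler_piMl.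
have AB j : `|A + B j| <= N * \int[mu]_x `|v x - f j x| + M * \int[mu]_x `|G x 0 i - partial i (f j) x|.
  have [Cj pj] := C1c_compM dS cs (test_C1c (tf j)) Cphi.
  have i1 : mu.-integrable setT (EFin \o (fun x => s (f j x) * (partial i (f j) x * phi x))).
    apply: (integrable_bddM (M := 1)) => //; last exact: ms.
    by under eq_fun do rewrite mulrC; exact: integrable_bddM (fun x _ => phiM x).
  have Z : \int[mu]_x (S (f j x) * partial i phi x) + \int[mu]_x (s (f j x) * (partial i (f j) x * phi x)) = 0.
    rewrite -RintegralD//; last exact: iS.
    rewrite /Rintegral -[RHS](congr1 fine (integral_partial_eq0 i Cj)).
    by congr fine; apply: eq_integral => x _; rewrite pj.
  have iSv := iS _ iv; have iSf := iS _ (if_ j); have isf := isG _ (mf j).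
  rewrite -[A + B j]subr0 -Z opprD addrACA /A /B -!RintegralB//.
  have i2 : mu.-integrable setT (EFin \o (fun x => S (v x) * partial i phi x - S (f j x) * partial i phi x)).
    by have := integrableB measurableT (iS _ iv) (iS _ (if_ j)).
  have i3 : mu.-integrable setT (EFin \o (fun x => s (f j x) * (G x 0 i * phi x) - s (f j x) * (partial i (f j) x * phi x))).
    by have := integrableB measurableT (isG _ (mf j)) i1.
  have i4 := integrable_normB iv (if_ j).
  have i5 := integrable_normB (iG i) (idf j).
  apply: le_trans (ler_normD _ _) _; apply: lerD.
    apply: le_trans (le_normr_Rintegral measurableT i2) _.
    rewrite -RintegralZl//; apply: le_Rintegral => //.
    + exact: integrable_norm.
    + by have := integrableZl measurableT N i4.
    + move=> x _; rewrite -mulrBl normrM mulrC ler_pM//.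
  apply: le_trans (le_normr_Rintegral measurableT i3) _.
  rewrite -RintegralZl//; apply: le_Rintegral => //.
  + exact: integrable_norm.
  + by have := integrableZl measurableT M i5.
  + move=> x _; rewrite -mulrBr -mulrBl normrM (le_trans (ler_piMl _ (s1 _)))//.
    by rewrite normrM mulrC ler_wpM2r.
have lim0 : N * \int[mu]_x `|v x - f j x| + M * \int[mu]_x `|G x 0 i - partial i (f j) x| @[j --> \oo] --> (0 : R).
  have -> : (0 : R) = N * 0 + M * 0 by rewrite !mulr0 addr0.
  apply: cvgD; apply: cvgM; try exact: cvg_cst.
    exact: cvg0_Rintegral.
  exact: cvg0_Rintegral.
have : A + B j @[j --> \oo] --> (0 : R).
  apply/norm_cvg0P; apply: (squeeze_cvgr _ _ lim0); last exact: cvg_cst.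
  by apply: nearW => j; rewrite normr_ge0 AB.
move=> H; apply/eqP; rewrite -addr_eq0; apply/eqP.
apply: (cvg_unique _ (cvgD (cvg_cst A) BB)); last exact: H.
exact: norm_hausdorff.
Qed.

Lemma weak_grad_approx v G phi i : approx v G -> test_function Om phi ->
  \int[mu]_x (v x * partial i phi x) = - \int[mu]_x (G x 0 i * phi x).
Proof.
move=> vG tphi.
have := @chain_rule_C1 id (cst 1) v G phi i (fun y => is_derive_id y 1) _ _ _ vG tphi.
move=> -> //; [|exact: cst_continuous|by move=> y; rewrite normr1].
by congr (- _); apply: eq_Rintegral => x _; rewrite mul1r.
Qed.

(** Dominated convergence along [strunc k m]. As [dstrunc] converges at every point, |s| = k
    included, the level sets |v| = k need no separate argument. *)
Lemma chain_rule_trunc k v G phi i : 0 < k -> approx v G -> test_function Om phi ->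
  \int[mu]_x (trunc k (v x) * partial i phi x) =
  - \int[mu]_x ((`|v x| < k)%R%:R * (G x 0 i * phi x)).
Proof.
move=> k0 vG tphi.
have H m := @chain_rule_C1 _ _ v G phi i (is_derive_strunc k m) (dstrunc_continuous (k := k) (m := m))
  (dstrunc_le1 k m) (strunc_lipschitz k m) vG tphi.
have [mv mG iv iG _] := vG.
have Cphi := test_C1c tphi; have [cphi dphi bphi] := Cphi.
have mphi := test_measurable tphi; have mdphi := test_partial_measurable i tphi.
have idphi := C1c_partial_integrable i Cphi.
have [M M0 phiM] := bsupp_bounded cphi bphi.
have iGphi : mu.-integrable setT (EFin \o (fun x => G x 0 i * phi x)).
  by under eq_fun do rewrite mulrC; exact: integrable_bddM (fun x _ => phiM x).
have mS m : measurable_fun setT (fun x => strunc k m (v x)).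
  by apply: (measurableT_comp _ mv); apply: continuous_measurable_fun; exact: strunc_continuous.
have ms m : measurable_fun setT (fun x => dstrunc k m (v x)).
  by apply: (measurableT_comp _ mv); apply: continuous_measurable_fun; exact: dstrunc_continuous.
have L1 : \int[mu]_x (strunc k m (v x) * partial i phi x) @[m --> \oo] -->
    \int[mu]_x (trunc k (v x) * partial i phi x).
  apply: (dominated_cvg_Rintegral measurableT _ _ (integrableZ_EFin (k + 3) measurableT (integrable_norm idphi))).
  - by move=> m; apply: measurable_funM.
  - apply: measurable_funM => //.
    by apply: (measurable_fun_cvg mS) => x _; exact: cvg_strunc.
  - by apply: aeW => x _; apply: cvgM; [exact: cvg_strunc|exact: cvg_cst].
  - by move=> m x _; rewrite normrM ler_wpM2r// strunc_le.
have L2 : \int[mu]_x (dstrunc k m (v x) * (G x 0 i * phi x)) @[m --> \oo] -->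
    \int[mu]_x ((`|v x| < k)%R%:R * (G x 0 i * phi x)).
  have mGphi : measurable_fun setT (fun x => G x 0 i * phi x) by exact: measurable_funM.
  apply: (dominated_cvg_Rintegral measurableT _ _ (integrable_norm iGphi)).
  - by move=> m; apply: measurable_funM.
  - apply: measurable_funM => //.
    by apply: (measurable_fun_cvg ms) => x _; exact: cvg_dstrunc.
  - by apply: aeW => x _; apply: cvgM; [exact: cvg_dstrunc|exact: cvg_cst].
  - by move=> m x _; rewrite normrM ler_piMl// dstrunc_le1.
apply: (cvg_unique _ L1); first exact: norm_hausdorff.
by rewrite /= (eq_cvg _ _ H); exact: cvgN.
Qed.

End chain_rule.

(** * The Sobolev inequality *)

Section hoelder_powR.
Context d (T : measurableType d) (R : realType).
Variable mu : {measure set T -> \bar R}.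

(** Hoelder's inequality for the conjugate exponents 1/a and 1/(1 - a), with the powers placed on
    the integrands. *)
Lemma hoelder_powR (f g : T -> R) (a : R) : 0 < a < 1 ->
  measurable_fun setT f -> measurable_fun setT g ->
  (forall x, 0 <= f x) -> (forall x, 0 <= g x) ->
  (\int[mu]_x (f x `^ a * g x `^ (1 - a))%:E <=
   (\int[mu]_x (f x)%:E) `^ a * (\int[mu]_x (g x)%:E) `^ (1 - a))%E.
Proof.
move=> /andP[a0 a1] mf mg f0 g0.
have b0 : 0 < 1 - a by rewrite subr_gt0.
have mfa : measurable_fun setT (fun x => f x `^ a).
  by apply: (measurableT_comp (measurable_powR _) mf).
have mgb : measurable_fun setT (fun x => g x `^ (1 - a)).
  by apply: (measurableT_comp (measurable_powR _) mg).
have := @hoelder _ T R mu (fun x => f x `^ a) (fun x => g x `^ (1 - a)) a^-1 (1 - a)^-1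
  mfa mgb.
rewrite !invr_gt0 !invrK => /(_ a0 b0); rewrite addrC subrK => /(_ erefl).
rewrite Lnorm1 !Lnorm_EFinE !invrK => H; apply: le_trans (le_trans H _).
  rewrite le_eqVlt; apply/orP; left; apply/eqP; apply: eq_integral => x _ /=.
  by rewrite ger0_norm// mulr_ge0// powR_ge0.
rewrite le_eqVlt; apply/orP; left; apply/eqP; congr (_ `^ _ * _ `^ _)%E;
  apply: eq_integral => x _.
  by rewrite (ger0_norm (powR_ge0 _ _)) -powRrM mulfV ?gt_eqF// powRr1.
by rewrite (ger0_norm (powR_ge0 _ _)) -powRrM mulfV ?gt_eqF// powRr1.
Qed.

End hoelder_powR.

Section Loomis_Whitney.
Context {R : realType}.

(* All iterated integrals of such a function are finite. *)
Definition bdd_supp n (M : R) (phi : 'rV[R]_n -> R) := [/\ measurable_fun setT phi,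
  forall x, 0 <= phi x <= M & forall x, ~ cube M x -> phi x = 0].

#[local] Arguments uncons_rV : simpl never.

(* lw phi x is the product over i of the integral of phi along the line
   through x parallel to the i-th axis. *)
Fixpoint lw n : ('rV[R]_n -> R) -> 'rV[R]_n -> R :=
  match n with
  | 0 => fun _ _ => 1
  | m.+1 => fun phi x =>
      \int[lebesgue_measure]_s (phi (cons_rV (s, (uncons_rV x).2))) *
      lw (fun y => phi (cons_rV ((uncons_rV x).1, y))) (uncons_rV x).2
  end.

Lemma bdd_supp_slice n M (phi : 'rV[R]_n.+1 -> R) t : bdd_supp M phi ->
  bdd_supp M (fun y => phi (cons_rV (t, y))).
Proof.
move=> [mphi phiM phi0]; split => //.
  apply: measurableT_comp => //.
  exact: (measurableT_comp (@measurable_cons_rV R n) (pair1_measurable t)).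
by move=> y My; apply: phi0; rewrite cons_rV_cube => -[].
Qed.

Lemma bdd_supp_integrable n M (phi : 'rV[R]_n -> R) : bdd_supp M phi ->
  (lebesgue R n).-integrable setT (EFin \o phi).
Proof.
move=> [mphi phiM phi0]; apply: (bounded_supp_integrable mphi (C := M)) phi0 => x.
by have /andP[h1 h2] := phiM x; rewrite ger0_norm.
Qed.

Lemma bounded_supp_integrable_line (C M : R) (g : R -> R) : measurable_fun setT g ->
  (forall s, `|g s| <= C) -> (forall s, M < `|s| -> g s = 0) ->
  lebesgue_measure.-integrable setT (EFin \o g).
Proof.
move=> mg gC gM; have mI : measurable (`[- M, M]%classic : set (measurableTypeR R)).
  exact: measurable_itv.
rewrite (_ : EFin \o g = (EFin \o g) \_ `[- M, M]).
  apply/(integrable_mkcond _ mI).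
  apply: measurable_bounded_integrable.
  - exact: measurable_itv.
  - by rewrite /= lebesgue_measure_itv; case: ifP => // _; rewrite -EFinB ltry.
  - exact: measurable_funTS.
  - by exists C; split; [exact: num_real|move=> D CD x _; apply: le_trans (gC x) _; exact: ltW].
apply/funext => s; rewrite patchE; case: ifPn => //.
rewrite notin_setE/= in_itv/= => /negP.
by rewrite -ler_norml -ltNge => /gM ->.
Qed.

Lemma bdd_supp_integrable_line n M (phi : 'rV[R]_n.+1 -> R) y : bdd_supp M phi ->
  lebesgue_measure.-integrable setT (EFin \o (fun s => phi (cons_rV (s, y)))).
Proof.
move=> [mphi phiM phi0].
have mpy : measurable_fun setT (fun s => phi (cons_rV (s, y))).
  apply: measurableT_comp => //.
  exact: (measurableT_comp (@measurable_cons_rV R n) (pair2_measurable y)).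
apply: (bounded_supp_integrable_line mpy (C := M) (M := M)) => s.
  by have /andP[h1 h2] := phiM (cons_rV (s, y)); rewrite ger0_norm.
move=> Ms; apply: phi0; rewrite cons_rV_cube => -[].
by rewrite -ler_norml leNgt Ms.
Qed.

Lemma measurable_line_integral d (Z : measurableType d) n M (phi : Z -> 'rV[R]_n.+1 -> R) :
  (forall z, bdd_supp M (phi z)) ->
  measurable_fun setT (fun zx : Z * 'rV[R]_n.+1 => phi zx.1 zx.2) ->
  measurable_fun setT (fun zy : Z * 'rV[R]_n =>
    \int[lebesgue_measure]_s (phi zy.1 (cons_rV (s, zy.2)))).
Proof.
move=> bphi mphi.
have := @measurable_fun_fubini_tonelli_F _ _ (Z * 'rV[R]_n)%type (measurableTypeR R) R
  lebesgue_measure (fun w => (phi w.1.1 (cons_rV (w.2, w.1.2)))%:E).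
move=> H; apply: (measurableT_comp (fine_measurable measurableT)); apply: H.
  apply/measurable_EFinP.
  apply: (measurableT_comp mphi (g := fun w : Z * 'rV[R]_n * measurableTypeR R => (w.1.1, cons_rV (w.2, w.1.2)))).
  apply: measurable_fun_pair.
    exact: (measurableT_comp measurable_fst measurable_fst).
  apply: (measurableT_comp (@measurable_cons_rV R n)).
  apply: measurable_fun_pair; first exact: measurable_snd.
  exact: (measurableT_comp measurable_snd measurable_fst).
by move=> w; rewrite lee_fin; have [_ /(_ (cons_rV (w.2, w.1.2)))/andP[]] := bphi w.1.1.
Qed.

(** The parameter space [Z] collects the coordinates that the recursion in [lw] has already frozen,
    so that joint measurability survives the induction. *)
Lemma measurable_lw d (Z : measurableType d) n M (phi : Z -> 'rV[R]_n -> R) :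
  (forall z, bdd_supp M (phi z)) ->
  measurable_fun setT (fun zx : Z * 'rV[R]_n => phi zx.1 zx.2) ->
  measurable_fun setT (fun zx : Z * 'rV[R]_n => lw (phi zx.1) zx.2).
Proof.
elim: n d Z phi => [|n IH] d Z phi bphi mphi /=; first exact: measurable_cst.
apply: measurable_funM.
  have m1 := measurable_line_integral bphi mphi.
  apply: (measurableT_comp m1 (g := fun zx : Z * 'rV[R]_n.+1 => (zx.1, (uncons_rV zx.2).2))).
  apply: measurable_fun_pair; first exact: measurable_fst.
  apply: (measurableT_comp measurable_snd).
  exact: (measurableT_comp (@measurable_uncons_rV R n) measurable_snd).
have m2 := IH _ (Z * measurableTypeR R)%type (fun zt y => phi zt.1 (cons_rV (zt.2, y))) _ _.
apply: (measurableT_comp (m2 _ _) (g := fun zx : Z * 'rV[R]_n.+1 =>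
  ((zx.1, (uncons_rV zx.2).1), (uncons_rV zx.2).2))).
- by move=> zt; exact: bdd_supp_slice.
- apply: (measurableT_comp mphi (g := fun w : Z * measurableTypeR R * 'rV[R]_n => (w.1.1, cons_rV (w.1.2, w.2)))).
  apply: measurable_fun_pair.
    exact: (measurableT_comp measurable_fst measurable_fst).
  apply: (measurableT_comp (@measurable_cons_rV R n)).
  apply: measurable_fun_pair; last exact: measurable_snd.
  exact: (measurableT_comp measurable_snd measurable_fst).
- apply: measurable_fun_pair; last first.
    apply: (measurableT_comp measurable_snd).
    exact: (measurableT_comp (@measurable_uncons_rV R n) measurable_snd).
  apply: measurable_fun_pair; first exact: measurable_fst.
  apply: (measurableT_comp measurable_fst).
  exact: (measurableT_comp (@measurable_uncons_rV R n) measurable_snd).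
Qed.

Lemma measurable_lw1 n M (phi : 'rV[R]_n -> R) : bdd_supp M phi ->
  measurable_fun setT (lw phi).
Proof.
move=> bphi; have [mphi _ _] := bphi.
have := @measurable_lw _ unit n M (fun _ => phi) (fun _ => bphi)
  (measurableT_comp mphi measurable_snd).
move=> m; exact: (measurableT_comp m (pair1_measurable tt)).
Qed.

Lemma lw_ge0 n M (phi : 'rV[R]_n -> R) x : bdd_supp M phi -> 0 <= lw phi x.
Proof.
elim: n phi x => [|n IH] phi x bphi //=; apply: mulr_ge0.
  apply: Rintegral_ge0 => s _.
  by have [_ /(_ (cons_rV (s, (uncons_rV x).2)))/andP[]] := bphi.
by apply: IH; exact: bdd_supp_slice.
Qed.

Lemma lw_cons n (phi : 'rV[R]_n.+1 -> R) t y : lw phi (cons_rV (t, y)) =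
  \int[lebesgue_measure]_s (phi (cons_rV (s, y))) * lw (fun y => phi (cons_rV (t, y))) y.
Proof.
pose F z := \int[lebesgue_measure]_s (phi (cons_rV (s, z.2))) *
  lw (fun y => phi (cons_rV (z.1, y))) z.2.
by rewrite -[LHS]/(F (uncons_rV (cons_rV (t, y)))) cons_rVK.
Qed.

(** On the line there is a single direction, so [lw psi] is constant, equal to the whole
    integral. *)
Lemma lebesgue1E (psi : 'rV[R]_1 -> R) (y : 'rV[R]_1) M : bdd_supp M psi ->
  (lw psi y)%:E = (\int[lebesgue R 1]_z (psi z)%:E)%E.
Proof.
move=> bpsi; have [mpsi psiM _] := bpsi.
rewrite ge0_integral_rVS; last 2 first.
- exact/measurable_EFinP.
- by move=> x; rewrite lee_fin; have /andP[] := psiM x.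
rewrite /= mulr1 /Rintegral fineK; last first.
  exact: integrable_fin_num (bdd_supp_integrable_line _ bpsi).
apply: eq_integral => s _.
rewrite (_ : (fun y0 => _) = cst (psi (cons_rV (s, (uncons_rV y).2)))%:E).
  by rewrite integral_cst//= diracT mule1.
by apply/funext => z; congr (psi (cons_rV (s, _)))%:E; apply/rowP => -[].
Qed.

Lemma le_poweR (x y : \bar R) r : 0 <= r -> (0 <= x)%E -> (x <= y)%E ->
  (x `^ r <= y `^ r)%E.
Proof.
move=> r0 x0 xy; apply: gt0_ler_poweR => //; rewrite in_itv/= leey andbT//.
exact: le_trans xy.
Qed.

Lemma line_integral_facts n M (phi : 'rV[R]_n.+1 -> R)
    (A := fun y => \int[lebesgue_measure]_s (phi (cons_rV (s, y)))) : bdd_supp M phi ->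
  [/\ measurable_fun setT A, forall y, 0 <= A y &
    (\int[lebesgue R n.+1]_x (phi x)%:E = \int[lebesgue R n]_y (A y)%:E)%E].
Proof.
move=> bphi; have [mphi phiM _] := bphi; split.
- have := @measurable_line_integral _ unit n M (fun _ => phi) (fun _ => bphi)
    (measurableT_comp mphi measurable_snd).
  by move=> m; exact: (measurableT_comp m (pair1_measurable tt)).
- by move=> y; apply: Rintegral_ge0 => s _; have /andP[] := phiM (cons_rV (s, y)).
rewrite ge0_integral_rVS_swap; last 2 first.
- exact/measurable_EFinP.
- by move=> x; rewrite lee_fin; have /andP[] := phiM x.
apply: eq_integral => y _.
by rewrite /A /Rintegral fineK//; exact: integrable_fin_num (bdd_supp_integrable_line _ bphi).
Qed.

Lemma slice_integral_facts n M (phi : 'rV[R]_n.+1 -> R)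
    (Phi := fun t => (\int[lebesgue R n]_z (phi (cons_rV (t, z)))%:E)%E) : bdd_supp M phi ->
  [/\ measurable_fun setT Phi, forall t, (0 <= Phi t)%E &
    (\int[lebesgue R n.+1]_x (phi x)%:E = \int[lebesgue_measure]_t Phi t)%E].
Proof.
move=> [mphi phiM _].
have mE : measurable_fun setT (fun x => (phi x)%:E) by exact/measurable_EFinP.
have phi0 x : (0 <= (phi x)%:E)%E by rewrite lee_fin; have /andP[] := phiM x.
split; last by rewrite ge0_integral_rVS.
- apply: (@measurable_fun_fubini_tonelli_F _ _ (measurableTypeR R) 'rV[R]_n R (lebesgue R n)
    (fun z => (phi (cons_rV z))%:E)).
    exact: (measurableT_comp mE (@measurable_cons_rV R n)).
  by move=> z; exact: phi0.
- by move=> t; apply: integral_ge0.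
Qed.

(** Let A(y) be the integral along the first axis, phi_t the slice at t and Phi(t) its integral, so
    that lw phi (t, y) = A(y) lw phi_t (y). Hoelder in y with weights a and 1 - a and the induction
    hypothesis bound the integral over the slice by I^a Phi(t); integrating in t gives I^(1 + a). *)
Lemma Loomis_Whitney n M (phi : 'rV[R]_n.+2 -> R) : bdd_supp M phi ->
  (\int[lebesgue R n.+2]_x (lw phi x `^ n.+1%:R^-1)%:E <=
   (\int[lebesgue R n.+2]_x (phi x)%:E) `^ (n.+2%:R / n.+1%:R))%E.
Proof.
elim: n phi => [|n IH] phi bphi; have mlw := measurable_lw1 bphi;
  have [mPhi Phi0 IPhi] := slice_integral_facts bphi;
  have [mA A0 IA] := line_integral_facts bphi.
  have If := integrable_fin_num measurableT (bdd_supp_integrable bphi).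
  set I := (\int[lebesgue R 2]_x (phi x)%:E)%E in IPhi IA If *.
  have I0 : (0 <= I)%E by rewrite IA; apply: integral_ge0 => y _; rewrite lee_fin.
  rewrite invr1 mulr1 ge0_integral_rVS; last 2 first.
  - by apply/measurable_EFinP; apply: (measurableT_comp (measurable_powR _) mlw).
  - by move=> x; rewrite lee_fin powR_ge0.
  (* In dimension 2 the second factor of [lw] does not depend on y, so the integral factorizes
     exactly. *)
  have E t : (\int[lebesgue R 1]_y (lw phi (cons_rV (t, y)) `^ 1)%:E =
      (\int[lebesgue R 1]_z (phi (cons_rV (t, z)))%:E) * I)%E.
    rewrite IA -ge0_integralZl//.
    - apply: eq_integral => y _; rewrite powRr1; last exact: lw_ge0 bphi.
      rewrite lw_cons EFinM muleC; congr (_ * _)%E.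
      exact: lebesgue1E (bdd_supp_slice t bphi).
    - exact/measurable_EFinP.
    - by move=> y _; rewrite lee_fin.
  under eq_integral do rewrite E.
  rewrite ge0_integralZr// -IPhi.
  rewrite -(fineK If) poweR_EFin -EFinM lee_fin.
  by rewrite (powR_mulrn 2)// ?fine_ge0// expr2.
pose A y := \int[lebesgue_measure]_s (phi (cons_rV (s, y))).
pose Phi t := (\int[lebesgue R n.+2]_z (phi (cons_rV (t, z)))%:E)%E.
have {}A0 y : 0 <= A y := A0 y; have {}Phi0 t : (0 <= Phi t)%E := Phi0 t.
set I := (\int[lebesgue R n.+3]_x (phi x)%:E)%E in IPhi IA *.
have {}IPhi : I = (\int[lebesgue_measure]_t Phi t)%E := IPhi.
have {}IA : I = (\int[lebesgue R n.+2]_y (A y)%:E)%E := IA.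
have I0 : (0 <= I)%E by rewrite IA; apply: integral_ge0 => y _; rewrite lee_fin.
have mlwp : measurable_fun setT (fun x => (lw phi x `^ n.+2%:R^-1)%:E).
  by apply/measurable_EFinP; apply: (measurableT_comp (measurable_powR _) mlw).
have lwp0 x : (0 <= (lw phi x `^ n.+2%:R^-1)%:E)%E by rewrite lee_fin powR_ge0.
(* With this weight 1 - a = (n+1)/(n+2), the inverse of the power in the induction hypothesis, so
   that Phi(t) comes out with exponent 1. *)
pose a : R := n.+2%:R^-1.
have a01 : 0 < a < 1 by rewrite invr_gt0 ltr0n/= invf_lt1 ?ltr1n ?ltr0n.
have a1 : 1 - a = n.+1%:R / n.+2%:R.
  have N0 : n.+2%:R != 0 :> R by rewrite pnatr_eq0.
  by apply: (mulIf N0); rewrite mulrBl mulVf// mul1r divfK// -natr1 addrK.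
rewrite ge0_integral_rVS//.
apply: (@le_trans _ _ (\int[lebesgue_measure]_t (I `^ a * Phi t))%E).
  apply: ge0_le_integral => //.
  - by move=> t _; exact: integral_ge0.
  - apply: (@measurable_fun_fubini_tonelli_F _ _ (measurableTypeR R) 'rV[R]_n.+2 R (lebesgue R n.+2) (fun z => (lw phi (cons_rV z) `^ n.+2%:R^-1)%:E)).
      exact: (measurableT_comp mlwp (@measurable_cons_rV R n.+2)).
    by move=> z; exact: lwp0.
  - by apply: emeasurable_funM => //; exact: measurable_cst.
  move=> t _; have bt := bdd_supp_slice t bphi.
  have := @hoelder_powR _ _ R (lebesgue R n.+2) A (fun y => lw (fun z => phi (cons_rV (t, z))) y `^ n.+1%:R^-1) a a01 mA.
  have -> : (\int[lebesgue R n.+2]_x (A x `^ a * (lw (fun z => phi (cons_rV (t, z))) x `^ n.+1%:R^-1) `^ (1 - a))%:E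
     = \int[lebesgue R n.+2]_y (lw phi (cons_rV (t, y)) `^ n.+2%:R^-1)%:E)%E.
    apply: eq_integral => y _; rewrite (lw_cons phi t y) (powRM _ (A0 y) (lw_ge0 _ bt)).
    by rewrite -powRrM a1 mulKf// pnatr_eq0.
  rewrite -IA => H; apply: le_trans (H _ _ _) _ => //.
  - by apply: (measurableT_comp (measurable_powR _) (measurable_lw1 bt)).
  - by move=> y; exact: powR_ge0.
  rewrite lee_wpmul2l ?poweR_ge0//.
  have /andP[_ a2] := a01.
  apply: le_trans (le_poweR _ _ (IH _ bt)) _; first by rewrite subr_ge0 ltW.
    by apply: integral_ge0 => y _; rewrite lee_fin powR_ge0.
  rewrite -poweRrM a1 mulrA divfK ?pnatr_eq0// mulfV ?pnatr_eq0// poweRe1//.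
  exact: Phi0.
rewrite ge0_integralZl ?poweR_ge0// -IPhi.
have [->|IN0] := eqVneq I 0%E; first by rewrite mule0 poweR_ge0.
rewrite -{2}(poweRe1 I0) -poweRD; last first.
  by apply: nneg_neq0_poweRD_def => //; rewrite ltW//; have /andP[] := a01.
rewrite (_ : a + 1 = n.+3%:R / n.+2%:R)// /a -[X in _ + X](@mulfV _ (n.+2%:R)) ?pnatr_eq0//.
by rewrite addrC -[X in _ + X]mul1r -mulrDl natr1.
Qed.

End Loomis_Whitney.

Section Gagliardo_Nirenberg.
Context {R : realType}.

(* At every point, g is at most the integral of phi along each of the n lines
   through it parallel to the axes. *)
Fixpoint line_dominated n : ('rV[R]_n -> R) -> ('rV[R]_n -> R) -> Prop :=
  match n with
  | 0 => fun _ _ => True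
  | m.+1 => fun g phi =>
      (forall t y, g (cons_rV (t, y)) <= \int[lebesgue_measure]_s (phi (cons_rV (s, y)))) /\
      (forall t, line_dominated (fun y => g (cons_rV (t, y))) (fun y => phi (cons_rV (t, y))))
  end.

Lemma line_dominated_lw n M (g phi : 'rV[R]_n -> R) x : bdd_supp M phi ->
  (forall x, 0 <= g x) -> line_dominated g phi -> g x ^+ n <= lw phi x.
Proof.
elim: n g phi x => [|n IH] g phi x bphi g0; first by rewrite expr0.
rewrite -(uncons_rVK x); case: (uncons_rV x) => t y [gphi0 gphiS].
rewrite lw_cons exprS ler_pM ?exprn_ge0//.
exact: (IH (fun y => g (cons_rV (t, y))) _ y (bdd_supp_slice t bphi) (fun y => g0 _) (gphiS t)).
Qed.

(** The value at a point is the integral of the derivative along a half-line coming from outside the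
    support. *)
Lemma C1c_line_dominated n M (g phi : 'rV[R]_n -> R) : C1c g -> bdd_supp M phi ->
  (forall i x, `|partial i g x| <= phi x) -> line_dominated (fun x => `|g x|) phi.
Proof.
elim: n g phi => [//|n IH] g phi Cg bphi gphi; split; last first.
  move=> t; apply: IH; [exact: C1c_slice|exact: bdd_supp_slice|].
  by move=> i y; rewrite partial_sliceS.
move=> t y; have [cg dg [N gN]] := Cg; have [mphi phiM _] := bphi.
pose h s := g (cons_rV (s, y)); pose dh s := partial 0 g (cons_rV (s, y)).
have hdh s : is_derive s (1 : R) h (dh s).
  by apply: is_derive_slice0; exact: partialP ((dg 0).1 _).
have cdh : continuous dh.
  move=> s; apply: (@continuous_comp _ _ _ (fun t : R => cons_rV (t, y) : 'rV[R]_n.+1)).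
    exact: continuous_cons_rVl.
  exact: (dg 0).2.
(* A starting point to the left of both [t] and the support. *)
pose a := - (`|t| + `|N| + 1).
have at_ : a < t.
  have : - t <= `|t| by rewrite -normrN ler_norm.
  by have := normr_ge0 N; rewrite /a; lra.
have ha : h a = 0.
  apply: gN; rewrite cons_rV_cube => -[/andP[h1 _] _]; move: h1.
  by have := ler_norm N; have := normr_ge0 t; rewrite /a; lra.
have mphil : measurable_fun setT (fun s : measurableTypeR R => (phi (cons_rV (s, y)))%:E).
  exact: (measurable_int _ (bdd_supp_integrable_line y bphi)).
have phi0 x : (0 <= (phi x)%:E)%E by rewrite lee_fin; have /andP[] := phiM x.
rewrite -lee_fin [leRHS]fineK; last exact: integrable_fin_num (bdd_supp_integrable_line y bphi).
have mI : measurable (`[a, t]%classic : set (measurableTypeR R)) by exact: measurable_itv.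
have mdh : measurable_fun (`[a, t]%classic : set (measurableTypeR R)) (fun s => (dh s)%:E).
  by apply/measurable_EFinP; apply: measurable_funTS; exact: continuous_measurable_fun.
have -> : (`|g (cons_rV (t, y))|%:E = `|\int[lebesgue_measure]_(s in `[a, t]) (dh s)%:E|)%E.
  by rewrite (FTC at_ hdh cdh) ha sube0.
apply: (le_trans (le_abse_integral _ mI mdh)).
apply: (@le_trans _ _ (\int[lebesgue_measure]_(s in `[a, t]) (phi (cons_rV (s, y)))%:E)%E).
  apply: ge0_le_integral => //.
  - exact: measurableT_comp.
  - exact: measurable_funTS.
  - by move=> s _; rewrite lee_fin; exact: gphi.
exact: ge0_subset_integral.
Qed.

(** A single [phi] majorizes all partial derivatives, so |g|^(n+2) is at most [lw phi], and the
    Loomis-Whitney inequality applies to its power 1/(n+1). *)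
Lemma Gagliardo_Nirenberg n M (g phi : 'rV[R]_n.+2 -> R) : C1c g -> bdd_supp M phi ->
  (forall i x, `|partial i g x| <= phi x) ->
  (\int[lebesgue R n.+2]_x (`|g x| `^ (n.+2%:R / n.+1%:R))%:E <=
   (\int[lebesgue R n.+2]_x (phi x)%:E) `^ (n.+2%:R / n.+1%:R))%E.
Proof.
move=> Cg bphi gphi; apply: le_trans (Loomis_Whitney bphi).
have [cg _ _] := Cg.
apply: ge0_le_integral => //.
- apply/measurable_EFinP; apply: (measurableT_comp (measurable_powR _)).
  by apply: measurableT_comp => //; exact: continuous_measurable_rV.
- apply/measurable_EFinP; apply: (measurableT_comp (measurable_powR _)).
  exact: measurable_lw1 bphi.
- move=> x _; rewrite lee_fin powRrM powR_mulrn//.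
  apply: ge0_ler_powR; rewrite ?nnegrE ?invr_ge0//.
  + exact: lw_ge0 bphi.
  + apply: (line_dominated_lw (g := fun x => `|g x|) x bphi) => //.
    exact: C1c_line_dominated bphi gphi.
Qed.

End Gagliardo_Nirenberg.

Local Notation measurable_field F := (forall i, measurable_fun setT (fun x => F x 0 i)).

Local Notation Lnorm_field mu p F := ('N[mu]_p%:E[EFin \o (fun x => enorm (F x))])%E.

Section euclidean_norm.
Context {R : realType} {n : nat}.
Implicit Types x y : 'rV[R]_n.

Lemma dotr_ge0 x : 0 <= dotr x x.
Proof. by apply: sumr_ge0 => i _; rewrite -expr2 sqr_ge0. Qed.

Lemma enorm_ge0 x : 0 <= enorm x. Proof. exact: sqrtr_ge0. Qed.

Lemma enorm_sqr x : enorm x ^+ 2 = dotr x x.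
Proof. by rewrite /enorm sqr_sqrtr// dotr_ge0. Qed.

Lemma coord_le_enorm x i : `|x 0 i| <= enorm x.
Proof.
rewrite -(@ler_pXn2r _ 2) ?nnegrE ?enorm_ge0// enorm_sqr real_normK ?num_real//.
rewrite /dotr (bigD1 i)//= -expr2 lerDl.
by apply: sumr_ge0 => j _; rewrite -expr2 sqr_ge0.
Qed.

Lemma dotrC x y : dotr x y = dotr y x.
Proof. by apply: eq_bigr => i _; rewrite mulrC. Qed.

Lemma dotrBl x y z : dotr (x - y) z = dotr x z - dotr y z.
Proof. by rewrite -sumrB; apply: eq_bigr => i _; rewrite !mxE mulrBl. Qed.

Lemma dotrDl x y z : dotr (x + y) z = dotr x z + dotr y z.
Proof. by rewrite -big_split; apply: eq_bigr => i _; rewrite !mxE mulrDl. Qed.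

Lemma dotrDr x y z : dotr z (x + y) = dotr z x + dotr z y.
Proof. by rewrite dotrC dotrDl !(dotrC z). Qed.

Lemma dotrZl a x y : dotr (a *: x) y = a * dotr x y.
Proof. by rewrite mulr_sumr; apply: eq_bigr => i _; rewrite !mxE mulrA. Qed.

Lemma dotrBr x y z : dotr z (x - y) = dotr z x - dotr z y.
Proof. by rewrite dotrC dotrBl !(dotrC z). Qed.

Lemma dotrZr a x y : dotr x (a *: y) = a * dotr x y.
Proof. by rewrite dotrC dotrZl dotrC. Qed.

Lemma dotr_le x y : `|dotr x y| <= enorm x * enorm y.
Proof.
have [x0|xN0] := eqVneq (enorm x) 0.
  have -> : x = 0.
    apply/rowP => i; rewrite mxE; apply/eqP.
    by rewrite -normr_le0 -x0 coord_le_enorm.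
  by rewrite (_ : dotr 0 y = 0) ?normr0 ?mulr_ge0 ?enorm_ge0// /dotr big1// => i _; rewrite mxE mul0r.
have x0 : 0 < enorm x by rewrite lt_neqAle eq_sym xN0 enorm_ge0.
have X0 : 0 < dotr x x by rewrite -enorm_sqr exprn_gt0.
rewrite -(@ler_pXn2r _ 2) ?nnegrE ?mulr_ge0 ?enorm_ge0// exprMn !enorm_sqr real_normK ?num_real//.
(* Cauchy-Schwarz from the squared length of |x|^2 y - (x . y) x, which is |x|^2 times the gap. *)
have := dotr_ge0 (dotr x x *: y - dotr x y *: x).
rewrite !dotrBl !dotrBr !dotrZl !dotrZr (dotrC y x) => H.
have : 0 <= dotr x x * (dotr x x * dotr y y - dotr x y ^+ 2) by apply: le_trans H _; nra.
by rewrite pmulr_rge0// subr_ge0.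
Qed.

Lemma enormD x y : enorm (x + y) <= enorm x + enorm y.
Proof.
rewrite -(@ler_pXn2r _ 2) ?nnegrE ?addr_ge0 ?enorm_ge0// sqrrD !enorm_sqr.
have -> : dotr (x + y) (x + y) = dotr x x + dotr x y *+ 2 + dotr y y.
  by rewrite !dotrDl !dotrDr (dotrC y x); ring.
have := ler_norm (dotr x y); have := dotr_le x y; set e := _ * _; lra.
Qed.

Lemma enormN x : enorm (- x) = enorm x.
Proof. by rewrite /enorm -scaleN1r dotrZl dotrZr; congr Num.sqrt; ring. Qed.

Lemma enorm0 : enorm (0 : 'rV[R]_n) = 0.
Proof. by rewrite /enorm /dotr big1 ?sqrtr0// => i _; rewrite mxE mul0r. Qed.

Lemma measurable_dotr d (T : measurableType d) (F G : T -> 'rV[R]_n) :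
  measurable_field F ->
  measurable_field G ->
  measurable_fun setT (fun x : T => dotr (F x) (G x)).
Proof.
move=> mF mG; rewrite /dotr.
have := @measurable_sum _ T R setT _ (index_enum 'I_n) (fun (i : 'I_n) (x : T) => F x 0 i * G x 0 i).
by apply=> i; exact: measurable_funM.
Qed.

Lemma measurable_enorm d (T : measurableType d) (F : T -> 'rV[R]_n) :
  measurable_field F ->
  measurable_fun setT (fun x : T => enorm (F x)).
Proof.
move=> mF; apply: (measurableT_comp _ (measurable_dotr mF mF)).
by apply: continuous_measurable_fun; exact: sqrt_continuous.
Qed.

End euclidean_norm.

Section power_function.
Context {R : realType}.
Variables (g : R) (g2 : 2 <= g).

Let S (y : R) := `|y| `^ g.
Let s (y : R) := g * (Num.sg y * `|y| `^ (g - 1)).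

Let g1_ge1 : 1 <= g - 1. Proof. by move: g2; lra. Qed.

Let near0_le (d : R) : 0 < d -> \forall z \near (0 : R), `|z| <= d.
Proof.
move=> d0; have := @cvgr_dist_le R R R (nbhs (0 : R)) (nbhs_filter (0 : R)) id 0 (@cvg_id _ _) d d0.
by apply: filterS => z; rewrite sub0r normrN.
Qed.

Let cvg_sg_powR0 : Num.sg z * `|z| `^ (g - 1) @[z --> (0 : R)] --> Num.sg 0 * `|0 : R| `^ (g - 1).
Proof.
apply/cvgrPdist_le => /= e e0; near=> z.
rewrite sgr0 mul0r sub0r normrN normrM (ger0_norm (powR_ge0 _ _)).
(* Since g - 1 >= 1, |z|^(g-1) <= |z| as soon as |z| <= 1. *)
have z1 : `|z| <= 1 by near: z; exact: near0_le.
have ze : `|z| <= e by near: z; exact: near0_le.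
apply: le_trans ze.
have [->|z0] := eqVneq z 0; first by rewrite sgr0 normr0 mul0r.
by rewrite normr_sg z0 mul1r ge1r_powR// normr_gt0 z0.
Unshelve. all: by end_near. Qed.

Lemma is_derive_norm_powR (y : R) : is_derive y (1 : R) S (s y).
Proof.
have [y0|y0|->] := ltgtP y 0.
- have ny0 : 0 < - y by rewrite oppr_gt0.
  have d := @is_derive1_comp R (@powR R ^~ g) -%R y _ _ (is_derive1_powR g ny0) (is_deriveNid y (1 : R)).
  have {}d : is_derive y (1 : R) (@powR R ^~ g \o -%R) (s y).
    by apply: (is_derive_eq d); rewrite /s ltr0_sg// ltr0_norm//; ring.
  apply: near_eq_is_derive d; near=> z; rewrite /S /= ltr0_norm//.
  by near: z; exact: lt_nbhsl.
- have d : is_derive y (1 : R) (@powR R ^~ g) (s y).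
    apply: (is_derive_eq (is_derive1_powR g y0)).
    by rewrite /s gtr0_sg// gtr0_norm// mul1r.
  apply: near_eq_is_derive d; near=> z; rewrite /S gtr0_norm//.
  by near: z; exact: lt_nbhsr.
- apply/is_derive1_caratheodory; exists (fun z => Num.sg z * `|z| `^ (g - 1)); split.
  + move=> z; rewrite /S normr0 powR0 ?subr0; last by move: g2; lra.
    have [->|z0] := eqVneq z 0; first by rewrite mulr0 normr0 powR0//; move: g2; lra.
    have nz0 : 0 < `|z| by rewrite normr_gt0.
    rewrite mulrAC -normrEsg.
    rewrite mulr_powRB1// ; move: g2; lra.
  + exact: cvg_sg_powR0.
  + by rewrite /s sgr0 !mul0r mulr0.
Unshelve. all: by end_near. Qed.

Lemma norm_powR_derive_continuous : continuous s.
Proof.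
move=> y; apply: cvgM; first exact: cvg_cst.
have [y0|y0|->] := ltgtP y 0.
- have ny0 : 0 < - y by rewrite oppr_gt0.
  have [d _] := @is_derive1_comp R (@powR R ^~ (g - 1)) -%R y _ _ (is_derive1_powR (g - 1) ny0) (is_deriveNid y (1 : R)).
  have {}d : (fun z : R => - (- z) `^ (g - 1)) z @[z --> y] --> - (- y) `^ (g - 1).
    by apply: cvgN; move: d => /derivable1_diffP/differentiable_continuous.
  rewrite ltr0_sg// ltr0_norm// mulN1r.
  apply: (cvg_trans _ d); apply: near_eq_cvg; near=> z.
  have z0 : z < 0 by near: z; exact: lt_nbhsl.
  by rewrite ltr0_sg// ltr0_norm// mulN1r.
- have [d _] := is_derive1_powR (g - 1) y0.
  have {}d : (fun z : R => z `^ (g - 1)) z @[z --> y] --> y `^ (g - 1).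
    by move: d => /derivable1_diffP/differentiable_continuous.
  rewrite gtr0_sg// gtr0_norm// mul1r.
  apply: (cvg_trans _ d); apply: near_eq_cvg; near=> z.
  have z0 : 0 < z by near: z; exact: lt_nbhsr.
  by rewrite gtr0_sg// gtr0_norm// mul1r.
- exact: cvg_sg_powR0.
Unshelve. all: by end_near. Qed.

Lemma norm_powR_derive_norm y : `|s y| <= g * `|y| `^ (g - 1).
Proof.
have g0 : 0 <= g by move: g2; lra.
rewrite normrM ger0_norm// ler_wpM2l// normrM (ger0_norm (powR_ge0 _ _)).
by rewrite ler_piMl ?powR_ge0// normr_sg; case: eqP.
Qed.

End power_function.

Section sobolev_exponents.
Context {R : realType}.
Variables N p : R.
Hypotheses (p0 : 0 < p) (Np : 0 < N - p) (N1 : 0 < N - 1) (N0 : 0 < N).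

Let nz : [/\ p != 0, N - p != 0, N - 1 != 0 & N != 0].
Proof. by rewrite !gt_eqF. Qed.

(** This determines gam = p (N - 1) / (N - p): the Gagliardo-Nirenberg power N / (N - 1) of |f|^gam
    must be |f| to the Sobolev exponent. *)
Lemma sobolev_gamma : p * (N - 1) / (N - p) * (N / (N - 1)) = N * p / (N - p).
Proof. by have [*] := nz; field; apply/andP. Qed.

Lemma sobolev_gamma_hoelder : p * (N - 1) / (N - p) - 1 = N * p / (N - p) * (1 - p^-1).
Proof. by have [*] := nz; field; apply/andP. Qed.

Lemma sobolev_inv : (N - 1) / N = (N * p / (N - p))^-1 + (1 - p^-1).
Proof. by have [*] := nz; field; do ?[apply/andP; split]. Qed.

Lemma sobolev_inv_gamma : N / (N - 1) * ((N - 1) / N) = 1.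
Proof. by have [*] := nz; field; apply/andP. Qed.

(** Here [a] stands for the integral of |f| to the Sobolev exponent and [d] for that of |grad f|^p.
    Raising to the power (N - 1) / N and dividing by a^(1 - 1/p) leaves the inverse of the Sobolev
    exponent, by [sobolev_inv]. *)
Lemma sobolev_absorb (gam a d : R) : 0 <= gam -> 0 <= a -> 0 <= d ->
  a <= (gam * (a `^ (1 - p^-1) * d `^ p^-1)) `^ (N / (N - 1)) ->
  a `^ (N * p / (N - p))^-1 <= gam * d `^ p^-1.
Proof.
move=> gam0 a0 d0 H; have [->|aN0] := eqVneq a 0.
  rewrite powR0 ?mulr_ge0 ?powR_ge0// invr_neq0// gt_eqF//.
  by rewrite divr_gt0// mulr_gt0.
have ap : 0 < a by rewrite lt_neqAle eq_sym aN0.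
have {}H : a `^ ((N - 1) / N) <= gam * (a `^ (1 - p^-1) * d `^ p^-1).
  have := ge0_ler_powR (_ : 0 <= (N - 1) / N) _ _ H.
  rewrite !nnegrE divr_ge0 ?(ltW N1) ?(ltW N0)// a0 powR_ge0 -powRrM.
  rewrite sobolev_inv_gamma powRr1; first by apply.
  by rewrite mulr_ge0// mulr_ge0 ?powR_ge0.
move: H; rewrite sobolev_inv powRD; last by rewrite aN0 implybT.
by rewrite mulrC mulrCA ler_pM2l// powR_gt0.
Qed.

End sobolev_exponents.

Section Sobolev.
Context {R : realType} {n : nat}.
Notation rV := 'rV[R]_n.+2.
Notation mu := (lebesgue R n.+2).
Variables (Om : set rV) (p : R).
Hypotheses (p2 : 2 <= p) (pn : p < n.+2%:R).

Let N : R := n.+2%:R.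
Let gam : R := p * (N - 1) / (N - p).
Definition sobolev_exp : R := N * p / (N - p).
Notation ps := sobolev_exp.

Let Np : 0 < N - p. Proof. by rewrite subr_gt0. Qed.
Let p0 : 0 < p. Proof. by move: p2; lra. Qed.
Let N1 : 0 < N - 1. Proof. by move: p2 Np; rewrite /N; lra. Qed.
Let N0 : 0 < N. Proof. by move: p2 Np; rewrite /N; lra. Qed.
Let ps0 : 0 < ps. Proof. by rewrite divr_gt0// mulr_gt0. Qed.

(** This makes |y|^gam continuously differentiable through [is_derive_norm_powR]. *)
Let gam2 : 2 <= gam.
Proof.
rewrite /gam ler_pdivlMr//; have := Np; have := p2; move: pn; rewrite -/N => *; nra.
Qed.

Lemma C1c_comp (S s : R -> R) (f : rV -> R) : S 0 = 0 ->
  (forall y, is_derive y (1 : R) S (s y)) -> continuous s -> C1c f ->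
  C1c (fun x => S (f x)) /\
  forall i x, partial i (fun x => S (f x)) x = s (f x) * partial i f x.
Proof.
move=> S0 dS cs [cf df bf].
have cS := is_derive_continuous dS.
have D i x : is_derive x (delta_mx 0 i) (fun x => S (f x)) (s (f x) * partial i f x).
  exact: is_derive_comp_rV (dS (f x)) (partialP ((df i).1 x)).
have E i x : partial i (fun x => S (f x)) x = s (f x) * partial i f x.
  by have [_] := D i x.
split => //; split.
- by move=> x; apply: (@continuous_comp _ _ _ f S); [exact: cf|exact: cS].
- move=> i; split; first by move=> x; have [] := D i x.
  rewrite (_ : partial i _ = fun x => s (f x) * partial i f x); last exact/funext/E.
  apply: continuous_funM; last exact: (df i).2.
  by move=> x; apply: (@continuous_comp _ _ _ f s); [exact: cf|exact: cs].
- by have [M fM] := bf; exists M => x /fM ->.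
Qed.

Lemma grad_bsupp (f : rV -> R) : C1c f -> exists M, bdd_supp M (fun x => enorm (grad f x)).
Proof.
move=> [cf df bf]; have [M fM] := bf.
have mdf i : measurable_fun setT (fun x : rV => grad f x 0 i).
  under eq_fun do rewrite mxE.
  by apply: continuous_measurable_rV; exact: (df i).2.
have /choice[C HC] : forall i, exists C : R, forall x, `|partial i f x| <= C.
  move=> i; have [C _ HC] := bsupp_bounded (df i).2 (bsupp_partial i bf).
  by exists C.
have /choice[D HD] : forall i, exists D : R, forall x, ~ cube D x -> partial i f x = 0.
  by move=> i; exact: bsupp_partial.
(* [bdd_supp] has one constant for the support and for the values; the two sums cover one each. *)
pose K := \sum_i `|D i| + Num.sqrt (\sum_i C i ^+ 2).
exists K; split.
- exact: measurable_enorm.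
- move=> x; rewrite enorm_ge0/= /K ler_wpDl//; first by apply: sumr_ge0.
  apply: ler_wsqrtr; apply: ler_sum => i _; rewrite mxE -expr2.
  by rewrite -real_normK ?num_real// lerXn2r ?nnegrE// (le_trans (normr_ge0 _) (HC i x)).
- move=> x Kx; rewrite (_ : grad f x = 0) ?enorm0//.
  apply/rowP => i; rewrite !mxE; apply: HD; apply: contra_not Kx.
  apply: cubeS; rewrite /K (bigD1 i)//= -!addrA.
  apply: le_trans (ler_norm _) _; rewrite lerDl addr_ge0 ?sqrtr_ge0//.
  by apply: sumr_ge0.
Qed.

Lemma bdd_supp_powR_integrable (q M : R) (phi : rV -> R) : 0 < q -> bdd_supp M phi ->
  mu.-integrable setT (EFin \o (fun x => phi x `^ q)).
Proof.
move=> q0 [mphi phiM phi0]; apply: (@bounded_supp_integrable _ _ (M `^ q) M).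
- exact: (measurableT_comp (measurable_powR _) mphi).
- move=> x; have /andP[h1 h2] := phiM x; rewrite ger0_norm ?powR_ge0//.
  by apply: ge0_ler_powR; rewrite ?nnegrE ?(ltW q0)// (le_trans h1).
- by move=> x /phi0 ->; rewrite powR0 ?gt_eqF.
Qed.

(* Gagliardo-Nirenberg for |f|^gam, where gam N / (N - 1) is the Sobolev
   exponent, followed by Hoelder. *)
Lemma sobolev_test (f : rV -> R) : test_function Om f ->
  ('N[mu]_ps%:E[EFin \o f] <= gam%:E * 'N[mu]_p%:E[EFin \o (fun x => enorm (grad f x))])%E.
Proof.
move=> tf; have Cf := test_C1c tf; have [cf df bf] := Cf.
have gam0 : 0 < gam by move: gam2; lra.
have [M bM] := grad_bsupp Cf; have [mgf gM g0] := bM.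
have [C C0 fC] := bsupp_bounded cf bf; have [L fL] := bf.
have mf := test_measurable tf.
have mnf : measurable_fun setT (fun x => `|f x|) by exact: measurableT_comp.
have S0 : `|0 : R| `^ gam = 0 by rewrite normr0 powR0// gt_eqF.
have [CS dSf] := C1c_comp (S := fun y => `|y| `^ gam) (s := fun y => gam * (Num.sg y * `|y| `^ (gam - 1)))
  (f := f) S0 (is_derive_norm_powR gam2) (norm_powR_derive_continuous gam2) Cf.
pose phi x := gam * (`|f x| `^ (gam - 1) * enorm (grad f x)).
have [K bphi] : exists K, bdd_supp K phi.
  exists (`|M| + gam * (C `^ (gam - 1) * `|M|)); split.
  - apply: measurable_funM => //; apply: measurable_funM => //.
    exact: (measurableT_comp (measurable_powR _) mnf).
  - move=> x; apply/andP; split.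
      by rewrite /phi mulr_ge0 ?(ltW gam0)// mulr_ge0 ?powR_ge0 ?enorm_ge0.
    have h1 : `|f x| `^ (gam - 1) <= C `^ (gam - 1).
      by apply: ge0_ler_powR; rewrite ?nnegrE//; move: gam2; lra.
    have h2 : enorm (grad f x) <= `|M|.
      by have /andP[_ h] := gM x; rewrite (le_trans h)// ler_norm.
    apply: (@le_trans _ _ (gam * (C `^ (gam - 1) * `|M|))); last by rewrite lerDr.
    by rewrite /phi (ler_wpM2l (ltW gam0))// ler_pM ?powR_ge0 ?enorm_ge0.
  - move=> x Kx.
    suff Mx : ~ cube M x by rewrite /phi (g0 x Mx) !mulr0.
    apply: contra_not Kx; apply: cubeS.
    rewrite (le_trans (ler_norm _))// lerDl mulr_ge0 ?(ltW gam0)// mulr_ge0 ?powR_ge0//.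
have := Gagliardo_Nirenberg CS bphi.
have -> : (n.+2%:R / n.+1%:R : R) = N / (N - 1) by rewrite /N -natr1 addrK.
have H1 i x : `|partial i (fun x => `|f x| `^ gam) x| <= phi x.
  rewrite dSf normrM /phi mulrA ler_pM// ?norm_powR_derive_norm//.
  by have := coord_le_enorm (grad f x) i; rewrite mxE.
move=> /(_ H1).
set A := (\int[mu]_x (`|f x| `^ ps)%:E)%E.
set D := (\int[mu]_x (enorm (grad f x) `^ p)%:E)%E.
under eq_integral do rewrite (ger0_norm (powR_ge0 _ _)) -powRrM (sobolev_gamma p0 Np N1 N0).
rewrite -/A => HA.
have mfp : measurable_fun setT (fun x => `|f x| `^ ps) by exact: (measurableT_comp (measurable_powR _) mnf).
have mgp : measurable_fun setT (fun x => enorm (grad f x) `^ p) by exact: (measurableT_comp (measurable_powR _) mgf).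
have iA : mu.-integrable setT (EFin \o (fun x => `|f x| `^ ps)).
  apply: (@bounded_supp_integrable _ _ (C `^ ps) L) => //.
  - by move=> x; rewrite ger0_norm ?powR_ge0// ge0_ler_powR ?nnegrE// ltW.
  - by move=> x Lx; rewrite fL ?normr0 ?powR0 ?gt_eqF.
have iD := bdd_supp_powR_integrable p0 bM.
have Af : A \is a fin_num := integrable_fin_num measurableT iA.
have Df : D \is a fin_num := integrable_fin_num measurableT iD.
have A0 : (0 <= A)%E by apply: integral_ge0 => x _; rewrite lee_fin powR_ge0.
have D0 : (0 <= D)%E by apply: integral_ge0 => x _; rewrite lee_fin powR_ge0.
have Hphi : (\int[mu]_x (phi x)%:E <= gam%:E * (A `^ (1 - p^-1) * D `^ (p^-1)))%E.
  rewrite /phi; under eq_integral do rewrite EFinM.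
  rewrite ge0_integralZl//; last 3 first.
  - apply/measurable_EFinP; apply: measurable_funM => //.
    exact: (measurableT_comp (measurable_powR _) mnf).
  - by move=> x _; rewrite lee_fin mulr_ge0 ?powR_ge0 ?enorm_ge0.
  - by rewrite lee_fin ltW.
  rewrite lee_wpmul2l ?lee_fin ?(ltW gam0)//.
  have a01 : 0 < 1 - p^-1 < 1.
    rewrite subr_gt0 invf_lt1// gtrBl invr_gt0 p0 andbT; move: p2; lra.
  have := hoelder_powR mu a01 mfp mgp (fun x => powR_ge0 _ _) (fun x => powR_ge0 _ _).
  rewrite subKr -/A -/D; apply: le_trans.
  rewrite le_eqVlt; apply/orP; left; apply/eqP; apply: eq_integral => x _.
  by rewrite -!powRrM mulfV ?gt_eqF// powRr1 ?enorm_ge0// /gam (sobolev_gamma_hoelder p0 Np N1 N0).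
rewrite !Lnorm_EFinE -/A.
under [in leRHS]eq_integral do rewrite (ger0_norm (enorm_ge0 _)).
rewrite -/D.
have N10 : 0 <= N / (N - 1) by rewrite divr_ge0 ?ltW.
have I0 : (0 <= \int[mu]_x (phi x)%:E)%E.
  by apply: integral_ge0 => x _; rewrite lee_fin mulr_ge0 ?(ltW gam0)// mulr_ge0 ?powR_ge0 ?enorm_ge0.
have {HA} := le_trans HA (le_poweR N10 I0 Hphi).
clear -Af Df A0 D0 gam0 Np p0 N1 N0; clearbody A D.
rewrite -(fineK Af) -(fineK Df) !poweR_EFin -!EFinM !lee_fin => H.
by apply: sobolev_absorb H => //; rewrite ?fine_ge0 ?(ltW gam0).
Qed.

End Sobolev.

Section Lnorm_facts.
Context d (T : measurableType d) (R : realType).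
Variable mu : {measure set T -> \bar R}.
Implicit Types f g h : T -> R.

Lemma continuous_norm_powR (q : R) : 0 < q -> continuous (fun y : R => `|y| `^ q).
Proof.
move=> q0 y; have [->|yN0] := eqVneq y 0; last first.
  have y0 : 0 < `|y| by rewrite normr_gt0.
  have [dq _] := is_derive1_powR q y0.
  have c : {for `|y|, continuous (fun z : R => z `^ q)}.
    by move: dq => /derivable1_diffP/differentiable_continuous.
  exact: (cvg_comp _ _ (@norm_continuous _ R^o y) c).
have qN0 : q != 0 by rewrite gt_eqF.
apply/cvgrPdist_le => e e0; rewrite normr0 powR0//.
have e1 : 0 < e `^ q^-1 by rewrite powR_gt0.
have := @cvgr_dist_le R R R (nbhs (0 : R)) (nbhs_filter (0 : R)) id 0 (@cvg_id _ _) _ e1.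
apply: filterS => z; rewrite !sub0r !normrN (ger0_norm (powR_ge0 _ _)) => ze.
have -> : e = (e `^ q^-1) `^ q by rewrite -powRrM mulVf// powRr1// ltW.
by apply: ge0_ler_powR; rewrite ?nnegrE ?powR_ge0// ltW.
Qed.

Lemma measurable_norm_powR (q : R) f : measurable_fun setT f ->
  measurable_fun setT (fun x => `|f x| `^ q).
Proof.
move=> mf; apply: (measurableT_comp (measurable_powR _)).
exact: measurableT_comp.
Qed.

Lemma le_Lnorm (q : R) f g : 0 < q -> measurable_fun setT f -> measurable_fun setT g ->
  (forall x, `|f x| <= `|g x|) ->
  ('N[mu]_q%:E[EFin \o f] <= 'N[mu]_q%:E[EFin \o g])%E.
Proof.
move=> q0 mf mg fg; rewrite !Lnorm_EFinE; apply: le_poweR.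
- by rewrite invr_ge0 ltW.
- by apply: integral_ge0 => x _; rewrite lee_fin powR_ge0.
apply: ge0_le_integral => //; try by apply/measurable_EFinP; exact: measurable_norm_powR.
by move=> x _; rewrite lee_fin; apply: ge0_ler_powR; rewrite ?nnegrE// ltW.
Qed.

Lemma Lnorm_triangle (q : R) f g h : 1 <= q -> measurable_fun setT f ->
  measurable_fun setT g -> measurable_fun setT h ->
  (forall x, `|f x| <= `|g x| + `|h x|) ->
  ('N[mu]_q%:E[EFin \o f] <= 'N[mu]_q%:E[EFin \o g] + 'N[mu]_q%:E[EFin \o h])%E.
Proof.
move=> q1 mf mg mh fgh.
have q0 : 0 < q by rewrite (lt_le_trans _ q1).
have mn (k : T -> R) : measurable_fun setT k -> measurable_fun setT (fun x => `|k x|).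
  by move=> mk; exact: measurableT_comp.
pose gh : T -> R := (fun x => `|g x|) \+ (fun x => `|h x|).
apply: (@le_trans _ _ ('N[mu]_q%:E[EFin \o gh])%E).
  apply: (le_Lnorm q0 mf); first by apply: measurable_funD; exact: mn.
  by move=> x; rewrite (le_trans (fgh x))//= ler_norm.
apply: le_trans (eminkowski _ (mn _ mg) (mn _ mh) _) _; first by rewrite lee_fin.
by apply: leeD; apply: le_Lnorm => //; [exact: mn|move=> x; rewrite normr_id|exact: mn|move=> x; rewrite normr_id].
Qed.

(** Fatou's lemma for the q-th powers, along the sequence shifted by [J]. The slack [e] admits
    bounds on [f_ j] that tend to [B] from above. *)
Lemma Lnorm_fatou (q : R) (f_ : nat -> T -> R) f (B : \bar R) : 0 < q ->
  (forall j, measurable_fun setT (f_ j)) -> measurable_fun setT f ->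
  {ae mu, forall x, f_ j x @[j --> \oo] --> f x} ->
  (forall e : R, 0 < e -> exists J, forall j, (J <= j)%N ->
    ('N[mu]_q%:E[EFin \o f_ j] <= B + e%:E)%E) ->
  ('N[mu]_q%:E[EFin \o f] <= B)%E.
Proof.
move=> q0 mf_ mf ff fB.
have B0 : (0 <= B)%E.
  apply/lee_addgt0Pr => e e0; have [J HJ] := fB e e0.
  exact: le_trans (Lnorm_ge0 _ _ _) (HJ J (leqnn J)).
apply/lee_addgt0Pr => e e0; have [J HJ] := fB e e0.
have [Boo|Bfin] := eqVneq B +oo%E; first by rewrite Boo leey.
have Be0 : (0 <= B + e%:E)%E by rewrite adde_ge0// lee_fin ltW.
rewrite Lnorm_EFinE.
have qV : (q * q^-1 = 1 :> R) by rewrite mulfV// gt_eqF.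
rewrite -[leRHS](poweRe1 Be0) -qV poweRrM; apply: le_poweR.
- by rewrite invr_ge0 ltW.
- by apply: integral_ge0 => x _; rewrite lee_fin powR_ge0.
have mp (h : T -> R) : measurable_fun setT h -> measurable_fun setT (fun x => (`|h x| `^ q)%:E).
  by move=> mh; apply/measurable_EFinP; exact: measurable_norm_powR.
have cpow := continuous_norm_powR q0.
have H0 j x : setT x -> (0 <= (`|f_ (j + J)%N x| `^ q)%:E)%E.
  by move=> _; rewrite lee_fin powR_ge0.
have H := @fatou _ _ _ mu setT measurableT (fun j x => (`|f_ (j + J)%N x| `^ q)%:E)
  (fun j => mp _ (mf_ _)) H0.
have -> : (\int[mu]_x (`|f x| `^ q)%:E = \int[mu]_x limn_einf (fun j => (`|f_ (j + J)%N x| `^ q)%:E))%E.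
  apply: ae_eq_integralT; apply: filterS ff => x fx.
  have fJ : f_ (j + J)%N x @[j --> \oo] --> f x by have := fx; rewrite -(cvg_shiftn J).
  have fq : (`|f_ (j + J)%N x| `^ q)%:E @[j --> \oo] --> (`|f x| `^ q)%:E.
    apply: cvg_EFin; first exact: nearW.
    exact: (cvg_comp _ _ fJ (cpow (f x))).
  by have [-> _] := cvg_limn_einf_sup fq.
apply: (le_trans H).
rewrite limn_einf_lim; apply: lime_le; first exact: is_cvg_einfs.
apply: nearW => j; apply: (@le_trans _ _ (\int[mu]_x (`|f_ (j + J)%N x| `^ q)%:E)%E).
  by apply: ereal_inf_lbound; exists j => //=.
have := HJ (j + J)%N (leq_addl _ _); rewrite Lnorm_EFinE => Hj.
have I0 : (0 <= \int[mu]_x (`|f_ (j + J)%N x| `^ q)%:E)%E.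
  by apply: integral_ge0 => x _; rewrite lee_fin powR_ge0.
rewrite -[leLHS](poweRe1 I0) -qV mulrC poweRrM; apply: le_poweR => //; first exact: ltW.
exact: poweR_ge0.
Qed.

Lemma Lnorm_enormB (q : R) n (F G H : T -> 'rV[R]_n) : 1 <= q ->
  measurable_field G ->
  measurable_field H ->
  (forall x, F x = G x - H x) ->
  (Lnorm_field mu q F <=
   Lnorm_field mu q G +
   Lnorm_field mu q H)%E.
Proof.
move=> q1 mG mH FGH.
have mF i : measurable_fun setT (fun x : T => F x 0 i).
  by under eq_fun do rewrite FGH !mxE; exact: measurable_funB.
apply: (Lnorm_triangle q1 (measurable_enorm mF) (measurable_enorm mG) (measurable_enorm mH)).
move=> x; rewrite FGH !(ger0_norm (enorm_ge0 _)).
by rewrite (le_trans (enormD _ _))// enormN.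
Qed.

End Lnorm_facts.

(** * Approximable pairs of a function and its gradient *)

Section W0p.
Context {R : realType} {n : nat}.
Notation rV := 'rV[R]_n.
Notation mu := (lebesgue R n).
Variables (Om : set rV) (p L : R).
Hypotheses (mOm : measurable Om) (OmL : Om `<=` cube L) (p1 : 1 < p).
Implicit Types (v : rV -> R) (G : rV -> rV).

Let p0 : 0 < p. Proof. exact: lt_trans p1. Qed.

(** The geometric rate is summable, and each term is twice the next, which lets a difference of two
    approximable functions keep the same rate. *)
Definition eps (j : nat) : R := 1 / (2 ^ j.+1)%:R.

Lemma eps_gt0 j : 0 < eps j. Proof. by rewrite divr_gt0// ltr0n expn_gt0. Qed.

Lemma eps_sum : (\sum_(0 <= j <oo) (eps j)%:E <= 1)%E.
Proof. exact: (@epsilon_trick0 R 1 xpredT). Qed.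

Lemma cvg_eps : eps j @[j --> \oo] --> (0 : R).
Proof.
apply: (squeeze_cvgr _ (cvg_cst 0) (@cvg_harmonic R)); apply: nearW => j.
rewrite ltW ?eps_gt0//= /eps /harmonic div1r lef_pV2 ?posrE ?ltr0n ?expn_gt0//.
by rewrite ler_nat ltnW// ltn_expl.
Qed.

(* The geometric rate makes the approximations converge almost everywhere. *)
Definition W0p v G := [/\ measurable_fun setT v,
  measurable_field G,
  (forall x, ~ Om x -> v x = 0), (forall x, ~ Om x -> G x = 0) &
  exists f : nat -> rV -> R, forall j, test_function Om (f j) /\
    ('N[mu]_p%:E[EFin \o (fun x => v x - f j x)%R] +
     'N[mu]_p%:E[EFin \o (fun x => enorm (G x - grad (f j) x))%R] < (eps j)%:E)%E].

Lemma test_grad_measurable f i : test_function Om f ->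
  measurable_fun setT (fun x => grad f x 0 i).
Proof.
move=> tf; under eq_fun do rewrite mxE; exact: test_partial_measurable tf.
Qed.

Lemma test_grad_out f x : test_function Om f -> ~ Om x -> grad f x = 0.
Proof. by move=> tf Ox; apply/rowP => i; rewrite !mxE (test_partial_out i tf). Qed.

Lemma gradB_measurable G f : measurable_field G ->
  test_function Om f -> measurable_fun setT (fun x => enorm (G x - grad f x)).
Proof.
move=> mG tf; apply: measurable_enorm => i.
under eq_fun do rewrite !mxE; apply: measurable_funB => //.
exact: test_partial_measurable tf.
Qed.

Lemma L1_le_Lp : exists2 c : R, 0 <= c & forall h : rV -> R, measurable_fun setT h ->
  (forall x, ~ Om x -> h x = 0) ->
  (\int[mu]_x `|h x|%:E <= c%:E * 'N[mu]_p%:E[EFin \o h])%E.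
Proof.
pose q := (1 - p^-1)^-1.
have q0 : 0 < q by rewrite invr_gt0 subr_gt0 invf_lt1.
have mI : measurable_fun setT (\1_Om : rV -> R) by exact: measurable_indic.
have fin : ('N[mu]_q%:E[EFin \o (\1_Om : rV -> R)])%E \is a fin_num.
  rewrite ge0_fin_numE ?Lnorm_ge0// (Lnorm_lty _ _ q0).
  rewrite (eq_integral (fun x => (\1_Om x)%:E)); last first.
    move=> x _; rewrite indicE; case: (x \in Om); first by rewrite normr1 powR1.
    by rewrite normr0 powR0// gt_eqF.
  rewrite integral_indic// setIT.
  apply: le_lt_trans (lebesgue_cube_lty n L).
  by apply: le_measure => //; rewrite inE//; exact: measurable_cube.
exists (fine ('N[mu]_q%:E[EFin \o (\1_Om : rV -> R)])%E); first by rewrite fine_ge0 ?Lnorm_ge0.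
move=> h mh h0; rewrite fineK//.
have := hoelder mu mh mI p0 q0; rewrite invrK addrC subrK => /(_ erefl).
rewrite Lnorm1 muleC; apply: le_trans.
rewrite le_eqVlt; apply/orP; left; apply/eqP; apply: eq_integral => x _ /=.
rewrite indicE; case: (boolP (x \in Om)) => [_|]; first by rewrite mulr1.
by rewrite notin_setE => /h0 ->; rewrite mul0r.
Qed.

Lemma Lnorm_eps_L1 : exists2 c : R, 0 <= c & forall v (f : nat -> rV -> R),
  measurable_fun setT v -> (forall x, ~ Om x -> v x = 0) -> (forall j, test_function Om (f j)) ->
  (forall j, 'N[mu]_p%:E[EFin \o (fun x => v x - f j x)%R] <= (eps j)%:E)%E ->
  forall j, (\int[mu]_x `|v x - f j x|%:E <= (c * eps j)%:E)%E.
Proof.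
have [c c0 Hc] := L1_le_Lp; exists c => // v f mv v0 tf Hf j; apply: le_trans (Hc _ _ _) _.
- exact: measurable_funB mv (test_measurable (tf j)).
- by move=> x Ox; rewrite v0// (test_out (tf j) Ox) subrr.
by rewrite EFinM lee_wpmul2l ?lee_fin.
Qed.

Lemma Lnorm_eps_cvg v (f : nat -> rV -> R) : measurable_fun setT v ->
  (forall x, ~ Om x -> v x = 0) -> (forall j, test_function Om (f j)) ->
  (forall j, 'N[mu]_p%:E[EFin \o (fun x => v x - f j x)%R] <= (eps j)%:E)%E ->
  {ae mu, forall x, f j x @[j --> \oo] --> v x}.
Proof.
move=> mv v0 tf Hf; have [c c0 /(_ v f mv v0 tf Hf) b1] := Lnorm_eps_L1.
have := @ae_cvg0_nneseries _ _ _ mu (fun j x => `|v x - f j x|).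
move=> /(_ _ _ _) H.
have {}H : {ae mu, forall x, `|v x - f j x| @[j --> \oo] --> (0 : R)}.
  apply: H => //.
    move=> j; apply: measurableT_comp => //.
    exact: measurable_funB mv (test_measurable (tf j)).
  apply: (@le_lt_trans _ _ (\sum_(0 <= j <oo) (c%:E * (eps j)%:E))%E).
    by apply: lee_nneseries => j *; [apply: integral_ge0 => x _; rewrite lee_fin|exact: b1].
  rewrite nneseriesZl; last by move=> j _; rewrite lee_fin ltW// eps_gt0.
  by apply: (@le_lt_trans _ _ (c%:E * 1)%E); [rewrite lee_wpmul2l ?lee_fin ?eps_sum|rewrite mule1 ltry].
apply: filterS H => x Hx.
apply/cvgrPdist_le => e e0; have /cvgrPdist_le/(_ e e0) := Hx.
by apply: filterS => j; rewrite sub0r normrN normr_id.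
Qed.

Lemma W0p_approx v G : W0p v G -> approx Om v G.
Proof.
move=> [mv mG v0 G0 [f Hf]].
have tf j := (Hf j).1.
have vf j : ('N[mu]_p%:E[EFin \o (fun x => v x - f j x)%R] <= (eps j)%:E)%E.
  by apply/ltW; apply: le_lt_trans (Hf j).2; rewrite leeDl// Lnorm_ge0.
have [c1 c10 /(_ v f mv v0 tf vf) b1] := Lnorm_eps_L1.
have [c c0 Hc] := L1_le_Lp.
have b2 j i : (\int[mu]_x `|G x 0 i - partial i (f j) x|%:E <= (c * eps j)%:E)%E.
  have mGf := gradB_measurable mG (tf j).
  apply: (@le_trans _ _ (\int[mu]_x `|enorm (G x - grad (f j) x)|%:E)%E).
    apply: ge0_le_integral => //.
    - apply/measurable_EFinP; apply: measurableT_comp => //.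
      by apply: measurable_funB => //; exact: test_partial_measurable (tf j).
    - by apply/measurable_EFinP; exact: measurableT_comp.
    - move=> x _; rewrite lee_fin (ger0_norm (enorm_ge0 _)).
      by have := coord_le_enorm (G x - grad (f j) x) i; rewrite !mxE.
  apply: le_trans (Hc _ mGf _) _.
    by move=> x Ox; rewrite G0// (test_grad_out (tf j) Ox) subrr enorm0.
  rewrite EFinM lee_wpmul2l ?lee_fin//; apply/ltW; apply: le_lt_trans (Hf j).2.
  by rewrite leeDr// Lnorm_ge0.
have lim0 a : (a * eps j)%:E @[j --> \oo] --> (0 : R)%:E.
  apply: cvg_EFin; first exact: nearW.
  by rewrite -[X in _ --> X](mulr0 a); apply: cvgM; [exact: cvg_cst|exact: cvg_eps].
have intB (h k : rV -> R) (C : R) : measurable_fun setT h -> mu.-integrable setT (EFin \o k) ->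
    (\int[mu]_x `|h x - k x|%:E <= C%:E)%E -> mu.-integrable setT (EFin \o h).
  move=> mh ik hk; rewrite (_ : EFin \o h = EFin \o (fun x => (h x - k x) + k x)); last first.
    by apply/funext => x /=; rewrite subrK.
  apply: integrableD_EFin => //; apply/integrableP; split.
    by apply/measurable_EFinP; exact: measurable_funB mh (integrable_measurable ik).
  by apply: le_lt_trans hk _; exact: ltry.
split => //.
- have [cf _ bf] := test_C1c (tf 0%N).
  exact: intB mv (bsupp_integrable cf bf) (b1 0%N).
- by move=> i; exact: intB (mG i) (C1c_partial_integrable i (test_C1c (tf 0%N))) (b2 0%N i).
exists f; split => //.
- exact: Lnorm_eps_cvg vf.
- apply: (squeeze_cvge _ (cvg_cst 0%E) (lim0 c1)); apply: nearW => j.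
  by rewrite b1 integral_ge0.
- move=> i; apply: (squeeze_cvge _ (cvg_cst 0%E) (lim0 c)); apply: nearW => j.
  by rewrite b2 integral_ge0.
Qed.

Lemma W0p_gradB f g x : test_function Om f -> test_function Om g ->
  grad (fun x => f x - g x) x = grad f x - grad g x.
Proof. by move=> tf tg; apply/rowP => i; rewrite !mxE (test_partialB i x tf tg). Qed.

Lemma W0pB v G v' G' : W0p v G -> W0p v' G' ->
  W0p (fun x => v x - v' x) (fun x => G x - G' x).
Proof.
move=> [mv mG v0 G0 [f Hf]] [mv' mG' v0' G0' [g Hg]]; split.
- exact: measurable_funB.
- by move=> i; under eq_fun do rewrite !mxE; exact: measurable_funB.
- by move=> x Ox; rewrite v0// v0'// subrr.
- by move=> x Ox; rewrite G0// G0'// subrr.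
(* The shifted index leaves room for two errors, since [eps j] is twice [eps j.+1]. *)
exists (fun j x => f j.+1 x - g j.+1 x) => j.
have [tf Hfj] := Hf j.+1; have [tg Hgj] := Hg j.+1; split; first exact: test_functionB.
have mvf := measurable_funB mv (test_measurable tf).
have mvg := measurable_funB mv' (test_measurable tg).
have mGf := gradB_measurable mG tf.
have mGg := gradB_measurable mG' tg.
have -> : eps j = eps j.+1 + eps j.+1.
  rewrite /eps !div1r (expnS _ j.+1) natrM invfM -mulrDl.
  by rewrite -[LHS]mul1r; congr (_ * _); lra.
rewrite EFinD; apply: le_lt_trans (lteD Hfj Hgj).
rewrite addeACA; apply: leeD.
  apply: (Lnorm_triangle mu (ltW p1) _ mvf mvg).
    by apply: measurable_funB; [exact: measurable_funB|exact: measurable_funB (test_measurable tf) (test_measurable tg)].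
  move=> x; have -> : v x - v' x - (f j.+1 x - g j.+1 x) = (v x - f j.+1 x) - (v' x - g j.+1 x) by ring.
  exact: ler_normB.
apply: (@Lnorm_enormB _ _ _ mu p n _ (fun x => G x - grad (f j.+1) x)
  (fun x => G' x - grad (g j.+1) x) (ltW p1)).
- by move=> i; under eq_fun do rewrite !mxE; apply: measurable_funB => //; exact: test_partial_measurable tf.
- by move=> i; under eq_fun do rewrite !mxE; apply: measurable_funB => //; exact: test_partial_measurable tg.
- by move=> x; rewrite (W0p_gradB x tf tg) !opprD !opprK addrACA.
Qed.

End W0p.

Section W0p_sobolev.
Context {R : realType} {n : nat}.
Notation rV := 'rV[R]_n.+2.
Notation mu := (lebesgue R n.+2).
Variables (Om : set rV) (p L : R).
Hypotheses (mOm : measurable Om) (OmL : Om `<=` cube L).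
Hypotheses (p2 : 2 <= p) (pn : p < n.+2%:R).
Implicit Types (v : rV -> R) (G : rV -> rV).

Let p1 : 1 < p. Proof. by move: p2; lra. Qed.
Let p0 : 0 < p. Proof. by move: p2; lra. Qed.

Lemma test_grad_Lnorm_lty (f : rV -> R) : test_function Om f ->
  ('N[mu]_p%:E[EFin \o (fun x => enorm (grad f x))] < +oo)%E.
Proof.
move=> tf; have [M bM] := grad_bsupp (test_C1c tf); have [mgf gM g0] := bM.
rewrite (Lnorm_lty _ _ p0).
under eq_integral do rewrite (ger0_norm (enorm_ge0 _)).
by apply: integrable_lty => //; exact: bdd_supp_powR_integrable bM.
Qed.

Lemma W0p_lty v G : W0p Om p v G ->
  (Lnorm_field mu p G < +oo)%E.
Proof.
move=> [mv mG v0 G0 [f Hf]]; have [tf Hf0] := Hf 0%N.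
have mGf := gradB_measurable mG tf.
have mgf : measurable_fun setT (fun x : rV => enorm (grad (f 0%N) x)).
  by apply: measurable_enorm => i; exact: test_grad_measurable tf.
apply: le_lt_trans (Lnorm_triangle mu (ltW p1) (measurable_enorm mG) mGf mgf _) _.
  move=> x; rewrite !(ger0_norm (enorm_ge0 _)).
  by rewrite -{1}(subrK (grad (f 0%N) x) (G x)) enormD.
apply: lte_add_pinfty; last exact: test_grad_Lnorm_lty tf.
apply: (@lt_trans _ _ (eps 0 : R)%:E); last exact: ltry.
by apply: le_lt_trans Hf0; rewrite leeDr// Lnorm_ge0.
Qed.

(** The inequality for the approximating test functions, whose gradients have norm at most that of
    [G] plus [eps j], passes to [v] by Fatou's lemma. *)
Lemma W0p_sobolev v G : W0p Om p v G ->
  ('N[mu]_(sobolev_exp (n := n) p)%:E[EFin \o v] <=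
   (p * (n.+2%:R - 1) / (n.+2%:R - p))%:E *
   Lnorm_field mu p G)%E.
Proof.
move=> vG; have [mv mG v0 G0 [f Hf]] := vG.
have tf j := (Hf j).1.
have Np : 0 < n.+2%:R - p by rewrite subr_gt0.
have gam0 : 0 <= p * (n.+2%:R - 1) / (n.+2%:R - p).
  by rewrite divr_ge0 ?(ltW Np)// mulr_ge0 ?(ltW p0)//; move: p2 Np; lra.
have ps0 : 0 < sobolev_exp (n := n) p by rewrite divr_gt0// mulr_gt0.
apply: (Lnorm_fatou ps0 (fun j => test_measurable (tf j)) mv).
  apply: (Lnorm_eps_cvg mOm OmL p1 mv v0 tf) => j; apply/ltW.
  by apply: le_lt_trans (Hf j).2; rewrite leeDl// Lnorm_ge0.
move=> e e0.
set gam := p * _ / _ in gam0 *.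
have : \forall j \near \oo, `|0 - gam * eps j| <= e.
  apply: cvgr_dist_le => //; rewrite -[X in _ --> X](mulr0 gam).
  by apply: cvgM; [exact: cvg_cst|exact: cvg_eps].
move=> [J _ HJ]; exists J => j Jj; have := HJ j Jj.
have ge0 : 0 <= gam * eps j by apply: mulr_ge0 => //; rewrite ltW// eps_gt0.
rewrite /= sub0r normrN (ger0_norm ge0) => ej.
apply: le_trans (sobolev_test p2 pn (tf j)) _.
apply: (@le_trans _ _ (gam%:E * (Lnorm_field mu p G + (eps j)%:E))%E); last first.
  have e00 : (0 <= (eps j : R)%:E)%E by rewrite lee_fin ltW// eps_gt0.
  rewrite (ge0_muleDr _ (Lnorm_ge0 _ _ _) e00).
  by rewrite leeD2l// -EFinM lee_fin.
rewrite lee_wpmul2l ?lee_fin//.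
have mgf i : measurable_fun setT (fun x : rV => grad (f j) x 0 i) by exact: test_grad_measurable (tf j).
have mGf i : measurable_fun setT (fun x : rV => (G x - grad (f j) x) 0 i).
  by under eq_fun do rewrite !mxE; apply: measurable_funB => //; exact: test_partial_measurable (tf j).
have := @Lnorm_enormB _ _ _ mu p n.+2 (grad (f j)) G (fun x => G x - grad (f j) x) (ltW p1) mG mGf.
move=> /(_ (fun x => _)) H.
apply: le_trans (H _) _; first by move=> x; rewrite opprB addrC subrK.
rewrite leeD2l//; apply/ltW; apply: le_lt_trans (Hf j).2.
by rewrite leeDr// Lnorm_ge0.
Qed.

End W0p_sobolev.

(** * Weak gradients and the entropic identity *)

Section weak_gradients.
Context {R : realType} {n : nat}.
Notation rV := 'rV[R]_n.
Notation mu := (lebesgue R n).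
Variable Om : set rV.
Hypothesis oOm : open Om.
Implicit Types (v : rV -> R) (G H : rV -> rV).

Let mOm : measurable Om. Proof. exact: open_measurable_rV. Qed.

Lemma bounded_sub_cube : bounded_set Om -> exists L : R, Om `<=` cube L.
Proof.
move=> [M [_ HM]]; exists (M + 1) => x Ox; apply: cube_norm.
by apply: HM Ox; rewrite ltrDl.
Qed.

Lemma represents_integrable (D : set rV) (f g : rV -> R) : represents mu D f g ->
  (normLp mu D 1 f < +oo)%E -> mu.-integrable setT (EFin \o g).
Proof.
move=> [mg g0 fg]; rewrite (@normLpE _ _ _ mu D 1 f g fg g0) Lnorm1 => g_fin.
by apply/integrableP; split => //; exact/measurable_EFinP.
Qed.

Lemma test_function_bounded (f : rV -> R) : test_function Om f ->
  exists2 C : R, 0 <= C & forall x, `|f x| <= C.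
Proof. by move=> /test_C1c [cf _ bf]; exact: bsupp_bounded. Qed.

Lemma weak_grad_ae v v' G G' :
  {ae mu, forall x, Om x -> v x = v' x} -> {ae mu, forall x, Om x -> G x = G' x} ->
  mu.-integrable setT (EFin \o v') ->
  (forall i, mu.-integrable setT (EFin \o (fun x => G' x 0 i))) ->
  (forall i f, test_function Om f ->
    \int[mu]_x (v' x * partial i f x) = - \int[mu]_x (G' x 0 i * f x)) ->
  is_weak_grad Om v G.
Proof.
move=> vv' GG' iv' iG' vG.
have loc (h h' : rV -> R) : {ae mu, forall x, Om x -> h x = h' x} ->
    mu.-integrable setT (EFin \o h') -> inL1loc Om h.
  move=> hh' ih' K cK KO.
  have mK : measurable K.
    by apply: closed_measurable_rV; apply: compact_closed => //; exact: norm_hausdorff.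
  have mh' := integrable_measurable ih'.
  split.
    by exists h'; [exact: measurable_funTS|apply: filterS hh' => x + /KO].
  rewrite (@normLpE _ _ _ mu K 1 h (h' \_ K)).
  - rewrite Lnorm1; have /integrableP[_] := ih'; apply: le_lt_trans.
    apply: ge0_le_integral => //.
    + by apply/measurable_EFinP; apply: measurableT_comp => //; apply/(measurable_restrictT _ mK); exact: measurable_funTS.
    + by apply/measurable_EFinP; exact: measurableT_comp.
    + move=> x _ /=; rewrite lee_fin patchE; case: ifP => // _.
      by rewrite normr0.
  - by apply: filterS hh' => x hx Kx; rewrite patchE mem_set// hx//; exact: KO.
  - by move=> x Kx; rewrite patchE memNset.
split.
- exact: loc vv' iv'.
- by move=> i; apply: loc (iG' i); apply: filterS GG' => x + Ox; move=> ->.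
- move=> i f tf.
  rewrite (@ae_eq_Rintegral_on _ _ _ mu Om _ (fun x => v' x * partial i f x)); last 2 first.
  + by apply: filterS vv' => x h Ox; rewrite h.
  + by move=> x Ox; rewrite (test_partial_out i tf Ox) mulr0.
  rewrite (vG i f tf) (@ae_eq_Rintegral_on _ _ _ mu Om _ (fun x => G' x 0 i * f x))//.
  + by apply: filterS GG' => x h Ox; rewrite h.
  + by move=> x Ox; rewrite (test_out tf Ox) mulr0.
Qed.

(** [G] is only locally integrable, so the comparison is made on each rational box whose closure
    lies in [Om]; countably many of them cover [Om]. *)
Lemma weak_grad_unique v G H : is_weak_grad Om v G ->
  (forall i, mu.-integrable setT (EFin \o (fun x => H x 0 i))) ->
  (forall i f, test_function Om f ->
    \int[mu]_(x in Om) (v x * partial i f x) = - \int[mu]_x (H x 0 i * f x)) ->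
  {ae mu, forall x, Om x -> G x = H x}.
Proof.
move=> [_ Gloc vG] iH vH.
have main k i : {ae mu, forall x : rV, cbox (@qbox R n k).1 (@qbox R n k).2 `<=` Om ->
    box (@qbox R n k).1 (@qbox R n k).2 x -> G x 0 i = H x 0 i}; last first.
  have maink k := filter_forall (ae_filter_ringOfSetsType mu) (main k).
  apply: filterS (ae_foralln maink) => x Hx; rewrite (open_qbox oOm) => -[k /= kO xk].
  by apply/rowP => i; exact: Hx k i kO xk.
set a := _.1; set b := _.2.
have [abO|abO] := pselect (cbox a b `<=` Om); last exact: aeW.
have cC := @compact_cbox R n a b.
have [mg gfin] := Gloc i _ cC abO.
have mC := measurable_cbox a b.
have [g rg] := ae_measurable_represents mC mg.
have ig := represents_integrable rg gfin.
have {rg} [{}mg g0 gG] := rg.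
have igH : mu.-integrable setT (EFin \o (fun x => g x - H x 0 i)).
  exact: integrableB_EFin (iH i).
suff : {ae mu, forall x, box a b x -> g x - H x 0 i = 0}.
  move=> gH; apply: filterS2 gG gH => x gx gHx _ xab.
  by rewrite gx; [apply/eqP; rewrite -subr_eq0 gHx|exact: box_sub_cbox].
(* The closed box plays the role of the domain, because the representative [g] of [G] is available
   only there. *)
apply: (@ae_eq0_cbox _ _ (cbox a b)) => //.
- exact: integrable_measurable igH.
- move=> K cK KC; apply: integrableS igH => //.
  by apply: closed_measurable_rV; apply: compact_closed => //; exact: norm_hausdorff.
move=> f tfC.
have tf : test_function Om f.
  have [cf [K [cK KC fK]]] := tfC; split=> //.
  by exists K; split => //; exact: subset_trans abO.
have [C C0 fC] := test_function_bounded tf.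
have mf := test_measurable tf.
have iM (h : rV -> R) : mu.-integrable setT (EFin \o h) -> mu.-integrable setT (EFin \o (fun x => h x * f x)).
  move=> ih; rewrite (_ : (fun x => _) = (fun x => f x * h x)); last first.
    by apply/funext => x; rewrite mulrC.
  by apply: (@integrable_bddM _ _ _ mu setT f h C).
rewrite (@ae_eq_integral_on _ _ _ mu _ _ (fun x => ((g x - H x 0 i) * f x)%:E)); last 2 first.
- by apply: aeW.
- by move=> x xC; rewrite (test_out tfC xC) mulr0.
under eq_integral do rewrite mulrBl EFinB.
rewrite (integralB_EFin measurableT (iM _ ig) (iM _ (iH i))).
have := vH i f tf; rewrite (vG i f tf) => /oppr_inj.
rewrite (@ae_eq_Rintegral_on _ _ _ mu Om _ (fun x => g x * f x)); last 2 first.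
- apply: filterS gG => x gx _; have [/gx->//|xC] := pselect (cbox a b x).
  by rewrite (test_out tfC xC) !mulr0.
- by move=> x Ox; rewrite (test_out tf Ox) mulr0.
move=> e.
have fin1 := integrable_fin_num measurableT (iM _ ig).
have fin2 := integrable_fin_num measurableT (iM _ (iH i)).
move: e; rewrite /Rintegral => e.
by rewrite -(fineK fin1) -(fineK fin2) e -EFinB subrr.
Qed.

Lemma wgradP v : (exists G, is_weak_grad Om v G) -> is_weak_grad Om v (wgrad Om v).
Proof. exact: xgetPex. Qed.

Lemma weak_grad_unique_ae v v' G G' : is_weak_grad Om v G ->
  {ae mu, forall x, Om x -> v x = v' x} ->
  (forall i, mu.-integrable setT (EFin \o (fun x => G' x 0 i))) ->
  (forall i f, test_function Om f ->
    \int[mu]_x (v' x * partial i f x) = - \int[mu]_x (G' x 0 i * f x)) ->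
  {ae mu, forall x, Om x -> G x = G' x}.
Proof.
move=> vG vv' iG' v'G'; apply: (weak_grad_unique vG) => // i f tf.
rewrite -v'G'//; apply: ae_eq_Rintegral_on.
  by apply: filterS vv' => x h Ox; rewrite h.
by move=> x Ox; rewrite (test_partial_out i tf Ox) mulr0.
Qed.

(** [wgrad] is some weak gradient picked by choice, so a computed gradient can be substituted for it
    only through uniqueness. *)
Lemma wgrad_ae v v' G' : {ae mu, forall x, Om x -> v x = v' x} ->
  mu.-integrable setT (EFin \o v') ->
  (forall i, mu.-integrable setT (EFin \o (fun x => G' x 0 i))) ->
  (forall i f, test_function Om f ->
    \int[mu]_x (v' x * partial i f x) = - \int[mu]_x (G' x 0 i * f x)) ->
  {ae mu, forall x, Om x -> wgrad Om v x = G' x}.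
Proof.
move=> vv' iv' iG' vG'; apply: (weak_grad_unique_ae _ vv' iG' vG').
by apply: wgradP; exists G'; apply: (weak_grad_ae vv' _ iv' iG' vG'); exact: aeW.
Qed.

Lemma vec_represents G : (forall i, ae_measurable mu Om (fun x => G x 0 i)) ->
  exists G', [/\ measurable_field G',
    forall x, ~ Om x -> G' x = 0 & {ae mu, forall x, Om x -> G x = G' x}].
Proof.
move=> mG; have [g Hg] := choice (fun i => ae_measurable_represents mOm (mG i)).
exists (fun x => \row_i g i x); split.
- by move=> i; under eq_fun do rewrite mxE; have [] := Hg i.
- by move=> x Ox; apply/rowP => i; rewrite !mxE; have [_ /(_ x Ox)] := Hg i.
have H i : {ae mu, forall x, Om x -> G x 0 i = g i x} by have [] := Hg i.
by apply: filterS (filter_forall _ H) => x Hx Ox; apply/rowP => i; rewrite mxE Hx.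
Qed.

Lemma Lnorm_ae_eq (q : R) (f g : rV -> R) : {ae mu, forall x, f x = g x} ->
  ('N[mu]_q%:E[EFin \o f] = 'N[mu]_q%:E[EFin \o g])%E.
Proof.
move=> fg; rewrite !Lnorm_EFinE; 
rewrite (@ae_eq_integralT _ _ _ mu (fun x => (`|f x| `^ q)%:E) (fun x => (`|g x| `^ q)%:E))//.
by apply: filterS fg => x ->.
Qed.

Lemma W0p_ae (p : R) v G G' : W0p Om p v G ->
  measurable_field G' ->
  (forall x, ~ Om x -> G' x = 0) -> {ae mu, forall x, Om x -> G x = G' x} ->
  W0p Om p v G'.
Proof.
move=> [mv mG v0 G0 [f Hf]] mG' G'0 GG'; split => //; exists f => j.
have [tf Hj] := Hf j; split => //; move: Hj.
rewrite (@Lnorm_ae_eq p (fun x => enorm (G x - grad (f j) x)) (fun x => enorm (G' x - grad (f j) x)))//.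
apply: filterS GG' => x h; have [/h->//|Ox] := pselect (Om x).
by rewrite G0 ?G'0.
Qed.

Lemma inW10_W0p (p : R) v v' : inW10 Om p v -> represents mu Om v v' ->
  is_weak_grad Om v (wgrad Om v) /\
  exists G', W0p Om p v' G' /\ {ae mu, forall x, Om x -> wgrad Om v x = G' x}.
Proof.
move=> [[_ exG [mG _]] apx] [mv' v'0 vv'].
split; first exact: wgradP.
have [G' [mG' G'0 GG']] := vec_represents mG; exists G'; split => //.
split => //.
have H j : exists f, test_function Om f /\
    ('N[mu]_p%:E[EFin \o (fun x => v' x - f x)%R] +
     'N[mu]_p%:E[EFin \o (fun x => enorm (G' x - grad f x))%R] < (eps j)%:E)%E.
  have [f tf] := apx _ (eps_gt0 j).
  move=> Hf; exists f; split => //; move: Hf.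
  rewrite /normLp_vec.
  rewrite (@normLpE _ _ _ mu Om p _ (fun x => v' x - f x)); last 2 first.
  - by apply: filterS vv' => x h Ox; rewrite h.
  - by move=> x Ox; rewrite v'0// (test_out tf Ox) subrr.
  rewrite (@normLpE _ _ _ mu Om p _ (fun x => enorm (G' x - grad f x)))//.
  - by apply: filterS GG' => x h Ox /=; rewrite h.
  - by move=> x Ox; rewrite G'0// (test_grad_out tf Ox) subrr enorm0.
by have [f Hf] := choice H; exists f.
Qed.

Lemma test_cst0 : test_function Om (cst 0).
Proof.
split; first by move=> k; exact: Ck_cst.
by exists set0; split => //; exact: compact0.
Qed.

Lemma grad_cst (c : R) : grad (cst c : rV -> R) = cst 0.
Proof. by apply/funext => x; apply/rowP => i; rewrite !mxE /partial derive_cst. Qed.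

Lemma Lnorm_cst0 (q : R) : 0 < q -> ('N[mu]_q%:E[EFin \o (cst 0%R : rV -> R)] = 0)%E.
Proof.
move=> q0; rewrite Lnorm_EFinE.
under eq_integral do rewrite normr0 powR0 ?gt_eqF//.
by rewrite integral0 poweR0r// invr_neq0// gt_eqF.
Qed.

Lemma W0p_cst0 (p : R) : 0 < p -> W0p Om p (cst 0) (cst 0).
Proof.
move=> p0; split; [exact: measurable_cst|by move=> i; exact: measurable_cst| | |] => //.
exists (fun=> cst 0) => j; split; first exact: test_cst0.
have -> : (fun x : rV => cst 0 x - cst 0 x) = cst (0 : R) by apply/funext => x; rewrite /= subrr.
have -> : (fun x => enorm (cst (0 : rV) x - grad (cst (0 : R)) x)) = cst (0 : R).
  by apply/funext => x; rewrite grad_cst /= subrr enorm0.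
by rewrite !Lnorm_cst0// adde0 lte_fin eps_gt0.
Qed.

End weak_gradients.

Section admissible_tests.
Context {R : realType}.
Notation lam := (@lebesgue_measure R).

Lemma trunc_lipschitz (k s t : R) : 0 < k -> `|trunc k s - trunc k t| <= `|s - t|.
Proof.
move=> k0; have c1 := @cvg_strunc R k s k0; have c2 := @cvg_strunc R k t k0.
have c : `|strunc k m s - strunc k m t| @[m --> \oo] --> `|trunc k s - trunc k t|.
  by apply: cvg_norm; exact: cvgB.
rewrite -(cvg_lim (@Rhausdorff R) c); apply: limr_le; first by apply/cvg_ex; eexists; exact: c.
by apply: nearW => m; exact: strunc_lipschitz.
Qed.

Lemma trunc_continuous (k : R) : 0 < k -> continuous (trunc k).
Proof.
move=> k0 s; apply/cvgrPdist_le => e e0.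
have := @cvgr_dist_le R R R (nbhs s) (nbhs_filter s) id s (@cvg_id _ _) _ e0.
by apply: filterS => t; apply: le_trans; exact: trunc_lipschitz.
Qed.

Lemma measurable_trunc (k : R) : 0 < k -> measurable_fun setT (trunc k).
Proof. by move=> k0; apply: continuous_measurable_fun; exact: trunc_continuous. Qed.

Lemma trunc0 (k : R) : trunc k 0 = 0.
Proof. by rewrite /trunc addr0 subr0 subrr mulr0. Qed.

Lemma continuous_supp_integrable (g : R -> R) (M : R) : continuous g ->
  (forall s, M < `|s| -> g s = 0) -> lam.-integrable setT (EFin \o g).
Proof.
move=> cg gM.
have -> : EFin \o g = (EFin \o g) \_ `[(- M)%R, M]%classic.
  apply/funext => s; rewrite patchE; case: ifPn => //.
  rewrite notin_setE/= in_itv/= => /negP.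
  by rewrite -ler_norml -ltNge => /gM ->.
apply/(@integrable_mkcond _ _ _ lam _ (EFin \o g) (measurable_itv `[- M, M])).
apply: continuous_compact_integrable; first exact: segment_compact.
exact: continuous_subspaceT.
Qed.

(** The weak derivative is the indicator of |s| < k. Integration by parts holds for the smoothed
    truncations, and both sides converge by dominated convergence. *)
Lemma admissible_trunc (k : R) : 0 < k -> admissible_B (trunc k).
Proof.
move=> k0; have mk := measurable_trunc k0.
have mb : measurable_fun setT (fun s : R => (`|s| < k)%R%:R : R).
  rewrite (_ : (fun s => _) = (\1_(`]-k, k[%classic) : R -> R)); first exact: measurable_indic.
  by apply/funext => s; rewrite indicE mem_setE in_itv/= -ltr_norml.
split.
- exact: trunc_continuous.
- exact: trunc0.
- split; first by exists (trunc k) => //; exact: aeW.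
  by apply: (@normLp_oo_lty _ _ _ _ _ _ k) => s _; exact: trunc_le.
exists (fun s => (`|s| < k)%R%:R); split.
- split; first by eexists; [exact: mb|exact: aeW].
  apply: (@normLp_oo_lty _ _ _ _ _ _ 1) => s _.
  by case: (_ < _); rewrite ?normr1 ?normr0.
- move=> f df [K cK fK].
  have [M [_ KM]] := compact_bounded cK.
  have fM s : M + 1 < `|s| -> f s = 0.
    move=> Ms; apply: fK => Ks; have := KM _ (ltr_pwDr ltr01 (lexx M)) _ Ks.
    by rewrite /= leNgt Ms.
  have d0 s : is_derive s (1 : R) f (f^`()%classic s).
    by rewrite derive1E; apply: DeriveDef => //; exact: (df 0%N).
  have cdf : continuous (f^`()%classic).
    by move=> s; apply/differentiable_continuous/derivable1_diffP; exact: (df 1%N s).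
  have cf := is_derive_continuous d0.
  have dfM := derive_eq0_out d0 fM.
  pose h m s := strunc k m s * f s.
  have dh m s : is_derive s (1 : R) (h m) (strunc k m s * f^`()%classic s + f s * dstrunc k m s).
    exact: (is_deriveM (is_derive_strunc k m s) (d0 s)).
  have ca m : continuous (fun s => strunc k m s * f^`()%classic s).
    by apply: continuous_funM => //; exact: strunc_continuous.
  have cb m : continuous (fun s => f s * dstrunc k m s).
    by apply: continuous_funM => //; exact: dstrunc_continuous.
  have ia m : lam.-integrable setT (EFin \o (fun s => strunc k m s * f^`()%classic s)).
    by apply: (@continuous_supp_integrable _ (M + 1)) => // s /dfM ->; rewrite mulr0.
  have ib m : lam.-integrable setT (EFin \o (fun s => f s * dstrunc k m s)).
    by apply: (@continuous_supp_integrable _ (M + 1)) => // s /fM ->; rewrite mul0r.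
  have hM m s : M + 1 < `|s| -> h m s = 0 by move=> /fM; rewrite /h => ->; rewrite mulr0.
  have I0 m := integral_derive_eq0 (dh m) (continuous_funD (ca m) (cb m)) (hM m).
  have E m : \int[lam]_s (strunc k m s * f^`()%classic s) = - \int[lam]_s (f s * dstrunc k m s).
    apply/eqP; rewrite -addr_eq0 -(RintegralD measurableT (ia m) (ib m)).
    by rewrite /Rintegral I0.
  have Ca : \int[lam]_s (strunc k m s * f^`()%classic s) @[m --> \oo] --> \int[lam]_s (trunc k s * f^`()%classic s).
    apply: (@dominated_cvg_Rintegral _ _ _ lam setT measurableT _ _ (fun s => `|(k + 3) * f^`()%classic s|)).
    - by move=> m; exact: integrable_measurable (ia m).
    - by apply: measurable_funM => //; exact: continuous_measurable_fun.
    - have i1 := @continuous_supp_integrable _ (M + 1) cdf dfM.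
      exact: integrable_abse (integrableZ_EFin (k + 3) measurableT i1).
    - by apply: aeW => s _; apply: cvgM; [exact: cvg_strunc|exact: cvg_cst].
    - by move=> m s _; rewrite !normrM ler_wpM2r// (@ger0_norm _ (k + 3)) ?addr_ge0 ?(ltW k0)// strunc_le.
  have Cb : \int[lam]_s (f s * dstrunc k m s) @[m --> \oo] --> \int[lam]_s ((`|s| < k)%R%:R * f s).
    apply: (@dominated_cvg_Rintegral _ _ _ lam setT measurableT _ _ (fun s => `|f s|)).
    - by move=> m; exact: integrable_measurable (ib m).
    - by apply: measurable_funM => //; exact: continuous_measurable_fun.
    - exact: integrable_abse (@continuous_supp_integrable _ (M + 1) cf fM).
    - by apply: aeW => s _; rewrite mulrC; apply: cvgM; [exact: cvg_cst|exact: cvg_dstrunc].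
    - by move=> m s _; rewrite normrM ler_piMr// dstrunc_le1.
  move: Ca; rewrite (_ : (fun m => _) = (fun m => - \int[lam]_s (f s * dstrunc k m s))); last exact/funext.
  by move=> Ca; apply: (cvg_unique _ Ca); [exact: Rhausdorff|exact: cvgN].
- by exists k => //; apply: aeW => s ks; rewrite ltNge ks.
Qed.

End admissible_tests.

Section solution_gradient.
Context {R : realType} {n : nat}.
Notation rV := 'rV[R]_n.
Notation mu := (lebesgue R n).
Variables (Om : set rV) (p L : R).
Hypotheses (oOm : open Om) (OmL : Om `<=` cube L) (p1 : 1 < p).
Implicit Types (v u : rV -> R) (F G H : rV -> rV).

Let mOm : measurable Om. Proof. exact: open_measurable_rV. Qed.
Let p0 : 0 < p. Proof. exact: lt_trans p1. Qed.

Lemma mu_Om_lty : (mu Om < +oo)%E.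
Proof.
apply: le_lt_trans (lebesgue_cube_lty n L).
by apply: le_measure => //; rewrite inE//; exact: measurable_cube.
Qed.

Let int1 (c : R) : mu.-integrable setT (EFin \o (fun x => c * (\1_Om x : R))).
Proof.
apply: integrableZ_EFin => //; apply/integrableP; split.
  by apply/measurable_EFinP; exact: measurable_indic.
rewrite (eq_integral (fun x => (\1_Om x)%:E)); last by move=> x _ /=; rewrite ger0_norm.
by rewrite integral_indic// setIT; exact: mu_Om_lty.
Qed.

Lemma cst_weak_grad (c : R) : is_weak_grad Om (cst c) (cst 0).
Proof.
apply: (@weak_grad_ae _ _ _ (cst c) (fun x => c * \1_Om x) (cst 0) (cst 0)).
- by apply: aeW => x Ox; rewrite indicE mem_set// mulr1.
- exact: aeW.
- exact: int1.
- move=> i; rewrite (_ : EFin \o _ = cst 0%E); first exact: integrable0.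
  by apply/funext => x /=; rewrite mxE.
move=> i f tf.
have := integral_partial_eq0 i (test_C1c tf) => I0.
rewrite (@eq_Rintegral _ _ _ mu setT (fun x => c * partial i f x)); last first.
  move=> x _; rewrite indicE -mulrA; congr (_ * _); case: (boolP (x \in Om)); first by rewrite mul1r.
  by rewrite notin_setE => Ox; rewrite (test_partial_out i tf Ox) mulr0.
rewrite RintegralZl//; last exact: C1c_partial_integrable (test_C1c tf).
rewrite {1}/Rintegral I0 mulr0.
rewrite (@eq_Rintegral _ _ _ mu setT (cst 0)); last by move=> x _; rewrite mxE mul0r.
by rewrite /Rintegral integral0 oppr0.
Qed.

Lemma wgrad_cst (c : R) : {ae mu, forall x, Om x -> wgrad Om (cst c) x = 0}.
Proof.
have G0 := cst_weak_grad c.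
have Gc : is_weak_grad Om (cst c) (wgrad Om (cst c)) by apply: wgradP; exists (cst 0).
apply: (weak_grad_unique oOm Gc (H := cst 0)).
  move=> i; rewrite (_ : EFin \o _ = cst 0%E); first exact: integrable0.
  by apply/funext => x /=; rewrite mxE.
move=> i f tf; have [_ _ ->//] := G0; congr (- _).
by apply: ae_eq_Rintegral_on; [exact: aeW|move=> x _; rewrite mxE mul0r].
Qed.

Lemma inLp_cst (q c : R) : 0 < q -> inLp mu Om q%:E (cst c).
Proof.
move=> q0; split; first by exists (cst c) => //; exact: aeW.
rewrite (@normLpE _ _ _ mu Om q _ (fun x => c * \1_Om x)); last 2 first.
- by apply: aeW => x Ox; rewrite indicE mem_set// mulr1.
- by move=> x Ox; rewrite indicE memNset// mulr0.
rewrite (Lnorm_lty _ _ q0).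
rewrite (eq_integral (fun x => (`|c| `^ q * \1_Om x)%:E)); last first.
  move=> x _; rewrite indicE normrM powRM//; case: (x \in Om); first by rewrite normr1 powR1.
  by rewrite normr0 powR0// gt_eqF.
by apply: integrable_lty => //; exact: int1.
Qed.

(** Serves the choice eta = 1 in the definition of a solution. *)
Lemma inW1_cst (q c : R) : 0 < q -> inW1 Om q%:E (cst c).
Proof.
move=> q0; split; [exact: inLp_cst|by exists (cst 0); exact: cst_weak_grad|].
have wg := wgrad_cst c; split.
  by move=> i; exists (cst 0) => //; apply: filterS wg => x h Ox; rewrite h// mxE.
rewrite /normLp_vec (@normLpE _ _ _ mu Om q _ (fun x => 0 * \1_Om x)).
- rewrite (Lnorm_lty _ _ q0).
  under eq_integral do rewrite mul0r normr0 powR0 ?gt_eqF//.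
  by rewrite integral0 ltry.
- by apply: filterS wg => x h Ox /=; rewrite h// enorm0 mul0r.
- by move=> x _; rewrite mul0r.
Qed.

Lemma inW10_cst0 (q : R) : 0 < q -> inW10 Om q (cst 0).
Proof.
move=> q0; split; first exact: inW1_cst.
move=> e e0; exists (cst 0); first exact: test_cst0.
rewrite /normLp_vec !(@normLpE _ _ _ mu Om q _ (cst 0)) ?Lnorm_cst0//.
- by rewrite adde0 lte_fin.
- by apply: filterS (wgrad_cst 0) => x h Ox /=; rewrite h// grad_cst subrr enorm0.
- by apply: aeW => x _ /=; rewrite subrr.
Qed.

Lemma trunc_id (k s : R) : `|s| <= k -> trunc k s = s.
Proof.
rewrite ler_norml => /andP[h1 h2]; rewrite /trunc ger0_norm; last by lra.
by rewrite ger0_norm; lra.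
Qed.

(** * Truncations and the generalized gradient of a solution *)

Lemma trunc_ge (k s : R) : 0 < k -> k <= s -> trunc k s = k.
Proof. by move=> k0 ks; rewrite /trunc ger0_norm ?ler0_norm; lra. Qed.

Lemma truncN (k s : R) : trunc k (- s) = - trunc k s.
Proof. by rewrite /trunc opprK (addrC k) -mulrN opprB addrC. Qed.

Lemma truncP (k s : R) : 0 < k -> [\/ `|s| <= k /\ trunc k s = s,
  k < s /\ trunc k s = k | s < - k /\ trunc k s = - k].
Proof.
move=> k0; have [sk|] := leP `|s| k; first by constructor 1; rewrite trunc_id.
rewrite lter_normr => /orP[ks|ks]; first by constructor 2; rewrite trunc_ge// ltW.
constructor 3; split; first by rewrite ltrNr.
by rewrite -(opprK s) truncN trunc_ge// ltW.
Qed.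

Lemma trunc_trunc (k m s : R) : 0 < k -> k <= m -> trunc k (trunc m s) = trunc k s.
Proof.
move=> k0 km; have m0 := lt_le_trans k0 km.
have [[_ ->]//|[sm ->]|[sm ->]] := truncP s m0.
- by rewrite !trunc_ge// ltW// (le_lt_trans km).
- by rewrite -[in RHS](opprK s) (truncN k m) (truncN k (- s)) !trunc_ge//; lra.
Qed.

Lemma trunc_lt (k m s : R) : 0 < k -> k <= m -> (`|trunc m s| < k) = (`|s| < k).
Proof.
move=> k0 km; have m0 := lt_le_trans k0 km.
by have [[_ ->]//|[sm ->]|[sm ->]] := truncP s m0; apply/idP/idP; rewrite !ltr_norml; lra.
Qed.

(* [T_M u] may replace [u] in [T_k (u - phi)] as soon as [|phi| <= M - k]. *)
Lemma truncB_trunc (k M s t : R) : 0 < k -> `|t| <= M - k ->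
  trunc k (trunc M s - t) = trunc k (s - t) /\
  (`|trunc M s - t| < k) = (`|s - t| < k) /\ (`|s - t| < k -> `|s| < M).
Proof.
rewrite ler_norml => k0 /andP[t1 t2]; have M0 : 0 < M by lra.
have [[sM ->]|[sM ->]|[sM ->]] := @truncP M s M0.
- by split => //; split => //; rewrite ltr_norml => /andP[h1 h2]; rewrite ltr_norml; lra.
- rewrite !trunc_ge; try lra; split => //; split; last by rewrite ltr_norml; lra.
  by apply/idP/idP; rewrite ltr_norml; lra.
- have e a : trunc k (a - t) = - trunc k (t - a) by rewrite -truncN opprB.
  rewrite !e !trunc_ge; try lra; split => //; split; last by rewrite ltr_norml; lra.
  by apply/idP/idP; rewrite ltr_norml; lra.
Qed.

(** When [F] is the generalized gradient of [u], this is the gradient of [trunc k u]. *)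
Definition cutoff (k : R) (u : rV -> R) F (x : rV) : rV := if `|u x| < k then F x else 0.

Lemma cutoff_coord k u F x i : cutoff k u F x 0 i = (`|u x| < k)%R%:R * F x 0 i.
Proof. by rewrite /cutoff; case: ifP => _; rewrite ?mul1r// mul0r mxE. Qed.

Lemma measurable_lt_norm (k : R) v : measurable_fun setT v ->
  measurable_fun setT (fun x => (`|v x| < k)%R%:R : R).
Proof.
move=> mv; rewrite (_ : (fun x => _) = (\1_(v @^-1` `]-k, k[%classic) : rV -> R)).
  by apply: measurable_indic; rewrite -[X in measurable X]setTI; exact: mv.
apply/funext => x; rewrite indicE; congr ((nat_of_bool _)%:R).
by apply/idP/idP; rewrite inE /= in_itv/= -ltr_norml.
Qed.

Lemma measurable_cutoff k u F i : measurable_fun setT u ->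
  measurable_fun setT (fun x => F x 0 i) -> measurable_fun setT (fun x => cutoff k u F x 0 i).
Proof.
move=> mu_ mF; under eq_fun do rewrite cutoff_coord.
by apply: measurable_funM => //; exact: measurable_lt_norm.
Qed.

Lemma W0p_integrable v G : W0p Om p v G -> mu.-integrable setT (EFin \o v) /\
  forall i, mu.-integrable setT (EFin \o (fun x => G x 0 i)).
Proof. by move=> /(W0p_approx mOm OmL p1)[]. Qed.

(** By the chain rule and uniqueness, gradients of truncations at different levels agree where both
    levels are inactive; the gluing below rests on this. *)
Lemma W0p_trunc (k : R) v v' G G' : 0 < k -> W0p Om p v G -> W0p Om p v' G' ->
  (forall x, v' x = trunc k (v x)) ->
  {ae mu, forall x, Om x -> G' x = cutoff k v G x}.
Proof.
move=> k0 vG v'G' v'E; have [mv mG _ G0 _] := vG.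
have [iv' iG'] := W0p_integrable v'G'; have [_ iG] := W0p_integrable vG.
have a := W0p_approx mOm OmL p1 vG; have a' := W0p_approx mOm OmL p1 v'G'.
have wg : is_weak_grad Om v' G'.
  by apply: (@weak_grad_ae _ _ _ v' v' G' G') => //; [exact: aeW|exact: aeW|move=> i f tf; exact: weak_grad_approx i a' tf].
apply: (weak_grad_unique_ae oOm wg (v' := v')); first exact: aeW.
- move=> i; rewrite (_ : EFin \o _ = EFin \o (fun x => (`|v x| < k)%R%:R * G x 0 i)).
    apply: (@integrable_bddM _ _ _ mu setT _ _ 1) => //; first exact: measurable_lt_norm.
    by move=> x _; case: (_ < _); rewrite ?normr1 ?normr0.
  by apply/funext => x; rewrite /= cutoff_coord.
move=> i f tf; have := chain_rule_trunc i k0 a tf.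
under eq_Rintegral do rewrite -v'E.
move=> ->; congr (- _); apply: eq_Rintegral => x _.
by rewrite cutoff_coord mulrA.
Qed.

(** Nothing is said of the integrability of [u'] or [F']: only the truncations are in the Sobolev
    space. *)
Definition gradient_represents u u' F' := [/\ represents mu Om u u',
  measurable_field F',
  forall x, ~ Om x -> F' x = 0,
  {ae mu, forall x, Om x -> gengrad Om u x = F' x} &
  forall k, 0 < k -> W0p Om p (fun x => trunc k (u' x)) (cutoff k u' F')].

Section generalized_gradient.
Variable u : rV -> R.
Hypothesis uS : inS10 Om p u.

(* The gradient is glued from those of the truncations: it is that of trunc m u
   on the set where m - 1 <= |u| < m. *)
Lemma gengrad_represents : exists u' F', gradient_represents u u' F'.
Proof.
have [mu_u _ uk _] := uS; have [u' ru'] := ae_measurable_represents mOm mu_u.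
have [mu' u'0 uu'] := ru'.
have rk k : 0 < k -> represents mu Om (fun x => trunc k (u x)) (fun x => trunc k (u' x)).
  move=> k0; split; first exact: (measurableT_comp (measurable_trunc k0) mu').
  - by move=> x /u'0 ->; rewrite trunc0.
  - by apply: filterS uu' => x h Ox; rewrite h.
have Wk k : 0 < k -> exists G, W0p Om p (fun x => trunc k (u' x)) G.
  by move=> k0; have [_ [G [WG _]]] := inW10_W0p oOm (uk k k0) (rk k k0); exists G.
have [G_ WG_] := choice (fun j => Wk j.+1%:R (ltr0Sn R j)).
pose m x := Num.truncn `|u' x|.
have um x : `|u' x| < (m x).+1%:R by have /andP[] := truncn_itv (normr_ge0 (u' x)).
pose F' x := G_ (m x) x.
have cutF k G : 0 < k -> W0p Om p (fun x => trunc k (u' x)) G ->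
    {ae mu, forall x, Om x -> G x = cutoff k u' F' x}.
  move=> k0 WG.
  (* Level [k] is compared with every integer level, in whichever order they come, so that one null
     set serves for all [j]. At a point with |u'| < k the level chosen is the one defining [F'],
     otherwise an integer level above [k]. *)
  have H j : {ae mu, forall x, Om x -> (k <= j.+1%:R -> G x = cutoff k u' (G_ j) x) /\
      (j.+1%:R <= k -> G_ j x = cutoff j.+1%:R u' G x)}.
    have h1 : {ae mu, forall x, Om x -> k <= j.+1%:R -> G x = cutoff k u' (G_ j) x}.
      have [kj|kj] := leP k j.+1%:R; last exact: aeW.
      have := W0p_trunc k0 (WG_ j) WG (fun x => esym (trunc_trunc (u' x) k0 kj)).
      by apply: filterS => x h Ox _; rewrite h// /cutoff trunc_lt.
    have h2 : {ae mu, forall x, Om x -> j.+1%:R <= k -> G_ j x = cutoff j.+1%:R u' G x}.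
      have [kj|kj] := leP j.+1%:R k; last exact: aeW.
      have := W0p_trunc (ltr0Sn R j) WG (WG_ j) (fun x => esym (trunc_trunc (u' x) (ltr0Sn R j) kj)).
      by apply: filterS => x h Ox _; rewrite h// /cutoff trunc_lt.
    by apply: filterS2 h1 h2 => x a b Ox; split; [exact: a|exact: b].
  apply: filterS (ae_foralln H) => x Hx Ox; rewrite /cutoff.
  case: ifPn => [uk_|]; last first.
    move=> uk_; have [h _] := Hx (Num.truncn k) Ox; rewrite h.
      by rewrite /cutoff (negbTE uk_).
    by apply/ltW; have /andP[] := truncn_itv (ltW k0).
  have [h1 h2] := Hx (m x) Ox; rewrite /F'.
  have [kj|kj] := leP k (m x).+1%:R; first by rewrite h1// /cutoff uk_.
  by rewrite h2 ?(ltW kj)// /cutoff um.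
have mF' i : measurable_fun setT (fun x => F' x 0 i).
  pose E j := [set x | m x = j].
  have UE : \bigcup_j E j = setT by apply/seteqP; split => // x _; exists (m x).
  have mE j : measurable (E j).
    rewrite (_ : E j = (fun x => `|u' x|) @^-1` `[j%:R, j.+1%:R[%classic).
      by rewrite -[X in measurable X]setTI; apply: (measurableT_comp _ mu').
    apply/seteqP; split => x; rewrite /E /= in_itv/=.
      by move=> <-; exact: truncn_itv.
    by move=> h; exact: truncn_def.
  rewrite -UE; apply/measurable_fun_bigcup => // j.
  apply: (@eq_measurable_fun _ _ _ _ _ (fun x => G_ j x 0 i)).
    by move=> x; rewrite inE /E /= /F' => ->.
  by have [_ mG _ _ _] := WG_ j; exact: measurable_funTS (mG i).
have F'0 x : ~ Om x -> F' x = 0 by move=> Ox; have [_ _ _ G0 _] := WG_ (m x); exact: G0.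
have WF k : 0 < k -> W0p Om p (fun x => trunc k (u' x)) (cutoff k u' F').
  move=> k0; have [G WG] := Wk k k0; apply: (W0p_ae WG) (cutF k G k0 WG).
  - by move=> i; exact: measurable_cutoff.
  - by move=> x Ox; rewrite /cutoff F'0// if_same.
have idk k i f : 0 < k -> test_function Om f ->
    \int[mu]_x (trunc k (u' x) * partial i f x) = - \int[mu]_x (cutoff k u' F' x 0 i * f x).
  by move=> k0 tf; exact: weak_grad_approx i (W0p_approx mOm OmL p1 (WF k k0)) tf.
have gF : is_gengrad Om u F'.
  split; first by move=> i; exists (fun x => F' x 0 i); [exact: measurable_funTS|exact: aeW].
  move=> k k0; have [ik iGk] := W0p_integrable (WF k k0).
  apply: (weak_grad_ae _ _ ik iGk) => [||i f tf]; last exact: idk.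
  - by apply: filterS uu' => x h Ox; rewrite h.
  - by apply: filterS uu' => x h Ox; rewrite /cutoff h.
exists u', F'; split => //.
(* [gengrad] is again a choice, now known to be made in a nonempty set. Uniqueness at every integer
   level identifies it with [F']. *)
have [_ gG] : is_gengrad Om u (gengrad Om u) by apply: xgetPex; exists F'.
have H j : {ae mu, forall x, Om x -> (if `|u x| < j.+1%:R then gengrad Om u x else 0) = cutoff j.+1%:R u' F' x}.
  have j0 := ltr0Sn R j; have [ik iGk] := W0p_integrable (WF _ j0).
  apply: (weak_grad_unique_ae oOm (gG _ j0) _ iGk) => [|i f tf]; last exact: idk.
  by apply: filterS uu' => x h Ox; rewrite h.
apply: filterS2 uu' (ae_foralln H) => x ux Hx Ox.
by have := Hx (m x) Ox; rewrite ux// /cutoff um.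
Qed.

End generalized_gradient.

End solution_gradient.

(** * The entropic identity tested with truncations *)

Section entropic_identity.
Context {R : realType} {n : nat}.
Notation rV := 'rV[R]_n.
Notation mu := (lebesgue R n).
Variables (Om : set rV) (p L : R) (V : rV -> R -> R).
Hypotheses (oOm : open Om) (OmL : Om `<=` cube L) (p1 : 1 < p).
Implicit Types (v u f : rV -> R) (F G : rV -> rV).

Let mOm : measurable Om. Proof. exact: open_measurable_rV. Qed.
Let p0 : 0 < p. Proof. exact: lt_trans p1. Qed.

(** The chain rule cannot be applied to u - phi, as [u] need not have a weak gradient. It is applied
    to trunc M u - phi, which has the same truncation at level [k]. *)
Lemma entropic_identity (k h : R) f f' u u' (F : rV -> rV) W phi phi' (Phi : rV -> rV) :
  entropic_renormalized Om p V f u -> gradient_represents Om p u u' F ->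
  represents mu Om f f' -> represents mu Om (fun x => V x (u x)) W ->
  inW10 Om p phi -> inLp mu Om +oo%E phi -> represents mu Om phi phi' ->
  W0p Om p phi' Phi -> (forall x, `|phi' x| <= h) -> 0 < k ->
  \int[mu]_x (enorm (F x) `^ (p - 2) *
    dotr (F x) (cutoff k (fun x => u' x - phi' x) (fun x => F x - Phi x) x)) +
  \int[mu]_x (W x * trunc k (u' x - phi' x)) =
  \int[mu]_x (f' x * trunc k (u' x - phi' x)).
Proof.
move=> [_ _ _ H] [ru mF F0 uF WF] [_ f0 ff'] [_ W0 VW] Wphi bphi [mphi' phi'0 pp'] WPhi phih k0.
have [mu' u'0 uu'] := ru.
have h0 : 0 <= h by exact: le_trans (normr_ge0 _) (phih 0).
(* Large enough that |u - phi| < k forces |u| < M. *)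
pose M := h + k; have M0 : 0 < M by rewrite ltr_wpDl.
have phiM x : `|phi' x| <= M - k by rewrite /M addrK.
pose B x := truncB_trunc (u' x) k0 (phiM x).
pose z x := u' x - phi' x.
have WB := W0pB p1 (WF M M0) WPhi; have aB := W0p_approx mOm OmL p1 WB.
have [ib iGb] := W0p_integrable oOm OmL p1 WB.
have mz : measurable_fun setT z by exact: measurable_funB.
pose w x := cst 1 x * trunc k (u x - phi x).
have iz : mu.-integrable setT (EFin \o (fun x => trunc k (z x))).
  apply: (@le_integrable_EFin _ _ _ mu setT _ (fun x => `|trunc M (u' x) - phi' x|)) => //.
  - exact: (measurableT_comp (measurable_trunc k0) mz).
  - by move=> x _; rewrite /z -(B x).1 trunc_le_norm.
  - exact: integrable_abse ib.
have wz : {ae mu, forall x, Om x -> w x = trunc k (z x)}.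
  by apply: filterS2 uu' pp' => x hu hphi Ox; rewrite /w /z mul1r hu// hphi.
have GE x i : cutoff k z (fun x => F x - Phi x) x 0 i =
    (`|trunc M (u' x) - phi' x| < k)%R%:R * (cutoff M u' F x - Phi x) 0 i.
  rewrite cutoff_coord (B x).2.1 /z; case: (boolP (_ < k)) => [zk|_]; last by rewrite !mul0r.
  by rewrite /cutoff ((B x).2.2 zk).
have wG : {ae mu, forall x, Om x -> wgrad Om w x = cutoff k z (fun x => F x - Phi x) x}.
  apply: (wgrad_ae oOm wz iz) => [i|i g tg].
    rewrite (_ : EFin \o _ = EFin \o (fun x => (`|trunc M (u' x) - phi' x| < k)%R%:R * (cutoff M u' F x - Phi x) 0 i)).
      apply: (@integrable_bddM _ _ _ mu setT _ _ 1) => //.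
        by apply: measurable_lt_norm; have [] := WB.
      by move=> x _; case: (_ < _); rewrite ?normr1 ?normr0.
    by apply/funext => x; rewrite /= GE.
  have := chain_rule_trunc i k0 aB tg.
  under eq_Rintegral do rewrite (B _).1.
  by move=> ->; congr (- _); apply: eq_Rintegral => x _; rewrite GE mulrA.
(* The constant eta = 1 is tested with the exponent r = n + 1, which exceeds n. *)
have nn1 : (n%:R%:E < n.+1%:R%:E :> \bar R)%E by rewrite lte_fin ltr_nat.
have := H _ (cst 1) phi (trunc k) nn1 (inW1_cst oOm OmL 1 (ltr0Sn R n)) Wphi bphi (admissible_trunc k0).
rewrite /= -/w.
rewrite (@ae_eq_Rintegral_on _ _ _ mu Om _ (fun x => enorm (F x) `^ (p - 2) *
    dotr (F x) (cutoff k z (fun x => F x - Phi x) x))); last 2 first.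
- by apply: filterS2 uF wG => x hF hG Ox; rewrite hF// hG.
- by move=> x Ox; rewrite F0// /dotr big1 ?mulr0// => i _; rewrite mxE mul0r.
rewrite (@ae_eq_Rintegral_on _ _ _ mu Om _ (fun x => W x * trunc k (z x))); last 2 first.
- by apply: filterS2 VW wz => x h1 h2 Ox; rewrite h1// -/(w x) h2.
- by move=> x Ox; rewrite W0// mul0r.
rewrite (@ae_eq_Rintegral_on _ _ _ mu Om _ (fun x => f' x * trunc k (z x)))//.
- by apply: filterS2 ff' wz => x h1 h2 Ox; rewrite h1// -/(w x) h2.
- by move=> x Ox; rewrite f0// mul0r.
Qed.

End entropic_identity.

(** * The Hoelder estimate *)

Section monotonicity.
Context {R : realType} {n : nat}.
Variable p : R.
Hypothesis p2 : 2 <= p.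
Implicit Types x y : 'rV[R]_n.

Let p0 : 0 < p. Proof. by move: p2; lra. Qed.

Lemma powR_split (a : R) : 0 <= a -> a `^ (p - 2) * a ^+ 2 = a `^ p.
Proof.
rewrite le_eqVlt => /orP[/eqP <-|a0]; first by rewrite expr0n mulr0 powR0// gt_eqF.
by rewrite -powR_mulrn ?(ltW a0)// -powRD ?subrK// (gt_eqF a0) implybT.
Qed.

Lemma powR_enorm x : enorm x `^ (p - 2) * dotr x x = enorm x `^ p.
Proof. by rewrite -enorm_sqr powR_split// enorm_ge0. Qed.

Lemma ler_powRs (a b s : R) : 0 <= s -> 0 <= a -> a <= b -> a `^ s <= b `^ s.
Proof. by move=> s0 a0 ab; apply: ge0_ler_powR; rewrite ?nnegrE// (le_trans a0). Qed.

(* Twice the right-hand side is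
     (|x|^(p-2) - |y|^(p-2)) (|x|^2 - |y|^2) + (|x|^(p-2) + |y|^(p-2)) |x - y|^2,
   and |x - y| / 2 is at most the maximum of |x| and |y|. *)
Lemma plaplacian_monotone x y :
  2 `^ (1 - p) * enorm (x - y) `^ p <=
  enorm x `^ (p - 2) * dotr x (x - y) - enorm y `^ (p - 2) * dotr y (x - y).
Proof.
have s0 : 0 <= p - 2 by rewrite subr_ge0.
have D0 := enorm_ge0 (x - y); have X0 := enorm_ge0 x; have Y0 := enorm_ge0 y.
have DXY : enorm (x - y) <= enorm x + enorm y by rewrite (le_trans (enormD _ _))// enormN.
have DE : enorm (x - y) ^+ 2 = enorm x ^+ 2 + enorm y ^+ 2 - 2 * dotr x y.
  by rewrite !enorm_sqr !dotrBl !dotrBr (dotrC y x); ring.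
rewrite !dotrBr (dotrC y x) -!enorm_sqr -powR_split//.
move: DE D0 X0 Y0 DXY; set D := enorm (x - y); set X := enorm x; set Y := enorm y; set d := dotr x y.
move=> DE D0 X0 Y0 DXY.
have dE : d = (X ^+ 2 + Y ^+ 2 - D ^+ 2) / 2 by rewrite DE; field.
have a0 : 0 <= X `^ (p - 2) := powR_ge0 _ _.
have b0 : 0 <= Y `^ (p - 2) := powR_ge0 _ _.
have mono : 0 <= (X `^ (p - 2) - Y `^ (p - 2)) * (X ^+ 2 - Y ^+ 2).
  have [XY|YX] := leP X Y.
    by rewrite mulr_le0// subr_le0 ?ler_powRs// ler_sqr.
  by rewrite mulr_ge0// subr_ge0 ?ler_powRs ?(ltW YX)// ler_sqr ?(ltW YX).
(* The left-hand side is (D / 2)^(p-2), and D / 2 is at most the larger of X and Y: here the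
   constant 2^(1-p) originates. *)
have half : 2 * 2 `^ (1 - p) * D `^ (p - 2) <= X `^ (p - 2) + Y `^ (p - 2).
  have -> : 2 * 2 `^ (1 - p) * D `^ (p - 2) = (D / 2) `^ (p - 2).
    rewrite powRM ?invr_ge0// mulrC; congr (_ * _).
    rewrite -{1}(@powRr1 _ 2)// -powRD; last by rewrite (_ : (2 == 0 :> R) = false) ?implybT// gt_eqF.
    by rewrite -powR_inv1// -powRrM; congr (_ `^ _); ring.
  have [XY|YX] := leP X Y.
    have /(ler_powRs s0) : 0 <= D / 2 by rewrite divr_ge0.
    by move=> /(_ Y) H; rewrite (le_trans (H _)) ?lerDr//; lra.
  have /(ler_powRs s0) : 0 <= D / 2 by rewrite divr_ge0.
  by move=> /(_ X) H; rewrite (le_trans (H _)) ?lerDl//; lra.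
have D2 : 0 <= D ^+ 2 by rewrite sqr_ge0.
have := ler_wpM2r D2 half; move: mono; rewrite dE.
move: (X `^ (p - 2)) (Y `^ (p - 2)) (D `^ (p - 2)) (2 `^ (1 - p)) (D ^+ 2) (X ^+ 2) (Y ^+ 2).
by move=> a b c e D2' X2 Y2; nra.
Qed.

(** Supplies a majorant for dominated convergence: with m the larger of a and b, Cauchy-Schwarz
    gives m^(p-2) m (m + m) = 2 m^p. *)
Lemma plaplacian_bound x y z (a b : R) : enorm y <= a -> enorm z <= b -> enorm x <= a ->
  `|enorm x `^ (p - 2) * dotr x (y - z)| <= 2 * (a `^ p + b `^ p).
Proof.
move=> ya zb xa; have s0 : 0 <= p - 2 by rewrite subr_ge0.
have X0 := enorm_ge0 x; have a0 := le_trans X0 xa; have b0 := le_trans (enorm_ge0 z) zb.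
rewrite normrM (ger0_norm (powR_ge0 _ _)).
pose m := Num.max a b; have m0 : 0 <= m by rewrite le_max a0.
have am : a <= m by rewrite le_max lexx.
have bm : b <= m by rewrite le_max lexx orbT.
have yz : enorm (y - z) <= m + m.
  by rewrite (le_trans (enormD _ _))// enormN lerD// ?(le_trans ya)// (le_trans zb).
apply: (@le_trans _ _ (m `^ (p - 2) * (m * (m + m)))).
  apply: ler_pM => //; first exact: powR_ge0.
    by apply: ler_powRs => //; exact: le_trans am.
  apply: le_trans (dotr_le _ _) _; apply: ler_pM => //; rewrite ?enorm_ge0//.
  exact: le_trans am.
have -> : m * (m + m) = 2 * m ^+ 2 by ring.
rewrite mulrCA powR_split// ler_wpM2l//.
by rewrite /m; case: (leP a b) => _; rewrite ?lerDl ?lerDr powR_ge0.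
Qed.

End monotonicity.

Section trunc_sign.
Context {R : realType}.

Lemma monotone_trunc_ge0 (g : R -> R) (k s t : R) : {homo g : a b / a <= b} -> 0 < k ->
  0 <= (g s - g t) * trunc k (s - t).
Proof.
move=> gm k0; have [st|ts] := leP s t.
  rewrite mulr_le0 ?subr_le0 ?gm//.
  by have [[_ ->]|[h _]|[_ ->]] := truncP (s - t) k0; lra.
rewrite mulr_ge0 ?subr_ge0 ?gm ?(ltW ts)//.
by have [[_ ->]|[_ ->]|[h _]] := truncP (s - t) k0; lra.
Qed.

(** The origin of the exponent 1/(p-1). As [y] is a real number, a norm has to be proved finite
    before it can take its place. *)
Lemma powR_absorb (p y D : R) : 1 < p -> 0 <= y -> 0 <= D ->
  y <= (D * y) `^ p^-1 -> y <= D `^ (p - 1)^-1.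
Proof.
move=> p1 y0 D0 H; have p0 : 0 < p by lra.
have pm0 : 0 < p - 1 by lra.
have [->|yN0] := eqVneq y 0; first exact: powR_ge0.
have {}y0 : 0 < y by rewrite lt_def yN0.
have h1 : y `^ p <= D * y.
  rewrite -[leRHS](@powRr1 _ (D * y)) ?mulr_ge0 ?(ltW y0)// -(@mulVf _ p) ?gt_eqF// powRrM.
  by apply: ler_powRs; rewrite ?(ltW p0) ?(ltW y0).
have h2 : y `^ (p - 1) <= D.
  rewrite -(ler_pM2r y0) -{2}(@powRr1 _ y) ?(ltW y0)// -powRD ?subrK//.
  by rewrite yN0 implybT.
have -> : y = (y `^ (p - 1)) `^ (p - 1)^-1.
  by rewrite -powRrM mulfV ?gt_eqF// powRr1// ltW.
by apply: ler_powRs; rewrite ?invr_ge0 ?powR_ge0 ?(ltW pm0).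
Qed.

End trunc_sign.

Section Lnorm_limits.
Context d (T : measurableType d) (R : realType).
Variable mu : {measure set T -> \bar R}.
Implicit Types f g h : T -> R.

(** The conclusion has the form of the bound with slack that [Lnorm_fatou] accepts. *)
Lemma Lnorm_dominated (q : R) (f_ : nat -> T -> R) f g : 0 < q ->
  (forall j, measurable_fun setT (f_ j)) -> measurable_fun setT f -> measurable_fun setT g ->
  (forall x, f_ j x @[j --> \oo] --> f x) -> (forall j x, `|f_ j x| <= g x) ->
  ('N[mu]_q%:E[EFin \o g] < +oo)%E ->
  forall e : R, 0 < e -> exists J, forall j, (J <= j)%N ->
    ('N[mu]_q%:E[EFin \o f_ j] <= 'N[mu]_q%:E[EFin \o f] + e%:E)%E.
Proof.
move=> q0 mf_ mf mg ff fg gfin e e0.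
have mp (h : T -> R) := @measurable_norm_powR _ _ R q h.
have ig : mu.-integrable setT (EFin \o (fun x => `|g x| `^ q)).
  apply/integrableP; split; first by apply/measurable_EFinP; exact: mp.
  move: gfin; rewrite (Lnorm_lty _ _ q0); apply: le_lt_trans.
  by rewrite le_eqVlt; apply/orP; left; apply/eqP; apply: eq_integral => x _ /=; rewrite ger0_norm// powR_ge0.
have fq j x : `| `|f_ j x| `^ q | <= `|g x| `^ q.
  rewrite (ger0_norm (powR_ge0 _ _)); apply: ler_powRs => //; first exact: ltW.
  exact: le_trans (fg j x) (ler_norm _).
have cpow := continuous_norm_powR q0.
have cf : {ae mu, forall x, setT x -> `|f_ k x| `^ q @[k --> \oo] --> `|f x| `^ q}.
  by apply: aeW => x _; exact: (cvg_comp _ _ (ff x) (cpow (f x))).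
have C := @dominated_cvg_Rintegral _ _ _ mu setT measurableT _ _ _ (fun j => mp _ (mf_ j)) (mp _ mf) ig cf (fun k x _ => fq k x).
have If := @dominated_integrable _ _ _ mu setT measurableT _ _ _ (fun j => mp _ (mf_ j)) (mp _ mf) ig cf (fun k x _ => fq k x).
have If_ j : mu.-integrable setT (EFin \o (fun x => `|f_ j x| `^ q)).
  by apply: le_integrable_EFin ig => //; exact: mp.
(* The absolute value changes nothing, but makes continuity of |.|^(1/q) applicable to the
   integrals. *)
have NE h : mu.-integrable setT (EFin \o (fun x => `|h x| `^ q)) ->
    'N[mu]_q%:E[EFin \o h]%E = (`|\int[mu]_x (`|h x| `^ q)| `^ q^-1)%:E.
  move=> ih; rewrite Lnorm_EFinE.
  rewrite ger0_norm; last by apply: Rintegral_ge0 => x _; exact: powR_ge0.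
  by rewrite -poweR_EFin /Rintegral fineK// integrable_fin_num.
have qV0 : 0 < q^-1 by rewrite invr_gt0.
have C2 : `|\int[mu]_x (`|f_ j x| `^ q)| `^ q^-1 @[j --> \oo] -->
    `|\int[mu]_x (`|f x| `^ q)| `^ q^-1.
  have c2 := @continuous_norm_powR R _ qV0 (\int[mu]_x (`|f x| `^ q)).
  exact: (cvg_comp _ _ C c2).
have [J _ HJ] := @cvgr_dist_le _ _ _ _ _ _ _ C2 _ e0.
exists J => j Jj; rewrite (NE _ (If_ j)) (NE _ If) -EFinD lee_fin.
have := HJ j Jj; rewrite /= => H.
by rewrite addrC -lerBlDr (le_trans _ H)// distrC ler_norm.
Qed.

Lemma Lnorm_fin_num (q : R) f : ('N[mu]_q%:E[EFin \o f] < +oo)%E ->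
  ('N[mu]_q%:E[EFin \o f])%E \is a fin_num.
Proof. by move=> ffin; rewrite ge0_fin_numE ?Lnorm_ge0. Qed.

(** The step shared by both estimates, with c = 1 for one solution and c = 2^(1-p) for the
    difference of two. *)
Lemma Lnorm_energy (p q r c : R) f z (G : T -> R) (D Y : R) : 0 < p -> 0 < q -> 0 < r ->
  q^-1 + r^-1 = 1 -> 0 < c -> 0 <= D -> measurable_fun setT f -> measurable_fun setT z ->
  mu.-integrable setT (EFin \o (fun x => `|G x| `^ p)) ->
  ('N[mu]_q%:E[EFin \o f] <= D%:E)%E -> ('N[mu]_r%:E[EFin \o z] <= Y%:E)%E ->
  c * \int[mu]_x (`|G x| `^ p) <= \int[mu]_x (f x * z x) ->
  ('N[mu]_p%:E[EFin \o G] <= ((c^-1 * (D * Y)) `^ p^-1)%:E)%E.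
Proof.
move=> p0 q0 r0 qr c0 D0 mf mz iG fD zY H.
have mfz : measurable_fun setT (fun x => f x * z x) by exact: measurable_funM.
have Ifz : (\int[mu]_x `|(f x * z x)%:E| <= (D * Y)%:E)%E.
  have := hoelder mu mf mz q0 r0 qr; rewrite Lnorm1 => h; apply: (le_trans h).
  by rewrite EFinM; apply: lee_pmul => //; exact: Lnorm_ge0.
have ifz : mu.-integrable setT (EFin \o (fun x => f x * z x)).
  by apply/integrableP; split; [exact/measurable_EFinP|apply: le_lt_trans Ifz _; exact: ltry].
rewrite Lnorm_EFinE -(fineK (integrable_fin_num measurableT iG)) poweR_EFin lee_fin.
have I0 : 0 <= \int[mu]_x (`|G x| `^ p) by apply: Rintegral_ge0 => x _; exact: powR_ge0.
apply: ler_powRs => //; first by rewrite invr_ge0 ltW.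
rewrite ler_pdivlMl//; apply: (le_trans H).
apply: le_trans (ler_norm _) _; apply: le_trans (le_normr_Rintegral measurableT ifz) _.
rewrite -lee_fin /Rintegral fineK//.
have := integrable_fin_num measurableT (integrable_abse ifz).
exact.
Qed.

End Lnorm_limits.

Section hoelder_estimate.
Context {R : realType} {n : nat}.
Notation rV := 'rV[R]_n.+2.
Notation mu := (lebesgue R n.+2).
Variables (Om : set rV) (p L : R) (V : rV -> R -> R).
Hypotheses (oOm : open Om) (OmL : Om `<=` cube L).
Hypotheses (p2 : 2 <= p) (pn : p < n.+2%:R) (hV : potential_hyp Om V).
Implicit Types (f u : rV -> R) (F G : rV -> rV).

Let mOm : measurable Om. Proof. exact: open_measurable_rV. Qed.
Let p1 : 1 < p. Proof. by move: p2; lra. Qed.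
Let p0 : 0 < p. Proof. by move: p2; lra. Qed.

Let N : R := n.+2%:R.
Let gam : R := p * (N - 1) / (N - p).
Let ps : R := sobolev_exp (n := n) p.
Let q : R := N * p / (N * p - N + p).

Let Np : 0 < N - p. Proof. by rewrite subr_gt0. Qed.
Let N0 : 0 < N. Proof. by move: p2 Np; rewrite /N; lra. Qed.
Let N1 : 0 < N - 1. Proof. by move: p2 Np; rewrite /N; lra. Qed.
Let gam0 : 0 < gam. Proof. by rewrite divr_gt0// mulr_gt0. Qed.
Let ps0 : 0 < ps. Proof. by rewrite divr_gt0// mulr_gt0. Qed.
Let den0 : 0 < N * p - N + p.
Proof. by have := mulr_gt0 N0 (_ : 0 < p - 1); move=> /(_ _); move: p2 N0; nra. Qed.
Let q0 : 0 < q. Proof. by rewrite divr_gt0// mulr_gt0. Qed.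
Let qps : q^-1 + ps^-1 = 1.
Proof.
have gen (M : R) : 0 < M - p -> 0 < M -> 0 < M * p - M + p ->
    (M * p / (M * p - M + p))^-1 + (M * p / (M - p))^-1 = 1.
  by move=> h1 h2 h3; field; rewrite !gt_eqF.
exact: gen.
Qed.

Let sobolev v G : W0p Om p v G ->
  ('N[mu]_ps%:E[EFin \o v] <= gam%:E * Lnorm_field mu p G)%E.
Proof.
by move=> WG; have := W0p_sobolev mOm OmL p2 pn WG.
Qed.

Definition solution_represents f u f' u' F W :=
  [/\ entropic_renormalized Om p V f u, gradient_represents Om p u u' F,
      represents mu Om f f' & represents mu Om (fun x => V x (u x)) W].

Lemma solution_representsP f u : entropic_renormalized Om p V f u ->
  exists f' u' F W, solution_represents f u f' u' F W.
Proof.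
move=> H; have [[mf _] uS [mV _] _] := H.
have [f' rf] := ae_measurable_represents mOm mf.
have [W rW] := ae_measurable_represents mOm mV.
by have [u' [F ruF]] := gengrad_represents oOm OmL p1 uS; exists f', u', F, W.
Qed.

Lemma solution_integrable f u f' u' F W : solution_represents f u f' u' F W ->
  mu.-integrable setT (EFin \o f') /\ mu.-integrable setT (EFin \o W).
Proof.
move=> [[[_ fL] _ [_ VL] _] _ rf rW].
by split; [exact: represents_integrable rf fL|exact: represents_integrable rW VL].
Qed.

Lemma measurable_plaplacian F G : measurable_field F ->
  measurable_field G ->
  measurable_fun setT (fun x => enorm (F x) `^ (p - 2) * dotr (F x) (G x)).
Proof.
move=> mF mG; apply: measurable_funM; last exact: measurable_dotr.
exact: (measurableT_comp (measurable_powR _) (measurable_enorm mF)).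
Qed.

Lemma enorm_powR_integrable F : measurable_field F ->
  (Lnorm_field mu p F < +oo)%E ->
  mu.-integrable setT (EFin \o (fun x => enorm (F x) `^ p)).
Proof.
move=> mF; rewrite (Lnorm_lty _ _ p0) => Ffin; apply/integrableP; split.
  apply/measurable_EFinP.
  exact: (measurableT_comp (measurable_powR _) (measurable_enorm mF)).
apply: le_lt_trans Ffin; rewrite le_eqVlt; apply/orP; left; apply/eqP.
by apply: eq_integral => x _ /=; rewrite (ger0_norm (enorm_ge0 _)) ger0_norm// powR_ge0.
Qed.

Lemma cutoff_eq k u F x : `|u x| < k -> cutoff k u F x = F x.
Proof. by rewrite /cutoff => ->. Qed.

Lemma near_lt_natr (a : R) : \forall j \near \oo, a < j.+1%:R.
Proof.
exists (Num.truncn `|a|) => // j /= aj.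
rewrite (le_lt_trans (ler_norm a))//; have /andP[_ h] := truncn_itv (normr_ge0 a).
by rewrite (lt_le_trans h)// ler_nat ltnS.
Qed.

Lemma enorm_cutoff_le k u F x : enorm (cutoff k u F x) <= enorm (F x).
Proof. by rewrite /cutoff; case: ifP => // _; rewrite enorm0 enorm_ge0. Qed.

Lemma solution_gradient_Lp f u f' u' F W : solution_represents f u f' u' F W ->
  ('N[mu]_q%:E[EFin \o f'] < +oo)%E ->
  (Lnorm_field mu p F < +oo)%E.
Proof.
move=> sol fq; have [if_ iW] := solution_integrable sol.
have [ent grF rf rW] := sol; have [ru mF F0 uF WF] := grF.
have [mf _ _] := rf; have [mW W0 VW] := rW; have [mu' u'0 uu'] := ru.
have mGk k i : measurable_fun setT (fun x => cutoff k u' F x 0 i) by exact: measurable_cutoff.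
pose D := fine ('N[mu]_q%:E[EFin \o f'])%E.
have D0 : 0 <= D by rewrite fine_ge0 ?Lnorm_ge0.
have DE : ('N[mu]_q%:E[EFin \o f'] = D%:E)%E by rewrite fineK// Lnorm_fin_num.
have bound k : 0 < k ->
    ('N[mu]_p%:E[EFin \o (fun x => enorm (cutoff k u' F x))] <= ((D * gam) `^ (p - 1)^-1)%:E)%E.
  (* Finiteness for a fixed level is what permits the absorption; the bound obtained no longer
     depends on [k]. *)
  move=> k0; have Gfin := W0p_lty p2 (WF k k0).
  pose y := fine ('N[mu]_p%:E[EFin \o (fun x => enorm (cutoff k u' F x))])%E.
  have y0 : 0 <= y by rewrite fine_ge0 ?Lnorm_ge0.
  have yE : ('N[mu]_p%:E[EFin \o (fun x => enorm (cutoff k u' F x))] = y%:E)%E.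
    by rewrite fineK// Lnorm_fin_num.
  rewrite yE lee_fin; apply: powR_absorb => //; first by rewrite mulr_ge0 ?(ltW gam0).
  rewrite -lee_fin -yE -mulrA -[D * _]mul1r -[X in (X * _) `^ _]invr1.
  have mTu : measurable_fun setT (fun x => trunc k (u' x)).
    exact: (measurableT_comp (measurable_trunc k0) mu').
  apply: (@Lnorm_energy _ _ _ mu p q ps 1 f' (fun x => trunc k (u' x)) _ D (gam * y) p0 q0 ps0 qps ltr01 D0 mf mTu).
  - rewrite (_ : EFin \o _ = EFin \o (fun x => enorm (cutoff k u' F x) `^ p)).
      by apply: enorm_powR_integrable.
    by apply/funext => x /=; rewrite (ger0_norm (enorm_ge0 _)).
  - by rewrite DE.
  - by rewrite (EFinM gam y) -yE; exact: sobolev (WF k k0).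
  have r0 : represents mu Om (cst 0) (cst 0 : rV -> R) by split => //; exact: aeW.
  have b0 : inLp mu Om +oo%E (cst 0).
    split; first exact: represents_ae_measurable r0.
    by apply: (@normLp_oo_lty _ _ _ _ _ _ 0) => x _; rewrite normr0.
  have := entropic_identity oOm OmL p1 ent grF rf rW (inW10_cst0 oOm OmL p0) b0 r0
    (W0p_cst0 _ p0) (h := 0) _ k0.
  rewrite (_ : (fun x => u' x - cst 0 x) = u'); last by apply/funext => x; rewrite subr0.
  rewrite (_ : (fun x => F x - cst 0 x) = F); last by apply/funext => x; rewrite subr0.
  under [in X in _ -> X]eq_Rintegral do rewrite (ger0_norm (enorm_ge0 _)).
  under [X in _ + X = _]eq_Rintegral do rewrite subr0.
  under [X in _ = X]eq_Rintegral do rewrite subr0.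
  have c0 (x : rV) : `|cst (0 : R) x| <= 0 by rewrite normr0.
  move=> /(_ c0) <-.
  rewrite mul1r (@eq_Rintegral _ _ _ mu setT (fun x => enorm (cutoff k u' F x) `^ p)
    (fun x => enorm (F x) `^ (p - 2) * dotr (F x) (cutoff k u' F x))); last first.
    move=> x _; rewrite /cutoff; case: ifP => _; first by rewrite powR_enorm.
    by rewrite enorm0 powR0 ?gt_eqF// /dotr big1 ?mulr0// => i _; rewrite mxE mulr0.
  rewrite lerDl.
  (* The product is nonnegative only almost everywhere, so it is exchanged for its absolute
     value. *)
  rewrite (@ae_eq_Rintegral_on _ _ _ mu setT _ (fun x => `|W x * trunc k (u' x)|)).
  - by apply: Rintegral_ge0.
  - apply: filterS3 uu' VW hV.2 => x ux Wx Vx _; rewrite ger0_norm//.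
    have [Ox|Ox] := pselect (Om x); last by rewrite W0// mul0r.
    have [_ Vm V0] := Vx Ox; rewrite -Wx// -ux//.
    by have := monotone_trunc_ge0 (u x) 0 Vm k0; rewrite V0 !subr0.
  - by move=> x /(_ I).
apply: le_lt_trans (ltry ((D * gam) `^ (p - 1)^-1)).
apply: (@Lnorm_fatou _ _ _ mu p (fun j x => enorm (cutoff j.+1%:R u' F x))) => //.
- by move=> j; exact: measurable_enorm.
- exact: measurable_enorm.
- apply: aeW => x; apply: cvg_near_cst.
  by apply: filterS (near_lt_natr `|u' x|) => j h; rewrite cutoff_eq.
- move=> e e0; exists 0%N => j _; apply: le_trans (bound _ (ltr0Sn R j)) _.
  by rewrite leeDl// lee_fin ltW.
Qed.

Lemma plaplacian_cutoff_le k u F G G' x : enorm (G' x) <= enorm (G x) ->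
  `|enorm (F x) `^ (p - 2) * dotr (F x) (cutoff k u (fun x => F x - G' x) x)| <=
  2 * (enorm (F x) `^ p + enorm (G x) `^ p).
Proof.
move=> GG; rewrite /cutoff; case: ifP => _; first exact: plaplacian_bound.
(* Off the cutoff set the vector is 0 = 0 - 0, to which the same bound applies. *)
rewrite -[0](subrr (0 : rV)); apply: plaplacian_bound => //; rewrite enorm0; exact: enorm_ge0.
Qed.

Lemma plaplacian_dominating F G : measurable_field F ->
  measurable_field G ->
  (Lnorm_field mu p F < +oo)%E ->
  (Lnorm_field mu p G < +oo)%E ->
  mu.-integrable setT (EFin \o (fun x => 2 * (enorm (F x) `^ p + enorm (G x) `^ p))).
Proof.
move=> mF mG Fp Gp; apply: integrableZ_EFin => //; apply: integrableD_EFin => //.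
  exact: enorm_powR_integrable.
exact: enorm_powR_integrable.
Qed.

Lemma measurable_cutoffB k u F G i : measurable_fun setT u ->
  measurable_field F ->
  measurable_field G ->
  measurable_fun setT (fun x => cutoff k u (fun x => F x - G x) x 0 i).
Proof.
move=> mu_ mF mG; apply: measurable_cutoff => //.
by under eq_fun do rewrite !mxE; exact: measurable_funB.
Qed.

Lemma plaplacian_integrable k u F G : measurable_fun setT u ->
  measurable_field F ->
  measurable_field G ->
  (Lnorm_field mu p F < +oo)%E ->
  (Lnorm_field mu p G < +oo)%E ->
  mu.-integrable setT (EFin \o (fun x => enorm (F x) `^ (p - 2) *
    dotr (F x) (cutoff k u (fun x => F x - G x) x))).
Proof.
move=> mu_ mF mG Fp Gp; apply: (le_integrable_EFin measurableT _ _ (plaplacian_dominating mF mG Fp Gp)).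
  by apply: measurable_plaplacian => // i; exact: measurable_cutoffB.
by move=> x _; exact: plaplacian_cutoff_le.
Qed.

Lemma trunc_integrable k f u : 0 < k -> measurable_fun setT u ->
  mu.-integrable setT (EFin \o f) ->
  mu.-integrable setT (EFin \o (fun x => f x * trunc k (u x))).
Proof.
move=> k0 mu_ if_; rewrite (_ : (fun x => _) = (fun x => trunc k (u x) * f x)); last first.
  by apply/funext => x; rewrite mulrC.
apply: (@integrable_bddM _ _ _ mu setT _ _ k) => //; last by move=> x _; exact: trunc_le.
exact: (measurableT_comp (measurable_trunc k0) mu_).
Qed.

(* The identity with phi = trunc h u2, in the limit h -> oo. *)
Lemma entropic_difference k f1 u1 f1' u1' F1 W1 u2 u2' F2 :
  solution_represents f1 u1 f1' u1' F1 W1 -> inS10 Om p u2 ->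
  gradient_represents Om p u2 u2' F2 ->
  (Lnorm_field mu p F1 < +oo)%E ->
  (Lnorm_field mu p F2 < +oo)%E -> 0 < k ->
  \int[mu]_x (enorm (F1 x) `^ (p - 2) *
    dotr (F1 x) (cutoff k (fun x => u1' x - u2' x) (fun x => F1 x - F2 x) x)) +
  \int[mu]_x (W1 x * trunc k (u1' x - u2' x)) =
  \int[mu]_x (f1' x * trunc k (u1' x - u2' x)).
Proof.
move=> sol S2 gr2 F1p F2p k0; have [if1 iW1] := solution_integrable sol.
have [ent gr1 rf rW] := sol.
have [[mu1 _ _] mF1 _ _ _] := gr1; have [[mu2 u20 uu2] mF2 F20 _ WF2] := gr2.
have [_ _ TS2 _] := S2.
pose h (j : nat) : R := j.+1%:R; have h0 j : 0 < h j by exact: ltr0Sn.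
have mTh j : measurable_fun setT (fun x => trunc (h j) (u2' x)).
  exact: (measurableT_comp (measurable_trunc (h0 j)) mu2).
have mFh j i : measurable_fun setT (fun x => cutoff (h j) u2' F2 x 0 i) by exact: measurable_cutoff.
have mz j : measurable_fun setT (fun x => u1' x - trunc (h j) (u2' x)) by exact: measurable_funB.
have mz0 : measurable_fun setT (fun x => u1' x - u2' x) by exact: measurable_funB.
have id j : \int[mu]_x (enorm (F1 x) `^ (p - 2) *
    dotr (F1 x) (cutoff k (fun x => u1' x - trunc (h j) (u2' x))
      (fun x => F1 x - cutoff (h j) u2' F2 x) x)) +
    \int[mu]_x (W1 x * trunc k (u1' x - trunc (h j) (u2' x))) =
    \int[mu]_x (f1' x * trunc k (u1' x - trunc (h j) (u2' x))).
  have rT : represents mu Om (fun x => trunc (h j) (u2 x)) (fun x => trunc (h j) (u2' x)).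
    split => //; first by move=> x /u20 ->; rewrite trunc0.
    by apply: filterS uu2 => x e Ox; rewrite e.
  have bT : inLp mu Om +oo%E (fun x => trunc (h j) (u2 x)).
    split; first exact: represents_ae_measurable rT.
    by apply: (@normLp_oo_lty _ _ _ _ _ _ (h j)) => x _; exact: trunc_le.
  apply: (entropic_identity oOm OmL p1 ent gr1 rf rW (TS2 _ (h0 j)) bT rT (WF2 _ (h0 j)) _ k0 (h := h j)).
  by move=> x; exact: trunc_le.
(* At a fixed point both truncation and cutoff are eventually inactive, so every pointwise limit
   below is that of an eventually constant sequence. *)
have nearE x : \forall j \near \oo, trunc (h j) (u2' x) = u2' x /\ cutoff (h j) u2' F2 x = F2 x.
  apply: filterS (near_lt_natr `|u2' x|) => j uj.
  by rewrite trunc_id ?cutoff_eq// ltW.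
have C1 := @dominated_cvg_Rintegral _ _ _ mu setT measurableT _
  (fun x => enorm (F1 x) `^ (p - 2) * dotr (F1 x) (cutoff k (fun x => u1' x - u2' x) (fun x => F1 x - F2 x) x))
  _ (fun j => measurable_plaplacian mF1 (fun i => measurable_cutoffB k i (mz j) mF1 (mFh j)))
  (measurable_plaplacian mF1 (fun i => measurable_cutoffB k i mz0 mF1 mF2))
  (plaplacian_dominating mF1 mF2 F1p F2p) _
  (fun j x _ => plaplacian_cutoff_le k _ F1 (enorm_cutoff_le (h j) u2' F2 x)).
have C2 g : mu.-integrable setT (EFin \o g) ->
    \int[mu]_x (g x * trunc k (u1' x - trunc (h j) (u2' x))) @[j --> \oo] -->
    \int[mu]_x (g x * trunc k (u1' x - u2' x)).
  move=> ig.
  apply: (@dominated_cvg_Rintegral _ _ _ mu setT measurableT _ _ (fun x => k * `|g x|)).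
  - by move=> j; exact: integrable_measurable (trunc_integrable k0 (mz j) ig).
  - exact: integrable_measurable (trunc_integrable k0 mz0 ig).
  - by apply: integrableZ_EFin => //; exact: integrable_abse ig.
  - apply: aeW => x _; apply: cvg_near_cst; apply: filterS (nearE x) => j [-> _].
    by [].
  - by move=> j x _; rewrite normrM mulrC ler_wpM2r// trunc_le.
have C : \int[mu]_x (f1' x * trunc k (u1' x - trunc (h j) (u2' x))) @[j --> \oo] -->
    \int[mu]_x (enorm (F1 x) `^ (p - 2) *
      dotr (F1 x) (cutoff k (fun x => u1' x - u2' x) (fun x => F1 x - F2 x) x)) +
    \int[mu]_x (W1 x * trunc k (u1' x - u2' x)).
  rewrite -(funext id); apply: cvgD; last exact: C2.
  apply: C1; apply: aeW => x _; apply: cvg_near_cst; apply: filterS (nearE x) => j [e1 e2].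
  by rewrite /cutoff -/(cutoff (h j) u2' F2 x) e1 e2.
exact: (cvg_unique (@Rhausdorff R) C (C2 _ if1)).
Qed.

(** The difference itself is not known to be approximable. The inequality is used for differences of
    truncations; Fatou handles the left-hand side and dominated convergence the right, the gradients
    being in L^p. *)
Lemma sobolev_difference u1 u1' F1 u2 u2' F2 :
  gradient_represents Om p u1 u1' F1 -> gradient_represents Om p u2 u2' F2 ->
  (Lnorm_field mu p F1 < +oo)%E ->
  (Lnorm_field mu p F2 < +oo)%E ->
  ('N[mu]_ps%:E[EFin \o (fun x => u1' x - u2' x)%R] <=
   gam%:E * 'N[mu]_p%:E[EFin \o (fun x => enorm (F1 x - F2 x)%R)])%E.
Proof.
move=> [[mu1 _ _] mF1 _ _ WF1] [[mu2 _ _] mF2 _ _ WF2] F1p F2p.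
have mT (u : rV -> R) j : measurable_fun setT u -> measurable_fun setT (fun x => trunc j.+1%:R (u x)).
  exact: (measurableT_comp (measurable_trunc (ltr0Sn R j))).
have mB (F G : rV -> rV) : measurable_field F ->
    measurable_field G ->
    measurable_fun setT (fun x => enorm (F x - G x)).
  move=> mF mG; apply: measurable_enorm => i.
  by under eq_fun do rewrite !mxE; exact: measurable_funB.
apply: (Lnorm_fatou ps0 (f_ := fun j x => trunc j.+1%:R (u1' x) - trunc j.+1%:R (u2' x))).
- by move=> j; apply: measurable_funB; exact: mT.
- exact: measurable_funB.
- apply: aeW => x; apply: cvg_near_cst.
  apply: filterS2 (near_lt_natr `|u1' x|) (near_lt_natr `|u2' x|) => j h1 h2.
  by rewrite !trunc_id// ltW.
move=> e e0.
(* The error is multiplied by the Sobolev constant [gam] further on. *)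
have eg : 0 < e / gam by rewrite divr_gt0.
have mD : measurable_fun setT (fun x => enorm (F1 x) + enorm (F2 x)).
  by apply: measurable_funD; exact: measurable_enorm.
have [|||||J HJ] := @Lnorm_dominated _ _ _ mu p
  (fun j x => enorm (cutoff j.+1%:R u1' F1 x - cutoff j.+1%:R u2' F2 x))
  (fun x => enorm (F1 x - F2 x)) (fun x => enorm (F1 x) + enorm (F2 x)) p0 _ _ mD _ _ _ _ eg.
- by move=> j; apply: mB => i; exact: measurable_cutoff.
- exact: mB.
- move=> x; apply: cvg_near_cst.
  apply: filterS2 (near_lt_natr `|u1' x|) (near_lt_natr `|u2' x|) => j h1 h2.
  by rewrite !cutoff_eq.
- move=> j x; rewrite (ger0_norm (enorm_ge0 _)) (le_trans (enormD _ _))// enormN.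
  by rewrite lerD// enorm_cutoff_le.
- apply: le_lt_trans (Lnorm_triangle mu (ltW p1) mD (measurable_enorm mF1) (measurable_enorm mF2) _) _.
    by move=> x; exact: ler_normD.
  by rewrite lte_add_pinfty.
exists J => j Jj.
apply: le_trans (sobolev (W0pB p1 (WF1 _ (ltr0Sn R j)) (WF2 _ (ltr0Sn R j)))) _.
apply: (@le_trans _ _ (gam%:E * ('N[mu]_p%:E[EFin \o (fun x => enorm (F1 x - F2 x)%R)] + (e / gam)%:E))%E).
  by apply: lee_wpmul2l; [rewrite lee_fin ltW|exact: HJ].
have eg0 : (0 <= (e / gam)%:E)%E by rewrite lee_fin ltW.
rewrite (ge0_muleDr _ (Lnorm_ge0 _ _ _) eg0) -EFinM.
by have -> : gam * (e / gam) = e by field; rewrite gt_eqF.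
Qed.

(** For each [k] the bound carries on its right the norm [y] of the full difference, since |trunc k
    w| <= |w|. Fatou's lemma brings [y] to the left as well, and only then is it absorbed. *)
Lemma gradient_difference f1 u1 f1' u1' F1 W1 f2 u2 f2' u2' F2 W2 (D : R) :
  solution_represents f1 u1 f1' u1' F1 W1 -> solution_represents f2 u2 f2' u2' F2 W2 ->
  (Lnorm_field mu p F1 < +oo)%E ->
  (Lnorm_field mu p F2 < +oo)%E ->
  ('N[mu]_q%:E[EFin \o (fun x => f1' x - f2' x)%R] <= D%:E)%E -> 0 <= D ->
  ('N[mu]_p%:E[EFin \o (fun x => enorm (F1 x - F2 x)%R)] <=
   ((((2 `^ (1 - p))^-1 * gam) * D) `^ (p - 1)^-1)%:E)%E.
Proof.
move=> sol1 sol2 F1p F2p fD D0.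
have [if1 iW1] := solution_integrable sol1; have [if2 iW2] := solution_integrable sol2.
have [ent1 gr1 rf1 [_ W10 VW1]] := sol1; have [ent2 gr2 rf2 [_ W20 VW2]] := sol2.
have [[mu1 u10 uu1] mF1 _ _ _] := gr1; have [[mu2 u20 uu2] mF2 _ _ _] := gr2.
have [_ S1 _ _] := ent1; have [_ S2 _ _] := ent2.
have mFB i : measurable_fun setT (fun x => (F1 x - F2 x) 0 i).
  by under eq_fun do rewrite !mxE; exact: measurable_funB.
have Bfin : ('N[mu]_p%:E[EFin \o (fun x => enorm (F1 x - F2 x)%R)] < +oo)%E.
  apply: le_lt_trans (@Lnorm_enormB _ _ _ mu p _ (fun x => F1 x - F2 x) F1 F2 (ltW p1) mF1 mF2 (fun x => erefl)) _.
  by rewrite lte_add_pinfty.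
pose y := fine ('N[mu]_p%:E[EFin \o (fun x => enorm (F1 x - F2 x)%R)])%E.
have y0 : 0 <= y by rewrite fine_ge0 ?Lnorm_ge0.
have yE : ('N[mu]_p%:E[EFin \o (fun x => enorm (F1 x - F2 x)%R)] = y%:E)%E.
  by rewrite fineK// Lnorm_fin_num.
pose c : R := 2 `^ (1 - p); have c0 : 0 < c by rewrite powR_gt0.
pose w x := u1' x - u2' x; have mw : measurable_fun setT w by exact: measurable_funB.
pose G k := cutoff k w (fun x => F1 x - F2 x).
have mG k i : measurable_fun setT (fun x => G k x 0 i) by exact: measurable_cutoffB.
rewrite yE lee_fin; apply: powR_absorb => //.
  by apply: mulr_ge0 => //; apply: mulr_ge0; rewrite ?invr_ge0 ltW.
rewrite -lee_fin -yE (_ : _ * D * y = c^-1 * (D * (gam * y))); last by rewrite /c; ring.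
suff bound k : 0 < k ->
    ('N[mu]_p%:E[EFin \o (fun x => enorm (G k x))] <= ((c^-1 * (D * (gam * y))) `^ p^-1)%:E)%E.
  apply: (@Lnorm_fatou _ _ _ mu p (fun j x => enorm (G j.+1%:R x))) => //.
  - by move=> j; exact: measurable_enorm.
  - exact: measurable_enorm.
  - apply: aeW => x; apply: cvg_near_cst.
    by apply: filterS (near_lt_natr `|w x|) => j h; rewrite /G cutoff_eq.
  - move=> e e0; exists 0%N => j _; apply: le_trans (bound _ (ltr0Sn R j)) _.
    by rewrite leeDl// lee_fin ltW.
move=> k0.
have mTw : measurable_fun setT (fun x => trunc k (w x)).
  exact: (measurableT_comp (measurable_trunc k0) mw).
have GE : (fun x => `|enorm (G k x)| `^ p) = (fun x => enorm (G k x) `^ p).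
  by apply/funext => x; rewrite (ger0_norm (enorm_ge0 _)).
have Gp : ('N[mu]_p%:E[EFin \o (fun x => enorm (G k x))] < +oo)%E.
  apply: le_lt_trans Bfin; apply: le_Lnorm => //; try exact: measurable_enorm.
  by move=> x; rewrite !(ger0_norm (enorm_ge0 _)) enorm_cutoff_le.
have iG := enorm_powR_integrable (mG k) Gp.
apply: (@Lnorm_energy _ _ _ mu p q ps c (fun x => f1' x - f2' x) (fun x => trunc k (w x)) _ D (gam * y)
  p0 q0 ps0 qps c0 D0 _ mTw _ fD).
- exact: measurable_funB (integrable_measurable if1) (integrable_measurable if2).
- by rewrite GE.
- rewrite (EFinM gam y) -yE; apply: le_trans (sobolev_difference gr1 gr2 F1p F2p).
  by apply: le_Lnorm => // x; exact: trunc_le_norm.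
rewrite GE -RintegralZl//.
have E1 := entropic_difference sol1 S2 gr2 F1p F2p k0.
have E2 := entropic_difference sol2 S1 gr1 F2p F1p k0.
pose A1 x := enorm (F1 x) `^ (p - 2) * dotr (F1 x) (G k x).
pose A2 x := enorm (F2 x) `^ (p - 2) * dotr (F2 x) (G k x).
have swap x : u2' x - u1' x = - w x by rewrite /w opprB.
have Gswap x : cutoff k (fun x => u2' x - u1' x) (fun x => F2 x - F1 x) x = - G k x.
  by rewrite /G /cutoff swap normrN; case: ifP => _; rewrite ?oppr0// opprB.
have dN (a b : rV) : dotr a (- b) = - dotr a b by rewrite -[- b]scaleN1r dotrZr mulN1r.
have iA1 : mu.-integrable setT (EFin \o A1) by exact: plaplacian_integrable.
have iA2 : mu.-integrable setT (EFin \o A2).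
  have := integrableZ_EFin (-1) measurableT (plaplacian_integrable k (measurable_funB mu2 mu1) mF2 mF1 F2p F1p).
  by congr (_.-integrable _ (_ \o _)); apply/funext => x; rewrite Gswap /A2 dN; ring.
have iT g : mu.-integrable setT (EFin \o g) -> mu.-integrable setT (EFin \o (fun x => g x * trunc k (w x))).
  exact: trunc_integrable.
(* Both the truncation and the cut-off difference of gradients are odd in the exchange of the two
   solutions, so the second identity, written with the test function of the first, is to be
   subtracted. *)
have {}E2 : - (\int[mu]_x (A2 x)) + - (\int[mu]_x (W2 x * trunc k (w x))) =
    - (\int[mu]_x (f2' x * trunc k (w x))).
  have neg g : mu.-integrable setT (EFin \o g) -> - (\int[mu]_x (g x)) = \int[mu]_x (-1 * g x).
    by move=> ig; rewrite RintegralZl// mulN1r.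
  rewrite (neg _ iA2) (neg _ (iT _ iW2)) (neg _ (iT _ if2)).
  move: E2; congr (_ + _ = _); apply: eq_Rintegral => x _.
  - by rewrite Gswap /A2 dN; ring.
  - by rewrite swap truncN; ring.
  - by rewrite swap truncN; ring.
have E : \int[mu]_x (A1 x - A2 x) + \int[mu]_x (W1 x * trunc k (w x) - W2 x * trunc k (w x)) =
    \int[mu]_x ((f1' x - f2' x) * trunc k (w x)).
  rewrite (RintegralB measurableT iA1 iA2) (RintegralB measurableT (iT _ iW1) (iT _ iW2)).
  under [X in _ = X]eq_Rintegral do rewrite mulrBl.
  rewrite (RintegralB measurableT (iT _ if1) (iT _ if2)) -E1 -E2.
  by rewrite -/(A1) addrACA.
rewrite -E; apply: (@le_trans _ _ (\int[mu]_x (A1 x - A2 x))).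
  apply: le_Rintegral => //.
  - exact: integrableZ_EFin.
  - exact: integrableB_EFin.
  move=> x _; rewrite /A1 /A2 /G /cutoff; case: ifP => _; first exact: plaplacian_monotone.
  rewrite enorm0 powR0 ?gt_eqF// mulr0 /dotr !big1 ?mulr0 ?subrr// => i _; by rewrite mxE mulr0.
rewrite lerDl.
rewrite (@ae_eq_Rintegral_on _ _ _ mu setT _ (fun x => `|W1 x * trunc k (w x) - W2 x * trunc k (w x)|)).
- by apply: Rintegral_ge0.
- have aeV : {ae mu, forall x, Om x -> [/\ V x (u1 x) = W1 x, V x (u2 x) = W2 x &
      {homo V x : s t / s <= t}]}.
    by apply: filterS3 VW1 VW2 hV.2 => x a b c' Ox; have [_ ? _] := c' Ox; rewrite a// b.
  apply: filterS3 uu1 uu2 aeV => x ux1 ux2 Vx _; rewrite ger0_norm//.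
  have [Ox|Ox] := pselect (Om x); last by rewrite W10// W20// mul0r subrr.
  have [Wx1 Wx2 Vm] := Vx Ox; rewrite -mulrBl -Wx1 -Wx2 /w -ux1// -ux2//.
  exact: monotone_trunc_ge0.
- by move=> x /(_ I).
Qed.

End hoelder_estimate.

Theorem theorem7p4 (R : realType) (n : nat) (Om : set 'rV[R]_n) (p : R)
    (V : 'rV[R]_n -> R -> R)
    (hOm : bounded_smooth_domain Om)
    (hp : 2 <= p) (hpn : p < n%:R)
    (hV : potential_hyp Om V) :
  let q : R := n%:R * p / (n%:R * p - n%:R + p) in
  (forall f u : 'rV[R]_n -> R,
     inLp (lebesgue R n) Om q%:E f -> entropic_renormalized Om p V f u ->
     inLp_vec Om p%:E (gengrad Om u)) /\
  exists c : R, 0 < c /\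
    forall f1 f2 u1 u2 : 'rV[R]_n -> R,
      inLp (lebesgue R n) Om q%:E f1 -> inLp (lebesgue R n) Om q%:E f2 ->
      entropic_renormalized Om p V f1 u1 ->
      entropic_renormalized Om p V f2 u2 ->
      (normLp_vec Om p%:E (fun x => gengrad Om u1 x - gengrad Om u2 x)%R
       <= c%:E * normLp (lebesgue R n) Om q%:E (fun x => f1 x - f2 x)%R
                   `^ (p - 1)^-1)%E.
Proof.
(* Since 2 <= p < n, dimensions 0 and 1 are excluded, and the remaining ones have the form [m.+2]
   used above. *)
case: n Om V hOm hpn hV => [|[|m]] Om V hOm hpn hV.
- by exfalso; move: hp hpn; lra.
- by exfalso; move: hp hpn; lra.
move=> q; have [_ oOm _ bOm _] := hOm; have [L OmL] := bounded_sub_cube bOm.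
have p0 : 0 < p by lra.
pose mu := lebesgue R m.+2.
have Lp f u f' u' F W : solution_represents Om p V f u f' u' F W ->
    inLp mu Om q%:E f -> ('N[mu]_q%:E[EFin \o f'] < +oo)%E.
  by move=> [_ _ [_ f0 ff'] _] [_]; rewrite (@normLpE _ _ _ mu Om q f f' ff' f0).
split.
  move=> f u fq ent; have [f' [u' [F [W sol]]]] := solution_representsP oOm OmL hp ent.
  have Fp := solution_gradient_Lp oOm OmL hp hpn hV sol (Lp _ _ _ _ _ _ sol fq).
  have [_ [_ mF F0 uF _] _ _] := sol; split.
    by move=> i; exists (fun x => F x 0 i); [exact: measurable_funTS|apply: filterS uF => x h Ox; rewrite h].
  rewrite /normLp_vec (@normLpE _ _ _ mu Om p _ (fun x => enorm (F x)))//.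
    by apply: filterS uF => x h Ox /=; rewrite h.
  by move=> x Ox; rewrite F0// enorm0.
pose gam := p * (m.+2%:R - 1) / (m.+2%:R - p).
(* Equal to 2 gam^(1/(p-1)). *)
pose c := ((2 `^ (1 - p))^-1 * gam) `^ (p - 1)^-1.
have Np : 0 < m.+2%:R - p by rewrite subr_gt0.
have gam0 : 0 < gam by rewrite divr_gt0// mulr_gt0//; lra.
have c20 : 0 < (2 `^ (1 - p))^-1 by rewrite invr_gt0 powR_gt0.
exists c; split; first by apply: powR_gt0; exact: mulr_gt0.
move=> f1 f2 u1 u2 f1q f2q ent1 ent2.
have [f1' [u1' [F1 [W1 sol1]]]] := solution_representsP oOm OmL hp ent1.
have [f2' [u2' [F2 [W2 sol2]]]] := solution_representsP oOm OmL hp ent2.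
have f1fin := Lp _ _ _ _ _ _ sol1 f1q; have f2fin := Lp _ _ _ _ _ _ sol2 f2q.
have F1p := solution_gradient_Lp oOm OmL hp hpn hV sol1 f1fin.
have F2p := solution_gradient_Lp oOm OmL hp hpn hV sol2 f2fin.
have [_ [_ _ F10 uF1 _] [mf1 f10 ff1] _] := sol1.
have [_ [_ _ F20 uF2 _] [mf2 f20 ff2] _] := sol2.
rewrite /normLp_vec (@normLpE _ _ _ mu Om p _ (fun x => enorm (F1 x - F2 x))); last 2 first.
- by apply: filterS2 uF1 uF2 => x h1 h2 Ox /=; rewrite h1// h2.
- by move=> x Ox; rewrite F10// F20// subrr enorm0.
rewrite (@normLpE _ _ _ mu Om q _ (fun x => f1' x - f2' x)); last 2 first.
- by apply: filterS2 ff1 ff2 => x h1 h2 Ox /=; rewrite h1// h2.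
- by move=> x Ox; rewrite f10// f20// subrr.
(* Needed for Minkowski's inequality, which makes the norm of f1 - f2 finite; it amounts to p <=
   n. *)
have q1 : 1 <= q.
  have m0 : 0 < m.+2%:R * p - m.+2%:R + p :> R by move: Np p0 hp; nra.
  by rewrite /q ler_pdivlMr// mul1r; move: Np; lra.
have Dfin : ('N[mu]_q%:E[EFin \o (fun x => f1' x - f2' x)%R] < +oo)%E.
  apply: le_lt_trans (Lnorm_triangle mu q1 (measurable_funB mf1 mf2) mf1 mf2 _) _.
    by move=> x; exact: ler_normB.
  by rewrite lte_add_pinfty.
have DE := fineK (Lnorm_fin_num Dfin); have := gradient_difference oOm OmL hp hpn hV sol1 sol2 F1p F2p.
rewrite -DE => /(_ _ (lexx _) (fine_ge0 (Lnorm_ge0 _ _ _))) H; apply: (le_trans H).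
by rewrite poweR_EFin -EFinM lee_fin powRM ?fine_ge0 ?Lnorm_ge0// ltW// mulr_gt0.
Qed.
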